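(* Let $A$ be a jointly measurable stationary random field on $\mathbb{R}^d$ with $\mathbb{E}[|A(0)|^2]<\infty$, and let $\mathcal{C}(x):=\mathrm{Cov}[A(0);A(x)]$ denote its covariance function. Let $\tilde\partial$ denote either the oscillation $\partial^{\mathrm{osc}}$ or the functional derivative $\partial^{\mathrm{fct}}$; when $\tilde\partial=\partial^{\mathrm{osc}}$, assume in addition that $A$ is bounded (by a deterministic constant). Then: (i) If $A$ satisfies ($\tilde\partial$-SG) (with some radius $R>0$ and some constant) and if $\mathcal{C}$ is nonnegative, then $\mathcal{C}$ is integrable on $\mathbb{R}^d$. (ii) If $A$ satisfies ($\tilde\partial$-MSG) with weight $\pi$ and if $\mathcal{C}$ is nonnegative, then $\mathcal{C}$ is integrable whenever $\int_0^\infty \ell^d\pi(\ell)\,d\ell<\infty$. More generally, for every $\alpha\ge 0$ there is a constant $C_\alpha$ such that $$\int_{\mathbb{R}^d}(1+|x|)^{-\alpha}\,\mathcal{C}(x)\,dx\le C_\alpha\begin{cases}\int_0^\infty(\ell+1)^{d-\alpha}\pi(\ell)\,d\ell,&\text{if }0\le\alpha<d;\\ \int_0^\infty\log^2(2+\ell)\,\pi(\ell)\,d\ell,&\text{if }\alpha=d;\\ \int_0^\infty\pi(\ell)\,d\ell,&\text{if }\alpha>d.\end{cases}$$ (iii) If $A$ satisfies ($\tilde\partial$-CI) with radius $R+\varepsilon$ for all $\varepsilon>0$ (the constant being allowed to depend on $\varepsilon$), then the range of dependence of $A$ is bounded by $2R$, that is, for all Borel subsets $S,T\subset\mathbb{R}^d$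 with $d(S,T)>2R$ the restrictions $A|_S$ and $A|_T$ are independent. (iv) If $A$ satisfies ($\tilde\partial$-MCI) with weight $\pi$, then there is a constant $C$ such that for all $x\in\mathbb{R}^d$, $$|\mathcal{C}(x)|\le C\int_{\frac12(|x|-2)\vee 0}^\infty\pi(\ell)\,d\ell.$$ Here $C$ depends only on $d$ (and, if $\tilde\partial=\partial^{\mathrm{osc}}$, on the deterministic bound on $A$), and $C_\alpha$ depends in addition on $\alpha$.
   Context: $B_r(x)$ denotes the Euclidean ball of radius $r$ centered at $x\in\mathbb{R}^d$, $B_r:=B_r(0)$; $a\vee b:=\max\{a,b\}$. Random field. $A:\mathbb{R}^d\times\Omega\to\mathbb{R}$ is a jointly measurable random field on a probability space $(\Omega,\mathcal{A},\mathbb{P})$, stationary: for all $z\in\mathbb{R}^d$, $A(\cdot+z,\cdot)$ has the same finite-dimensional distributions as $A$. $X(A),Y(A)$ denote real $\sigma(A)$-measurable random variables. Oscillation. For a Borel set $S\subset\mathbb{R}^d$, $\partial^{\mathrm{osc}}_{A,S}X(A):=\mathcal{M}[X(A)\|A|_{\mathbb{R}^d\setminus S}]+\mathcal{M}[-X(A)\|A|_{\mathbb{R}^d\setminus S}]$, where $\mathcal{M}[Y\|A|_{\mathbb{R}^d\setminus S}]$ is the conditional essential supremum of $Y$ given $\sigma(A|_{\mathbb{R}^d\setminus S})$, i.e. the a.s. smallest $\sigma(A|_{\mathbb{R}^d\setminus S})$-measurable random variable that dominates $Y$ a.s. (Formally: essential supremum minus essential infimum of $X(A')$ over $A'$ coinciding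 with $A$ outside $S$.) Functional derivative. Fix an open set $M\subset L^\infty(\mathbb{R}^d)$ containing the realizations of $A$ and an extension $\tilde X:M\to\mathbb{R}$ of $X$ (such an extension is always assumed implicitly given). The Gâteaux derivative $\frac{\partial\tilde X(A)}{\partial A}\in L^2(\Omega,L^1_{\mathrm{loc}}(\mathbb{R}^d))$ is defined by $\lim_{t\to0}\frac{\tilde X(A+tB)-\tilde X(A)}{t}=\int_{\mathbb{R}^d}B(x)\frac{\partial\tilde X(A)}{\partial A}(x)\,dx$ a.s. for all compactly supported $B\in L^\infty(\mathbb{R}^d)$, if the limit exists, and for bounded Borel $S$, $\partial^{\mathrm{fct}}_{A,S}X(A):=\int_S\big|\frac{\partial\tilde X(A)}{\partial A}(x)\big|\,dx$. Functional inequalities. With $\tilde\partial\in\{\partial^{\mathrm{osc}},\partial^{\mathrm{fct}}\}$: - ($\tilde\partial$-SG) with radius $R>0$ and constant $C>0$: for all $X(A)$, $\mathrm{Var}[X(A)]\le C\,\mathbb{E}\big[\int_{\mathbb{R}^d}(\tilde\partial_{A,B_R(x)}X(A))^2dx\big]$. - ($\tilde\partial$-CI) with radius $R>0$ and constant $C>0$: for all $X(A),Y(A)$, $\mathrm{Cov}[X(A);Y(A)]\le C\int_{\mathbb{R}^d}\mathbb{E}[(\tilde\partial_{A,B_R(x)}X(A))^2]^{1/2}\,\mathbb{E}[(\tilde\partial_{A,B_R(x)}Y(A))^2]^{1/2}dx$. - ($\tilde\partial$-MSG) with weight $\pi$, where $\pi:\mathbb{R}_+\to\mathbb{R}_+$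 is integrable: for all $X(A)$, $\mathrm{Var}[X(A)]\le\mathbb{E}\big[\int_0^\infty\int_{\mathbb{R}^d}(\tilde\partial_{A,B_{\ell+1}(x)}X(A))^2dx\,(\ell+1)^{-d}\pi(\ell)\,d\ell\big]$. - ($\tilde\partial$-MCI) with weight $\pi$ integrable: for all $X(A),Y(A)$, $\mathrm{Cov}[X(A);Y(A)]\le\int_0^\infty\int_{\mathbb{R}^d}\mathbb{E}[(\tilde\partial_{A,B_{\ell+1}(x)}X(A))^2]^{1/2}\,\mathbb{E}[(\tilde\partial_{A,B_{\ell+1}(x)}Y(A))^2]^{1/2}dx\,(\ell+1)^{-d}\pi(\ell)\,d\ell$. *)

(* Defs.v *)
From HB Require Import structures.
From mathcomp Require Import all_boot all_order all_algebra.
From mathcomp Require Import all_classical all_reals all_analysis.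
From mathcomp Require Import measurable_realfun ess_sup_inf.

Set Implicit Arguments.
Unset Strict Implicit.
Unset Printing Implicit Defensive.

Import Order.TTheory GRing.Theory Num.Theory.
Import numFieldNormedType.Exports.

Local Open Scope classical_set_scope.
Local Open Scope ring_scope.

(* R^d is 'rV[R]_d, with the sigma-algebra generated by the d coordinates (the
   Borel sigma-algebra), as the library does for tuples and products. *)
Fact rV_display : measure_display. Proof. exact. Qed.

Section borel_rV.
Context (R : realType) (n : nat).

Definition rV_coord (i : 'I_n) (x : 'rV[R]_n) : R := x ord0 i.

Let mrV := g_sigma_preimage rV_coord.

Let mrV0 : mrV set0. Proof. exact: sigma_algebra0. Qed.

Let mrVC A : mrV A -> mrV (~` A). Proof. exact: sigma_algebraC. Qed.

Let mrV_bigcup (F : (set 'rV[R]_n)^nat) :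
  (forall i, mrV (F i)) -> mrV (\bigcup_i F i).
Proof. exact: sigma_algebra_bigcup. Qed.

HB.instance Definition _ :=
  @isMeasurable.Build rV_display 'rV[R]_n mrV mrV0 mrVC mrV_bigcup.

End borel_rV.

Lemma measurable_rV_coord (R : realType) (n : nat) (i : 'I_n) :
  measurable_fun setT (@rV_coord R n i).
Proof.
move=> _ B mB; rewrite setTI.
apply: sub_sigma_algebra; rewrite -bigcup_seq/=; exists i => /=.
  by rewrite mem_index_enum.
by exists B => //; rewrite setTI.
Qed.

Lemma measurable_fun_rVP d (T : measurableType d) (R : realType) (n : nat)
    (f : T -> 'rV[R]_n) :
  (forall i, measurable_fun setT (fun t => f t ord0 i)) -> measurable_fun setT f.
Proof.
move=> mf _ Y; rewrite setTI.
have : sigma_algebra setT [set Z : set 'rV[R]_n | measurable (f @^-1` Z)].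
  split => /=.
  - by rewrite preimage_set0.
  - by move=> Z mZ; rewrite setTD preimage_setC; exact: measurableC.
  - by move=> F mF; rewrite preimage_bigcup; exact: bigcup_measurable.
move=> sa mY; apply: (mY [set Z | measurable (f @^-1` Z)]); split => // Z /=.
elim/big_ind : _ => [//|A B hA hB [/hA//|/hB//]|i _ [B mB <-]].
by rewrite setTI -[X in measurable X]setTI; exact: mf.
Qed.

Lemma product_sigma_finite d1 d2 (T1 : measurableType d1)
    (T2 : measurableType d2) (R : realType)
    (m1 : {sigma_finite_measure set T1 -> \bar R})
    (m2 : {sigma_finite_measure set T2 -> \bar R}) :
  sigma_finite setT (m1 \x m2)%E.
Proof.
have /sigma_finiteP[F [TF ndF Foo]] := sigma_finiteT m1.
have /sigma_finiteP[G [TG ndG Goo]] := sigma_finiteT m2.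
exists (fun n => F n `*` G n).
  rewrite -setXTT TF TG predeqE => -[x y]; split.
    move=> [/= [n _ Fnx] [k _ Gky]]; exists (maxn n k) => //; split.
    - by move: x Fnx; exact/subsetPset/ndF/leq_maxl.
    - by move: y Gky; exact/subsetPset/ndG/leq_maxr.
  by move=> [n _ []/= ? ?]; split; exists n.
move=> k; have [? ?] := Foo k; have [? ?] := Goo k.
split; first exact: measurableX.
by rewrite product_measure1E// lte_mul_pinfty// ge0_fin_numE.
Qed.

Section lebesgue_rV.
Context (R : realType).
Local Open Scope ereal_scope.

Definition rV_cons n (p : measurableTypeR R * 'rV[R]_n) : 'rV[R]_n.+1 :=
  (row_mx p.1%:M p.2 : 'rV[R]_(1 + n)).

Lemma measurable_rV_cons n : measurable_fun setT (@rV_cons n).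
Proof.
apply: measurable_fun_rVP => i.
rewrite /rV_cons; case: (@split_ordP 1 n i) => j ->.
- rewrite (_ : (fun _ => _) = fst)//; apply/funext => -[x y] /=.
  by rewrite [LHS]row_mxEl !ord1 mxE eqxx mulr1n.
- rewrite (_ : (fun _ => _) = @rV_coord R n j \o snd); last first.
    by apply/funext => -[x y] /=; rewrite [LHS]row_mxEr.
  by apply: measurableT_comp => //; exact: measurable_rV_coord.
Qed.

Section step.
Context (n : nat) (mu : {sigma_finite_measure set 'rV[R]_n -> \bar R}).

Definition lebesgue_rV_step : set 'rV[R]_n.+1 -> \bar R :=
  pushforward (lebesgue_measure \x mu) (@rV_cons n).

Let step0 : lebesgue_rV_step set0 = 0.
Proof. by rewrite /lebesgue_rV_step /pushforward preimage_set0 measure0. Qed.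

Let step_ge0 A : 0 <= lebesgue_rV_step A.
Proof. by rewrite /lebesgue_rV_step /pushforward measure_ge0. Qed.

Let step_sigma_additive : semi_sigma_additive lebesgue_rV_step.
Proof.
move=> F mF tF mUF; rewrite /lebesgue_rV_step /pushforward preimage_bigcup.
apply: measure_semi_sigma_additive.
- by move=> k; rewrite -[X in measurable X]setTI; exact: measurable_rV_cons.
- apply/trivIsetP => /= i j _ _ ij; rewrite -preimage_setI.
  by move/trivIsetP : tF => /(_ _ _ _ _ ij) ->//; rewrite preimage_set0.
- rewrite -preimage_bigcup -[X in measurable X]setTI.
  exact: measurable_rV_cons.
Qed.

HB.instance Definition _ := isMeasure.Build _ _ _ lebesgue_rV_step
  step0 step_ge0 step_sigma_additive.

Let step_sigma_finite : sigma_finite setT lebesgue_rV_step.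
Proof.
have [F TF Foo] := product_sigma_finite (@lebesgue_measure R) mu.
pose uncons (x : 'rV[R]_n.+1) : (measurableTypeR R * 'rV[R]_n)%type :=
  (x ord0 ord0, rsubmx (x : 'rV[R]_(1 + n))).
have consK : cancel (@rV_cons n) uncons.
  move=> [x y]; rewrite /uncons /rV_cons row_mxKr; congr pair.
  rewrite (_ : ord0 = lshift n (ord0 : 'I_1)); last exact/val_inj.
  by rewrite [LHS]row_mxEl mxE eqxx mulr1n.
have unconsK : cancel uncons (@rV_cons n).
  move=> x; rewrite /uncons /rV_cons /= -[RHS](@hsubmxK _ 1 1 n).
  suff -> : (x ord0 ord0)%:M = lsubmx (x : 'rV[R]_(1 + n)) by [].
  apply/matrixP => i j; rewrite !ord1 !mxE eqxx mulr1n.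
  by congr (x _ _); exact/val_inj.
have muncons : measurable_fun setT uncons.
  apply/measurable_fun_pairP; split => /=.
    exact: measurable_rV_coord.
  apply: measurable_fun_rVP => i.
  rewrite (_ : (fun _ => _) = @rV_coord R n.+1 (rshift 1 i)).
    exact: measurable_rV_coord.
  by apply/funext => x /=; rewrite mxE.
exists (fun k => uncons @^-1` F k).
  by rewrite -preimage_bigcup -TF preimage_setT.
move=> k; have [mFk Fkoo] := Foo k; split.
  by rewrite -[X in measurable X]setTI; exact: muncons.
rewrite /lebesgue_rV_step /pushforward -comp_preimage.
by rewrite (_ : uncons \o _ = id)//; apply/funext => p; exact: consK.
Qed.

HB.instance Definition _ := Measure_isSigmaFinite.Build _ _ _ lebesgue_rV_step
  step_sigma_finite.

End step.

(* Lebesgue measure on R^n: the n-fold product of the one on R. *)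
Fixpoint lebesgue_rV n : {sigma_finite_measure set 'rV[R]_n -> \bar R} :=
  match n with
  | 0 => dirac (0%R : 'rV[R]_0)
  | n'.+1 => lebesgue_rV_step (lebesgue_rV n')
  end.

End lebesgue_rV.

Section euclidean.
Context (R : realType) (n : nat).

Definition enorm (x : 'rV[R]_n) : R := Num.sqrt (\sum_i x ord0 i ^+ 2).

Definition eball (x : 'rV[R]_n) (r : R) : set 'rV[R]_n :=
  [set y | enorm (y - x) < r].

(* Equal to +oo when S or T is empty. *)
Definition edist_set (S T : set 'rV[R]_n) : \bar R :=
  ereal_inf [set (enorm (x - y))%:E | x in S & y in T].

End euclidean.

Section random_field.
Context (R : realType) (d : nat) (dO : measure_display)
  (Omega : measurableType dO) (P : probability Omega R).

Local Notation Rd := 'rV[R]_d.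
Local Notation leb := (lebesgue_rV R d).

Implicit Types (A : Rd -> Omega -> R) (X Y : Omega -> R) (S : set Rd).

Definition jointly_measurable (f : Rd -> Omega -> R) :=
  measurable_fun [set: Rd * Omega] (fun p => f p.1 p.2).

Definition stationary A :=
  forall (z : Rd) (k : nat) (x : 'I_k -> Rd) (B : set (k.-tuple R)),
    measurable B ->
    P [set w | B [tuple A (x i + z) w | i < k]] =
    P [set w | B [tuple A (x i) w | i < k]].

Definition autocovariance A (x : Rd) : \bar R := covariance P (A 0) (A x).

Definition bounded_field A (K : R) :=
  forall x, {ae P, forall w, `|A x w| <= K}.

(* sigma(A|_S) *)
Definition field_sigma A S : set (set Omega) :=
  <<s \bigcup_(x in S) preimage_set_system setT (A x) measurable >>.

(* Measurability of f with respect to a sub-sigma-algebra G. *)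
Definition sub_measurable_fun (G : set (set Omega)) dT (T : measurableType dT)
  (f : Omega -> T) := preimage_set_system setT f measurable `<=` G.

Definition independent_sigma (G H : set (set Omega)) :=
  forall E F, G E -> H F -> P (E `&` F) = (P E * P F)%E.

(* Z is a version of the conditional essential supremum M[Y || G]. *)
Definition is_cond_ess_sup (G : set (set Omega)) Y (Z : Omega -> \bar R) :=
  [/\ sub_measurable_fun G Z,
      {ae P, forall w, ((Y w)%:E <= Z w)%E} &
      forall Z' : Omega -> \bar R, sub_measurable_fun G Z' ->
        {ae P, forall w, ((Y w)%:E <= Z' w)%E} ->
        {ae P, forall w, (Z w <= Z' w)%E}].

(* Both derivatives are random variables defined up to null sets only. They are
   rendered as relations: [dX] is a family S |-> dX S such that, for every Borel
   S (bounded Borel S for the functional derivative), dX S is a version of the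
   derivative of X with respect to A on S. *)
Definition is_osc A X (dX : set Rd -> Omega -> \bar R) :=
  forall S, measurable S -> exists U V,
    [/\ is_cond_ess_sup (field_sigma A (~` S)) X U,
        is_cond_ess_sup (field_sigma A (~` S)) (fun w => - X w) V &
        forall w, dX S w = (U w + V w)%E].

(* An open subset of L^oo(R^d), as a set of representatives; openness makes it
   saturated for almost everywhere equality. *)
Definition open_Linfty (M : set (Rd -> R)) :=
  (forall u, M u -> u \in Lfun leb +oo%E) /\
  (forall u, M u -> exists2 e : R, 0 < e &
     forall v, v \in Lfun leb +oo%E ->
       ('N[leb]_+oo[EFin \o (v \- u)%R] < e%:E)%E -> M v).

(* X is Xt(A), for a functional Xt on M (its values outside M are irrelevant);
   the first clause says that Xt is defined on classes of functions. *)
Definition is_extension A (M : set (Rd -> R)) X (Xt : (Rd -> R) -> R) :=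
  (forall u v, M u -> M v -> {ae leb, forall x, u x = v x} -> Xt u = Xt v) /\
  {ae P, forall w, X w = Xt (A ^~ w)}.

Definition compactly_supported (B : Rd -> R) :=
  exists r : R, forall x, r < enorm x -> B x = 0.

(* The second clause is membership in L^2(Omega, L^1_loc(R^d)). *)
Definition is_gateaux_derivative A (Xt : (Rd -> R) -> R)
    (g : Rd -> Omega -> R) :=
  [/\ jointly_measurable g,
      forall r : R, (\int[P]_w
        ((\int[leb]_(x in eball 0 r) `|g x w|%:E) ^+ 2) < +oo)%E &
      forall B : Rd -> R, B \in Lfun leb +oo%E -> compactly_supported B ->
        {ae P, forall w,
          (fun t : R => (Xt (fun x => A x w + t * B x) - Xt (A ^~ w)) / t)
            @ 0^' --> (\int[leb]_x (B x * g x w))%R}].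

Definition is_fct A (M : set (Rd -> R)) X (dX : set Rd -> Omega -> \bar R) :=
  exists Xt g,
    [/\ is_extension A M X Xt, is_gateaux_derivative A Xt g &
        forall S, measurable S -> (exists r : R, S `<=` eball 0 r) ->
          forall w, dX S w = (\int[leb]_(x in S) `|g x w|%:E)%E].

End random_field.

Variant derivative_kind := osc | fct.

Section functional_inequalities.
Context (R : realType) (d : nat) (dO : measure_display)
  (Omega : measurableType dO) (P : probability Omega R).

Local Notation Rd := 'rV[R]_d.
Local Notation leb := (lebesgue_rV R d).

(* The open set M is relevant to the functional derivative only. *)
Definition is_derivative (k : derivative_kind) (M : set (Rd -> R))
    (A : Rd -> Omega -> R) (X : Omega -> R) (dX : set Rd -> Omega -> \bar R) :=
  match k with
  | osc => is_osc P A X dX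
  | fct => is_fct P A M X dX
  end.

Variables (k : derivative_kind) (M : set (Rd -> R)) (A : Rd -> Omega -> R).

(* Variances and covariances are considered for X(A) in L^2 only. *)
Definition admissible (X : Omega -> R) (dX : set Rd -> Omega -> \bar R) :=
  [/\ sub_measurable_fun (field_sigma A setT) X,
      X \in Lfun P 2%:E & is_derivative k M A X dX].

Local Open Scope ereal_scope.

(* E[(d_{A,S} X(A))^2]; since dX S is defined up to null sets for each S, the
   expectation is taken inside the integrals over x and l (Tonelli). *)
Definition sq_mean (dX : set Rd -> Omega -> \bar R) (S : set Rd) : \bar R :=
  \int[P]_w (dX S w ^+ 2).

Definition SG (r c : R) := forall X dX, admissible X dX ->
  'V_P[X] <= c%:E * \int[leb]_x sq_mean dX (eball x r).

Definition CI (r c : R) := forall X dX Y dY,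
  admissible X dX -> admissible Y dY ->
  covariance P X Y <= c%:E * \int[leb]_x
    (sq_mean dX (eball x r) `^ 2^-1 * sq_mean dY (eball x r) `^ 2^-1).

Definition MSG (w : R -> R) := forall X dX, admissible X dX ->
  'V_P[X] <= \int[lebesgue_measure]_(l in `[0%R, +oo[)
    ((\int[leb]_x sq_mean dX (eball x (l + 1)%R)) *
     ((l + 1) ^- d * w l)%:E).

Definition MCI (w : R -> R) := forall X dX Y dY,
  admissible X dX -> admissible Y dY ->
  covariance P X Y <= \int[lebesgue_measure]_(l in `[0%R, +oo[)
    ((\int[leb]_x (sq_mean dX (eball x (l + 1)%R) `^ 2^-1 *
                   sq_mean dY (eball x (l + 1)%R) `^ 2^-1)) *
     ((l + 1) ^- d * w l)%:E).

End functional_inequalities.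

Definition is_weight (R : realType) (w : R -> R) :=
  (forall l, 0 <= l -> 0 <= w l) /\
  lebesgue_measure.-integrable `[0, +oo[ (EFin \o w).

Section weight_bound.
Context (R : realType).
Local Open Scope ereal_scope.

Definition weight_bound (d : nat) (a : R) (w : R -> R) : \bar R :=
  if (a < d%:R)%R then
    \int[lebesgue_measure]_(l in `[0%R, +oo[) ((l + 1) `^ (d%:R - a) * w l)%:E
  else if a == d%:R then
    \int[lebesgue_measure]_(l in `[0%R, +oo[) (ln (2 + l) ^+ 2 * w l)%:E
  else \int[lebesgue_measure]_(l in `[0%R, +oo[) (w l)%:E.

End weight_bound.

(* Main.v *)
(* The test random variables are averages I_T = \int_T A(x) dx: modifying A on S
   moves I_T by at most kappa |S n T| for both derivatives, while
   Cov(I_S, I_T) = \int_S \int_T C(y - x).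
   (i), (ii) With T a cube of half-side 2L, nonnegativity of C gives
   Var(I_T) >= (2L)^d \int_{Q_L} C, and \int |B_r(x) n T|^2 dx is at most
   min(|B_r|, |T|) |B_r| |T|; hence a bound on \int_{Q_L} C. The weight
   (1 + |x|)^-a is dominated by a sum of 2^(-ak) 1_{Q_(2^(k+1))}.
   (iv) S and T are cubes shrinking to 0 and x; C is continuous because a
   jointly measurable stationary field is continuous in mean square.
   (iii) The inequality kills the covariance of two variables that no common ball
   affects. For the oscillation, take indicators of events. For the functional
   derivative, take smooth functions of averages over small cubes, which
   approximate indicators of {A(x_i) > a_i, i <= k}; these events generate. *)

(* Three obstacles shape the proof. First, [A] is only jointly measurable, so its average over [T]
   need not be measurable for [sigma(A|_T)], which is not completed. A conditional expectation
   supplies a measurable modification; each functional inequality is applied to such a modification,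
   and the result is carried back almost surely. Second, a derivative is a family chosen separately
   for every set, so nothing makes [sq_mean dX (eball x r)] measurable in [x] or [r]; such
   integrands are only compared pointwise with measurable ones, or shown to vanish. Third, [Omega]
   has no topology, so translations are shown to be continuous in measure by proving that the sets
   with this property form a sigma-algebra containing the rectangles. The signed square [a |a|] and
   the layer cake formula then turn this into continuity in L^2 under a second moment alone. The
   covariance inequalities are one-sided. A sign in front of a test variable, or the complement of
   an event, gives the opposite bound. *)
Require Import Defs.
From HB Require Import structures.
From mathcomp Require Import all_boot all_order all_algebra.
From mathcomp Require Import all_classical all_reals all_analysis.
From mathcomp Require Import measurable_realfun ess_sup_inf.
From mathcomp Require Import lra ring.

Set Implicit Arguments.
Unset Strict Implicit.
Unset Printing Implicit Defensive.

Import Order.TTheory GRing.Theory Num.Theory.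
Import numFieldNormedType.Exports.

Local Open Scope classical_set_scope.
Local Open Scope ring_scope.

(** * Lebesgue measure on R^n *)

Section rV_measure.
Context (R : realType).
Local Notation leb := (lebesgue_rV R).
Local Notation mu1 := (@lebesgue_measure R).

Lemma rV_cons0 n (p : R * 'rV[R]_n) : rV_cons p ord0 ord0 = p.1.
Proof.
rewrite /rV_cons (_ : ord0 = lshift n (ord0 : 'I_1)); last exact/val_inj.
by rewrite [LHS]row_mxEl mxE eqxx mulr1n.
Qed.

Lemma rV_consS n (p : R * 'rV[R]_n) i : rV_cons p ord0 (lift ord0 i) = p.2 ord0 i.
Proof.
rewrite /rV_cons (_ : lift ord0 i = rshift 1 i); last exact/val_inj.
by rewrite [LHS]row_mxEr.
Qed.

Lemma measurable_rV_addr n (z : 'rV[R]_n) : measurable_fun setT (fun x : 'rV[R]_n => x + z).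
Proof.
apply: measurable_fun_rVP => i; under eq_fun do rewrite mxE.
by apply: measurable_funD => //; exact: (@measurable_rV_coord R n i).
Qed.

Lemma measurable_rV_subr n :
  measurable_fun setT (fun p : 'rV[R]_n * 'rV[R]_n => p.1 - p.2).
Proof.
apply: measurable_fun_rVP => i; under eq_fun do rewrite !mxE.
apply: measurable_funB.
  by apply: (measurableT_comp (@measurable_rV_coord R n i)).
by apply: (measurableT_comp (@measurable_rV_coord R n i)).
Qed.

Lemma measurable_rect n (B : 'I_n -> set R) : (forall i, measurable (B i)) ->
  measurable [set x : 'rV[R]_n | forall i, B i (x ord0 i)].
Proof.
move=> mB; rewrite [X in measurable X](_ : _ =
    \bigcap_(i in [set: 'I_n]) (@rV_coord R n i @^-1` B i)); last first.
  by apply/seteqP; split => x /= Bx i; [move=> _; exact: Bx|exact: (Bx i I)].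
apply: fin_bigcap_measurable.
  apply/finite_seqP; exists (enum 'I_n).
  by apply/seteqP; split => i //= _; rewrite mem_enum.
move=> i _.
by rewrite -[X in measurable X]setTI; exact: (@measurable_rV_coord R n i).
Qed.

Lemma lebesgue_rV_rect n (B : 'I_n -> set R) :
  (forall i, measurable (B i)) -> (forall i, (mu1 (B i) < +oo)%E) ->
  leb n [set x | forall i, B i (x ord0 i)] = (\prod_i fine (mu1 (B i)))%:E.
Proof.
elim: n B => [|n ih] B mB Boo.
  rewrite big_ord0 /= diracE mem_set//=.
  by case.
transitivity ((mu1 \x leb n)%E
    (B ord0 `*` [set y : 'rV[R]_n | forall i, B (lift ord0 i) (y ord0 i)])).
  rewrite /= /lebesgue_rV_step /pushforward; congr (_ _).
  apply/seteqP; split => [p /= Bp|p /= [B0 BS] i].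
    split => [|i]; first by have := Bp ord0; rewrite rV_cons0.
    by have := Bp (lift ord0 i); rewrite rV_consS.
  by case: (unliftP ord0 i) => [j|] ->; rewrite ?rV_cons0 ?rV_consS.
rewrite product_measure1E; [|exact: mB|]; last first.
  exact: (measurable_rect (fun i => mB (lift ord0 i))).
rewrite (ih (fun i => B (lift ord0 i)))// big_ord_recl EFinM fineK//.
by rewrite ge0_fin_numE.
Qed.

Lemma lebesgue_measure_addr (a : R) (A : set R) : measurable A ->
  pushforward mu1 ((fun x => x + a) : _ -> measurableTypeR R) A = mu1 A.
Proof.
move=> mA.
have mf : measurable_fun setT ((fun x => x + a) : measurableTypeR R -> measurableTypeR R).
  by apply: measurable_funD.
pose nu := pushforward mu1 ((fun x => x + a) : _ -> measurableTypeR R).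
apply/esym/lebesgue_measure_unique => //= _ [[b c]] _ <-.
rewrite /pushforward (_ : _ @^-1` _ = `]b - a, c - a]%classic).
  rewrite !lebesgue_measure_itv/= !lte_fin ltrD2r.
  by case: ifPn => // _; congr (_%:E); ring.
by apply/seteqP; split => x /=; rewrite !in_itv/= ltrBlDr lerBrDr.
Qed.

Local Open Scope ereal_scope.

Lemma ge0_integral_rV_cons n (f : 'rV[R]_n.+1 -> \bar R) :
  measurable_fun setT f -> (forall x, 0 <= f x) ->
  \int[leb n.+1]_x f x = \int[mu1]_s \int[leb n]_y f (rV_cons (s, y)).
Proof.
move=> mf f0; rewrite ge0_integral_pushforward//; last first.
  exact: measurable_rV_cons.
rewrite preimage_setT fubini_tonelli1//; last by move=> p; exact: f0.
by apply: measurableT_comp => //; exact: measurable_rV_cons.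
Qed.

Lemma ge0_integral_addr (a : R) (f : R -> \bar R) :
  measurable_fun setT f -> (forall x, 0 <= f x) ->
  \int[mu1]_x f (x + a)%R = \int[mu1]_x f x.
Proof.
move=> mf f0.
have mD : measurable_fun setT ((fun x => x + a)%R : measurableTypeR R -> measurableTypeR R).
  by apply: measurable_funD.
transitivity (\int[pushforward mu1 ((fun x => x + a)%R : _ -> measurableTypeR R)]_x f x).
  by rewrite ge0_integral_pushforward.
by apply: eq_measure_integral => A mA _; exact: lebesgue_measure_addr.
Qed.

(** By induction on the dimension: the shift acts separately on the first coordinate and on the
    others. Nonnegativity allows Tonelli even for infinite integrals. *)
Lemma ge0_integral_rV_addr n (z : 'rV[R]_n) (f : 'rV[R]_n -> \bar R) :
  measurable_fun setT f -> (forall x, 0 <= f x) ->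
  \int[leb n]_x f (x + z)%R = \int[leb n]_x f x.
Proof.
elim: n z f => [|n ih] z f mf f0.
  by apply: eq_integral => x _; congr f; apply/matrixP => i [].
have mfz : measurable_fun setT (fun x : 'rV[R]_n.+1 => f (x + z)%R).
  by apply: measurableT_comp => //; exact: measurable_rV_addr.
rewrite [RHS](ge0_integral_rV_cons mf f0) [LHS](ge0_integral_rV_cons mfz);
  last by move=> x; exact: f0.
pose z0 := z ord0 ord0; pose z' : 'rV[R]_n := \row_i z ord0 (lift ord0 i).
have E s y : (rV_cons (s, y) + z = rV_cons ((s + z0), (y + z')))%R.
  apply/rowP => i; rewrite mxE.
  by case: (unliftP ord0 i) => [j|] ->; rewrite ?rV_cons0 ?rV_consS//= !mxE.
under eq_integral => s _.
  under eq_integral do rewrite E.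
  rewrite (ih z' (fun y => f (rV_cons ((s + z0)%R, y))))//; last first.
    apply: (measurableT_comp mf).
    apply: (@measurableT_comp _ _ _ _ _ _ (@rV_cons R n)) => //.
    exact: measurable_rV_cons.
  over.
rewrite (ge0_integral_addr z0 (f := fun s => \int[leb n]_y f (rV_cons (s, y))))//.
  apply: (@measurable_fun_fubini_tonelli_F _ _ _ _ _ (leb n)
    (fun p => f (rV_cons p))) => //.
  by apply: (measurableT_comp mf); exact: measurable_rV_cons.
by move=> s; apply: integral_ge0.
Qed.

Lemma lebesgue_rV_preimage_addr n (z : 'rV[R]_n) (S : set 'rV[R]_n) :
  measurable S -> leb n [set x | S (x + z)%R] = leb n S.
Proof.
move=> mS.
have mSz : measurable [set x | S (x + z)%R].
  by rewrite -[X in measurable X]setTI; exact: measurable_rV_addr.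
have -> : leb n S = \int[leb n]_x (\1_S x)%:E by rewrite integral_indic// setIT.
have -> : leb n [set x | S (x + z)%R] = \int[leb n]_x (\1_S (x + z)%R)%:E.
  by rewrite (integral_indic (leb n) measurableT mSz) setIT.
rewrite (ge0_integral_rV_addr z (f := fun x => (\1_S x)%:E))//.
exact/measurable_EFinP.
Qed.

End rV_measure.

(** * Euclidean norm, cubes and balls *)

Section euclidean_geometry.
Context (R : realType) (n : nat).
Local Notation Rd := 'rV[R]_n.
Local Notation leb := (lebesgue_rV R n).
Implicit Types (x y z : Rd) (r L : R).

Lemma enorm_ge0 x : 0 <= enorm x. Proof. exact: sqrtr_ge0. Qed.

Lemma enormN x : enorm (- x) = enorm x.
Proof. by congr Num.sqrt; apply: eq_bigr => i _; rewrite mxE sqrrN. Qed.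

Lemma sqr_enorm x : enorm x ^+ 2 = \sum_i x ord0 i ^+ 2.
Proof. by rewrite sqr_sqrtr// sumr_ge0// => i _; exact: sqr_ge0. Qed.

Lemma sum_mul_le_enorm x y : \sum_i x ord0 i * y ord0 i <= enorm x * enorm y.
Proof.
rewrite (le_trans (ler_norm _))// -(@ler_pXn2r _ 2)// ?nnegrE//; last first.
  by rewrite mulr_ge0// enorm_ge0.
rewrite real_normK ?num_real// exprMn !sqr_enorm.
(* Lagrange's identity: this double sum of squares is twice the gap in the Cauchy-Schwarz
   inequality. *)
have : 0 <= \sum_i \sum_j (x ord0 i * y ord0 j - x ord0 j * y ord0 i) ^+ 2.
  by apply: sumr_ge0 => i _; apply: sumr_ge0 => j _; exact: sqr_ge0.
rewrite (_ : \sum_i _ = 2 * ((\sum_i x ord0 i ^+ 2) * (\sum_i y ord0 i ^+ 2)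
    - (\sum_i x ord0 i * y ord0 i) ^+ 2)); last first.
  have E1 : (\sum_i x ord0 i ^+ 2) * (\sum_i y ord0 i ^+ 2) =
      \sum_i \sum_j x ord0 i ^+ 2 * y ord0 j ^+ 2 by rewrite big_distrlr.
  have E2 : (\sum_i x ord0 i ^+ 2) * (\sum_i y ord0 i ^+ 2) =
      \sum_i \sum_j x ord0 j ^+ 2 * y ord0 i ^+ 2.
    by rewrite E1 exchange_big.
  rewrite mulrBr mulr_natl mulr2n {1}E1 E2 expr2 big_distrlr/=.
  rewrite mulr_sumr -sumrN -!big_split/=; apply: eq_bigr => i _.
  rewrite mulr_sumr -sumrN -!big_split/=; apply: eq_bigr => j _.
  by ring.
by rewrite pmulr_rge0// subr_ge0.
Qed.

Lemma enormD x y : enorm (x + y) <= enorm x + enorm y.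
Proof.
rewrite -(@ler_pXn2r _ 2)// ?nnegrE ?addr_ge0 ?enorm_ge0//.
rewrite sqrrD !sqr_enorm.
rewrite (_ : \sum_i (x + y) ord0 i ^+ 2 = \sum_i x ord0 i ^+ 2 +
    (\sum_i x ord0 i * y ord0 i) *+ 2 + \sum_i y ord0 i ^+ 2).
  by rewrite lerD2r lerD2l ler_pMn2r// sum_mul_le_enorm.
rewrite -sumrMnl -!big_split/=; apply: eq_bigr => i _.
by rewrite mxE sqrrD.
Qed.

Lemma enormB x y : enorm (x - y) = enorm (y - x).
Proof. by rewrite -enormN opprB. Qed.

Lemma coord_le_enorm x i : `|x ord0 i| <= enorm x.
Proof.
rewrite -(@ler_pXn2r _ 2)// ?nnegrE ?enorm_ge0// sqr_enorm real_normK ?num_real//.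
by rewrite (bigD1 i)//= lerDl sumr_ge0// => j _; exact: sqr_ge0.
Qed.

Definition cube L : set Rd := [set x | forall i, `|x ord0 i| <= L].

Lemma enorm_cube L x : cube L x -> enorm x <= n%:R * L.
Proof.
move=> Lx; rewrite -(@ler_pXn2r _ 2)// ?nnegrE ?enorm_ge0//; last first.
  (* In positive dimension a point of the cube forces [0 <= L]; in dimension 0 the bound is 0
     whatever the sign of [L]. *)
  have [->|] := posnP n; first by rewrite mul0r.
  move=> n0; rewrite mulr_ge0//; exact: (le_trans (normr_ge0 _) (Lx (Ordinal n0))).
rewrite sqr_enorm (@le_trans _ _ (\sum_(i < n) L ^+ 2))//.
  apply: ler_sum => i _; rewrite -real_normK ?num_real// ler_pXn2r// ?nnegrE//.
  exact: (le_trans (normr_ge0 _) (Lx i)).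
rewrite sumr_const card_ord exprMn -[leLHS]mulr_natl ler_wpM2r ?sqr_ge0//.
by rewrite -natrX ler_nat; case: n => // m; rewrite leq_pmulr.
Qed.

Lemma cube_addr L L' x y : cube L x -> cube L' y -> cube (L + L') (x + y).
Proof. by move=> Lx Ly i; rewrite mxE (le_trans (ler_normD _ _))// lerD. Qed.

Lemma subset_cube L L' : L <= L' -> cube L `<=` cube L'.
Proof. by move=> LL' x Lx i; exact: le_trans LL'. Qed.

Lemma cubeN L x : cube L x -> cube L (- x).
Proof. by move=> Lx i; rewrite mxE normrN. Qed.

Let cubeE L : cube L = [set x | forall i, `[- L, L]%classic (x ord0 i)].
Proof.
by apply/seteqP; split => x + i => /(_ i); rewrite /= in_itv/= ler_norml.
Qed.

Lemma measurable_cube L : measurable (cube L).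
Proof. by rewrite cubeE; exact: (@measurable_rect _ _ (fun=> `[- L, L]%classic)). Qed.

Lemma lebesgue_cube L : 0 <= L -> leb (cube L) = ((2 * L) ^+ n)%:E.
Proof.
move=> L0; rewrite cubeE (@lebesgue_rV_rect _ _ (fun=> `[- L, L]%classic))//.
  rewrite prodr_const card_ord lebesgue_measure_itv/=.
  case: ifPn => /=; first by rewrite opprK -mulr2n mulr_natl.
  rewrite lte_fin -leNgt => LL; have -> : L = 0 by lra.
  by rewrite mulr0.
by move=> i; rewrite lebesgue_measure_itv/=; case: ifP => _; rewrite ?ltry.
Qed.

(** The slab lies in a box whose [i]-th side has length [2 * e]. It is the boundary layer that a
    half-space sweeps under a small shift. *)
Lemma lebesgue_slab L i (a e : R) : 0 <= L -> 0 <= e ->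
  (leb [set x | cube L x /\ (`|x ord0 i - a| <= e)%R] <=
   ((2 * L) ^+ n.-1 * (2 * e))%:E)%E.
Proof.
move=> L0 e0.
pose B j : set R := if j == i then `[a - e, a + e]%classic else `[- L, L]%classic.
have mB j : measurable (B j) by rewrite /B; case: ifP.
have itvE (u v : R) : u <= v -> lebesgue_measure `[u, v]%classic = (v - u)%:E.
  move=> uv; rewrite lebesgue_measure_itv/= lte_fin.
  by case: ltP => //; rewrite EFinB => vu; rewrite (@le_anti _ _ u v) ?uv//= subee.
have BE j : lebesgue_measure (B j) = (if j == i then 2 * e else 2 * L)%:E.
  by rewrite /B; case: ifP => _; rewrite itvE; [congr (_%:E); ring|lra|congr (_%:E); ring|lra].
rewrite (@le_trans _ _ (leb [set x | forall j, B j (x ord0 j)]))//.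
  apply: le_measure; rewrite ?inE.
  - apply: measurableI; first exact: measurable_cube.
    rewrite [X in measurable X](_ : _ = @rV_coord R n i @^-1` `[a - e, a + e]%classic).
      by rewrite -[X in measurable X]setTI; exact: measurable_rV_coord.
    by apply/seteqP; split => x /=; rewrite in_itv/= ler_distl /rV_coord.
  - exact: measurable_rect.
  - move=> x [Lx xa] j; rewrite /B; case: ifPn => [/eqP->|_] /=.
      by rewrite in_itv/=; rewrite ler_distl in xa.
    by rewrite in_itv/= -ler_norml.
rewrite lebesgue_rV_rect//; last by move=> j; rewrite BE ltry.
rewrite lee_fin (bigD1 i)//= BE eqxx/= mulrC ler_wpM2r//; first lra.
rewrite (eq_bigr (fun=> 2 * L)); last by move=> j /negPf ji; rewrite BE ji.
by rewrite prodr_const cardC1 card_ord.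
Qed.

Lemma measurable_enorm : measurable_fun setT (@enorm R n).
Proof.
rewrite /enorm; apply: measurableT_comp => //.
  by apply: continuous_measurable_fun; exact: sqrt_continuous.
apply: measurable_sum => i; apply: measurable_funX.
exact: (@measurable_rV_coord R n i).
Qed.

Lemma measurable_enormB : measurable_fun setT (fun p : Rd * Rd => enorm (p.1 - p.2)).
Proof. exact: (measurableT_comp measurable_enorm (@measurable_rV_subr R n)). Qed.

Lemma measurable_eball2 r : measurable [set p : Rd * Rd | eball p.1 r p.2].
Proof.
rewrite [X in measurable X](_ : _ =
    (fun p : Rd * Rd => enorm (p.1 - p.2)) @^-1` `]-oo, r[%classic).
  by rewrite -[X in measurable X]setTI; exact: measurable_enormB.
by apply/seteqP; split => -[x y]; rewrite /eball/= in_itv/= enormB.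
Qed.

Lemma measurable_eball x r : measurable (eball x r).
Proof.
by have := measurable_xsection x (measurable_eball2 r); rewrite /xsection/=;
  congr measurable; apply/seteqP; split => y /=; rewrite inE.
Qed.

Lemma eball_sym x y r : eball x r y -> eball y r x.
Proof. by rewrite /eball/= enormB. Qed.

Lemma eball_cube x r y : eball x r y -> cube r (y - x).
Proof. by move=> xy i; apply/ltW/(le_lt_trans _ xy)/coord_le_enorm. Qed.

(** The ball is compared with its circumscribed cube; each such comparison puts a factor 2^n into
    the final constants. *)
Lemma lebesgue_eball x r : 0 <= r -> (leb (eball x r) <= ((2 * r) ^+ n)%:E)%E.
Proof.
move=> r0; rewrite -lebesgue_cube// -(lebesgue_rV_preimage_addr (- x) (measurable_cube r)).
apply: le_measure; rewrite ?inE.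
- exact: measurable_eball.
- by rewrite -[X in measurable X]setTI; apply: measurable_rV_addr => //; exact: measurable_cube.
- by move=> y /eball_cube.
Qed.

Definition cell L x : set Rd := [set y | cube L (y - x)].

Lemma measurable_cell L x : measurable (cell L x).
Proof.
rewrite -[X in measurable X]setTI.
by apply: (measurable_rV_addr (- x)) => //; exact: measurable_cube.
Qed.

Lemma lebesgue_cell L x : 0 <= L -> leb (cell L x) = ((2 * L) ^+ n)%:E.
Proof.
move=> L0; rewrite -lebesgue_cube//.
by rewrite -(lebesgue_rV_preimage_addr (- x) (measurable_cube L)).
Qed.

Lemma enorm_cell L x y : cell L x y -> enorm (y - x) <= n%:R * L.
Proof. exact: enorm_cube. Qed.

End euclidean_geometry.

(** * Conditional expectation *)

Section ae_comparison.
Context d (T : measurableType d) (R : realType).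
Variable mu : {measure set T -> \bar R}.
Local Open Scope ereal_scope.

(** On the event [g < f] the difference [f - g] is positive while its integral is at most 0, so the
    event is null. For a conditional expectation this event lies in the sub-sigma-algebra, where the
    integrals can be compared. *)
Lemma ae_le_integral_gt (f g : T -> R) : mu.-integrable setT (EFin \o f) ->
  mu.-integrable setT (EFin \o g) ->
  \int[mu]_(w in [set w | (g w < f w)%R]) (f w)%:E <=
    \int[mu]_(w in [set w | (g w < f w)%R]) (g w)%:E ->
  {ae mu, forall w, (f w <= g w)%R}.
Proof.
move=> intf intg; set E := [set w | _] => fg.
have mf : measurable_fun setT f by exact/measurable_EFinP/(measurable_int _ intf).
have mg : measurable_fun setT g by exact/measurable_EFinP/(measurable_int _ intg).
have mE : measurable E.
  rewrite (_ : E = setT `&` (fun w => f w - g w)%R @^-1` `]0%R, +oo[%classic).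
    have : measurable_fun setT (fun w => f w - g w)%R by exact: measurable_funB.
    by apply.
  by apply/seteqP; split => w; rewrite /E/= in_itv/= andbT subr_gt0// => -[].
have mfg : measurable_fun E (fun w => (f w)%:E - (g w)%:E).
  by apply: emeasurable_funB; apply/measurable_EFinP; exact: measurable_funTS.
have intfE := integrableS measurableT mE (@subsetT _ _) intf.
have intgE := integrableS measurableT mE (@subsetT _ _) intg.
have : \int[mu]_(w in E) `|(f w)%:E - (g w)%:E| = 0.
  rewrite (eq_integral (fun w => (f w)%:E - (g w)%:E)); last first.
    by move=> w; rewrite inE /E/= => gf; rewrite ger0_norm// subr_ge0 ltW.
  apply/eqP; rewrite eq_le; apply/andP; split.
    rewrite integralB// sube_le0//.
  apply: integral_ge0 => w; rewrite /E/= => gf.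
  by rewrite -EFinB lee_fin subr_ge0 ltW.
move/(ae_eq_integral_abs mu mE mfg); apply: filterS => w /= fgE.
rewrite leNgt; apply/negP => gf; have := fgE gf.
by move=> /eqP; rewrite -EFinB eqe subr_eq0 => /eqP fgw; rewrite fgw ltxx in gf.
Qed.

End ae_comparison.

Section sub_sigma_algebra.
Context d (T : measurableType d) (R : realType) (P : probability T R).
Variables (C : set (set T)).
Hypothesis CT : C `<=` measurable.
Local Notation G := (<<s C >>).
Local Notation TG := (g_sigma_algebraType C).
Implicit Types (f g h : T -> R).

Lemma sub_sigma_measurable E : G E -> measurable E.
Proof. by apply: smallest_sub => //; exact: sigma_algebra_measurable. Qed.

Lemma sub_measurable_funP dU (U : measurableType dU) (f : T -> U) :
  sub_measurable_fun G f <-> measurable_fun setT (f : TG -> U).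
Proof.
split => [mf _ B mB|mf _ [B mB <-]]; last exact: mf.
by apply: mf; exists B.
Qed.

Lemma sub_measurable_fun_measurable dU (U : measurableType dU) (f : T -> U) :
  sub_measurable_fun G f -> measurable_fun setT f.
Proof. by move=> mf _ B mB; apply: sub_sigma_measurable; apply: mf; exists B. Qed.

(** The identity towards the coarser sigma-algebra: the distribution of [idG] is the restriction of
    [P] to [G]. *)
Let idG : T -> TG := id.

Lemma measurable_sub_id : measurable_fun setT idG.
Proof. by move=> _ B mB; rewrite setTI; exact: sub_sigma_measurable. Qed.

HB.instance Definition _ := isMeasurableFun.Build _ _ _ _ idG measurable_sub_id.

Local Open Scope ereal_scope.

(** [g] is the Radon-Nikodym derivative of the charge [E |-> \int_E f] with respect to [P], both
    restricted to [G]. *)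
Lemma condexp_exists f : P.-integrable setT (EFin \o f) ->
  exists g, [/\ sub_measurable_fun G g, P.-integrable setT (EFin \o g) &
    forall E, G E -> \int[P]_(w in E) (f w)%:E = \int[P]_(w in E) (g w)%:E].
Proof.
move=> intf.
pose nu0 : {charge set T -> \bar R} := induced_charge intf.
have nuG0 : (nu0 : set TG -> \bar R) set0 = 0 by rewrite charge0.
have nuGfin : fin_num_fun (nu0 : set TG -> \bar R).
  by move=> A /sub_sigma_measurable mA; exact: fin_num_measure.
have nuGs : semi_sigma_additive (nu0 : set TG -> \bar R).
  move=> F mF tF mUF; apply: charge_semi_sigma_additive => //.
    by move=> i; exact: (sub_sigma_measurable (mF i)).
  exact: sub_sigma_measurable.
pose nu : {charge set TG -> \bar R} := HB.pack (nu0 : set TG -> \bar R)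
  (isCharge.Build _ TG R (nu0 : set TG -> \bar R) nuG0 nuGfin nuGs).
pose mu := distribution P (idG : {mfun T >-> TG}).
have numu : nu `<< mu.
  apply/null_content_dominatesP => A mA; rewrite /mu /distribution /pushforward.
  move=> muA0; apply/eqP; rewrite -abse_eq0; apply/eqP.
  have mA' := sub_sigma_measurable mA.
  apply/eqP; rewrite eq_le abse_ge0 andbT.
  rewrite (le_trans (le_abse_integral P mA' _))//.
    exact: measurable_funTS (measurable_int _ intf).
  by rewrite integral_abs_eq0//; exact: measurable_funTS (measurable_int _ intf).
pose g := fine \o (Radon_Nikodym nu mu : TG -> \bar R).
have gE w : (g w)%:E = (Radon_Nikodym nu mu : TG -> \bar R) w.
  by rewrite /g/= fineK// Radon_Nikodym_fin_num.
have gEf : EFin \o g = Radon_Nikodym nu mu by apply/funext => w; rewrite /= gE.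
have := Radon_Nikodym_integrable numu; rewrite -gEf => intg.
have mg : measurable_fun setT (g : TG -> R).
  by have /integrableP[/measurable_EFinP] := intg.
have intgP : P.-integrable setT (EFin \o g).
  apply/integrableP; split.
    exact/measurable_EFinP/sub_measurable_fun_measurable/sub_measurable_funP.
  have /integrableP[_] := intg.
  rewrite ge0_integral_distribution//.
  by apply: measurableT_comp => //; exact/measurable_EFinP.
exists g; split => //; first exact/sub_measurable_funP.
move=> E mE.
transitivity (nu E) => //.
rewrite (Radon_Nikodym_integral numu mE) -gEf.
rewrite integral_pushforward//.
- exact: (measurable_int _ intg).
- by apply: (integrableS measurableT) => //; exact: sub_sigma_measurable.
Qed.

(* Layer cake: [D w * h w] is the integral over [t] of [D w] on [h w > t]. *)
Lemma integral_mul_eq0_ge0 (D h : T -> R) : P.-integrable setT (EFin \o D) ->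
  (forall E, G E -> \int[P]_(w in E) (D w)%:E = 0) ->
  sub_measurable_fun G h -> (forall w, (0 <= h w)%R) ->
  P.-integrable setT (fun w => (D w * h w)%:E) ->
  \int[P]_w (D w * h w)%:E = 0.
Proof.
move=> intD D0 Gh h0 intDh.
have mh := sub_measurable_fun_measurable Gh.
have mD : measurable_fun setT D by apply/measurable_EFinP; exact: measurable_int intD.
pose F (p : T * R) : \bar R := (D p.1)%:E * (\1_[set q : T * R | 0 <= q.2 < h q.1]%R p)%:E.
have mU : measurable [set q : T * R | (0 <= q.2 < h q.1)%R].
  rewrite [X in measurable X](_ : _ = (snd @^-1` `[0%R, +oo[%classic) `&`
      ((fun q : T * R => h q.1 - q.2)%R @^-1` `]0%R, +oo[%classic)); last first.
    apply/seteqP; split => q /=; rewrite !in_itv/= !andbT subr_gt0.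
      by move=> /andP.
    by move=> [-> ->].
  apply: measurableI.
    by rewrite -[X in measurable X]setTI; apply: measurable_snd.
  rewrite -[X in measurable X]setTI.
  have : measurable_fun setT (fun q : T * R => h q.1 - q.2)%R.
    apply: measurable_funB => //.
    by apply: measurableT_comp.
  exact.
have mF : measurable_fun setT F.
  apply: emeasurable_funM; apply/measurable_EFinP.
    by apply: measurableT_comp.
  exact: measurable_indic.
have ind w (t : R) : \1_[set q : T * R | (0 <= q.2 < h q.1)%R] (w, t) =
    \1_(`[0%R, h w[%classic : set R) t :> R.
  rewrite /indic/=; congr (_%:R); congr (nat_of_bool _).
have sec w : \int[lebesgue_measure]_t (\1_[set q : T * R | (0 <= q.2 < h q.1)%R] (w, t))%:E = (h w)%:E.
  transitivity (\int[lebesgue_measure]_t (\1_(`[0%R, h w[%classic : set R) t)%:E).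
    by apply: eq_integral => t _; rewrite ind.
  rewrite integral_indic// setIT/= lebesgue_measure_itv/= lte_fin.
  have := h0 w; rewrite le_eqVlt => /predU1P[<-|->]; first by rewrite ltxx.
  by rewrite oppr0 adde0.
have mind w : measurable_fun setT (fun t : R =>
    (\1_[set q : T * R | (0 <= q.2 < h q.1)%R] (w, t))%:E : \bar R).
  apply/measurable_EFinP.
  rewrite [X in measurable_fun _ X](_ : _ = \1_(`[0%R, h w[%classic : set R)).
    exact: measurable_indic.
  by apply/funext => t; exact: ind.
have intF : (P \x lebesgue_measure).-integrable setT F.
  apply/(@integrable12ltyP _ _ _ _ _ P lebesgue_measure) => //.
  rewrite (eq_integral (fun w => `|(D w * h w)%:E|)).
    by have /integrableP[] := intDh.
  move=> w _.
  transitivity (\int[lebesgue_measure]_t ((`|D w|)%:E *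
      (\1_[set q : T * R | (0 <= q.2 < h q.1)%R] (w, t))%:E)).
    apply: eq_integral => t _; rewrite /F -EFinM abse_EFin normrM.
    by rewrite [X in (_ * X)%R]ger0_norm.
  rewrite ge0_integralZl//; first by rewrite sec abse_EFin normrM (ger0_norm (h0 w)).
  exact: mind.
transitivity (\int[P]_w \int[lebesgue_measure]_t F (w, t)).
  apply: eq_integral => w _; rewrite /F/= integralZl//.
    by rewrite sec EFinM.
  apply/integrableP; split; first exact: mind.
  under eq_integral do rewrite gee0_abs ?lee_fin//.
  by rewrite sec ltry.
rewrite (@Fubini _ _ _ _ _ P lebesgue_measure)// integral0_eq// => t _.
have [t0|t0] := ltP t 0%R.
  rewrite integral0_eq// => w _; rewrite /F/= indicE memNset ?mule0//=.
  by move=> /andP[]; rewrite leNgt t0.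
rewrite -(D0 [set w | t < h w]%R); last first.
  rewrite (_ : [set w | _] = setT `&` h @^-1` `]t, +oo[%classic); last first.
    by apply/seteqP; split => w /=; rewrite in_itv/= andbT// => -[].
  by apply: Gh; exists `]t, +oo[%classic.
rewrite [RHS]integral_mkcond; apply: eq_integral => w _; rewrite /F/= patchE.
rewrite indicE; case: ifPn => [|].
  by rewrite inE/= => tw; rewrite mem_set ?mule1//= t0 tw.
by rewrite notin_setE/= => tw; rewrite memNset ?mule0// => /andP[_].
Qed.

Lemma integral_mul_eq0 (D h : T -> R) : P.-integrable setT (EFin \o D) ->
  (forall E, G E -> \int[P]_(w in E) (D w)%:E = 0) ->
  sub_measurable_fun G h ->
  P.-integrable setT (fun w => (D w * h w)%:E) ->
  \int[P]_w (D w * h w)%:E = 0.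
Proof.
move=> intD D0 Gh intDh.
have mD : measurable_fun setT D by exact/measurable_EFinP/(measurable_int _ intD).
have part (k : T -> R) : sub_measurable_fun G k -> (forall w, (0 <= k w <= `|h w|)%R) ->
    P.-integrable setT (fun w => (D w * k w)%:E) /\ \int[P]_w (D w * k w)%:E = 0.
  move=> Gk kh; have intDk : P.-integrable setT (fun w => (D w * k w)%:E).
    apply: (le_integrable measurableT _ _ intDh).
      apply/measurable_EFinP/measurable_funM => //.
      exact: sub_measurable_fun_measurable.
    move=> w _; rewrite lee_fin !normrM ler_wpM2l//.
    by have /andP[k0 kw] := kh w; rewrite (ger0_norm k0).
  by split => //; apply: integral_mul_eq0_ge0 => // w; have /andP[] := kh w.
have mh : measurable_fun setT (h : TG -> R) by exact/sub_measurable_funP.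
have [||intp p0] := @part (fun w => Num.max (h w) 0%R).
- apply/sub_measurable_funP; exact: measurable_maxr.
- by move=> w; rewrite le_max lexx orbT ge_max ler_norm normr_ge0.
have [||intm m0] := @part (fun w => Num.max (- h w)%R 0%R).
- apply/sub_measurable_funP; apply: measurable_maxr => //.
  exact: measurable_funN.
- by move=> w; rewrite le_max lexx orbT ge_max -normrN ler_norm normr_ge0.
transitivity (\int[P]_w ((D w * Num.max (h w) 0)%:E - (D w * Num.max (- h w) 0)%:E)).
  apply: eq_integral => w _; rewrite -EFinB -mulrBr; congr (_ * _)%:E.
  have [h0|h0] := leP 0%R (h w).
    by rewrite (max_idPr _) ?subr0// oppr_le0.
  by rewrite (max_idPl _) ?sub0r ?opprK// oppr_ge0 ltW.
by rewrite integralB// p0 m0 sube0.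
Qed.

Lemma condexp_indic F : measurable F -> exists p : T -> R,
  [/\ sub_measurable_fun G p, (forall w, (0 <= p w <= 1)%R) &
   forall E, G E -> \int[P]_(w in E) (\1_F w - p w)%:E = 0].
Proof.
move=> mF.
have int1 : P.-integrable setT (EFin \o (\1_F : T -> R)).
  by apply: integrable_indic => //; rewrite -ge0_fin_numE// fin_num_measure.
have [g [Gg intg gE]] := condexp_exists int1.
have mg : measurable_fun setT (g : TG -> R) by exact/sub_measurable_funP.
have mg' : measurable_fun setT g by exact: sub_measurable_fun_measurable.
have intc r : P.-integrable setT (EFin \o (fun=> r) : T -> \bar R).
  exact: finite_measure_integrable_cst.
have g1 : {ae P, forall w, (g w <= 1)%R}.
  apply: (@ae_le_integral_gt _ _ _ P g (fun=> 1%R)) => //.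
  rewrite -gE; last first.
    rewrite (_ : [set w | _] = setT `&` g @^-1` `]1%R, +oo[%classic).
      by apply: Gg; exists (`]1%R, +oo[%classic).
    by apply/seteqP; split => w /=; rewrite in_itv/= andbT// => -[].
  have mE : measurable [set w | (1 < g w)%R].
    rewrite (_ : [set w | _] = setT `&` g @^-1` `]1%R, +oo[%classic).
      exact: mg'.
    by apply/seteqP; split => w /=; rewrite in_itv/= andbT// => -[].
  apply: ge0_le_integral => //=.
  - by apply/measurable_EFinP; exact: measurable_indic.
  - by move=> w _; rewrite lee_fin indicE lern1 leq_b1.
have g0 : {ae P, forall w, (0 <= g w)%R}.
  apply: (@ae_le_integral_gt _ _ _ P (fun=> 0%R) g) => //.
  rewrite -gE; last first.
    rewrite (_ : [set w | _] = setT `&` g @^-1` `]-oo, 0%R[%classic).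
      by apply: Gg; exists (`]-oo, 0%R[%classic).
    by apply/seteqP; split => w /=; rewrite in_itv/=// => -[].
  rewrite integral0_eq//; apply: integral_ge0 => w _.
  by rewrite lee_fin.
(* [g] lies in [0, 1] almost surely only. Truncation gives the bounds at every point and preserves
   measurability for [G]. *)
pose p w := Num.max 0%R (Num.min (g w) 1%R).
have Gp : sub_measurable_fun G p.
  apply/sub_measurable_funP; apply: measurable_maxr => //.
  exact: measurable_minr.
exists p; split => //.
  by move=> w; rewrite /p le_max lexx ge_max ler01 ge_min lexx orbT.
move=> E GE; have mE := sub_sigma_measurable GE.
transitivity (\int[P]_(w in E) ((\1_F w)%:E - (g w)%:E)).
  apply: ae_eq_integral => //.
  - apply/measurable_EFinP/measurable_funB; first exact: measurable_indic.
    by apply: measurable_funTS; exact: sub_measurable_fun_measurable.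
  - apply: emeasurable_funB; apply/measurable_EFinP; first exact: measurable_indic.
    exact: measurable_funTS.
  - apply: filterS2 g0 g1 => w g0w g1w _ /=.
    by rewrite -EFinB /p (min_idPl g1w) (max_idPr g0w).
rewrite integralB//.
- by rewrite -gE// subee// integrable_fin_num//; exact: integrableS int1.
- exact: integrableS int1.
- exact: integrableS intg.
Qed.

End sub_sigma_algebra.

Lemma ae_integrable d (T : measurableType d) (R : realType)
    (mu : {measure set T -> \bar R}) (f g : T -> \bar R) :
  measurable_fun setT g -> mu.-integrable setT f ->
  {ae mu, forall w, f w = g w} -> mu.-integrable setT g.
Proof.
move=> mg /[dup] intf /integrableP[mf foo] fg; apply/integrableP; split => //.
rewrite -(@ge0_ae_eq_integral _ _ _ mu setT (abse \o f))//.
- exact: measurableT_comp.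
- exact: measurableT_comp.
- by move=> x _; exact: abse_ge0.
- by apply: filterS fg => w /= -> _.
Qed.

Lemma bounded_integrable d (T : measurableType d) (R : realType)
    (P : probability T R) (f : T -> R) (M : R) :
  measurable_fun setT f -> (forall w, `|f w| <= M) ->
  P.-integrable setT (EFin \o f).
Proof.
move=> mf fM; apply: (@le_integrable _ _ _ P setT measurableT _ (EFin \o cst M)).
- exact/measurable_EFinP.
- by move=> w _; rewrite lee_fin (le_trans (fM w))// ler_norm.
- exact: finite_measure_integrable_cst.
Qed.

Lemma integrable_mul_bounded d (T : measurableType d) (R : realType)
    (mu : {measure set T -> \bar R}) (V W : T -> R) (M : R) :
  measurable_fun setT W -> (forall w, `|W w| <= M) ->
  mu.-integrable setT (EFin \o V) -> mu.-integrable setT (fun w => (V w * W w)%:E).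
Proof.
move=> mW WM intV.
apply: (@le_integrable _ _ _ mu setT measurableT _ (fun w => M%:E * (V w)%:E)%E).
- apply/measurable_EFinP/measurable_funM => //.
  exact/measurable_EFinP/(measurable_int _ intV).
- move=> w _; rewrite lee_fin !normrM mulrC ler_wpM2r//.
  by rewrite (le_trans (WM w))// ler_norm.
- exact: integrableZl.
Qed.

(** * Integrals depending on a parameter *)

Section parametric_integral.
Context d1 d2 (T1 : measurableType d1) (T2 : measurableType d2) (R : realType).
Local Open Scope ereal_scope.

(** An extended integral is the difference of the integrals of the positive and negative parts, and
    Tonelli handles each of them. *)
Lemma measurable_integral2 (m2 : {sigma_finite_measure set T2 -> \bar R})
    (f : T1 * T2 -> \bar R) : measurable_fun setT f ->
  measurable_fun setT (fun x => \int[m2]_y f (x, y)).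
Proof.
move=> mf; rewrite [X in measurable_fun _ X](_ : _ = fun x =>
    \int[m2]_y f^\+ (x, y) - \int[m2]_y f^\- (x, y)); last first.
  by apply/funext => x; rewrite [LHS]integralE; congr (_ - _); apply: eq_integral => y _; rewrite ?funeposE ?funenegE.
apply: emeasurable_funB.
  exact: (measurable_fun_fubini_tonelli_F _ (measurable_funepos mf)).
exact: (measurable_fun_fubini_tonelli_F _ (measurable_funeneg mf)).
Qed.

Lemma measurable_integral1 (m1 : {sigma_finite_measure set T1 -> \bar R})
    (f : T1 * T2 -> \bar R) : measurable_fun setT f ->
  measurable_fun setT (fun y => \int[m1]_x f (x, y)).
Proof.
move=> mf; rewrite [X in measurable_fun _ X](_ : _ = fun y =>
    \int[m1]_x f^\+ (x, y) - \int[m1]_x f^\- (x, y)); last first.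
  by apply/funext => x; rewrite [LHS]integralE; congr (_ - _); apply: eq_integral => y _; rewrite ?funeposE ?funenegE.
apply: emeasurable_funB.
  exact: (measurable_fun_fubini_tonelli_G _ (measurable_funepos mf)).
exact: (measurable_fun_fubini_tonelli_G _ (measurable_funeneg mf)).
Qed.

Lemma measurable_integral1_in (m1 : {sigma_finite_measure set T1 -> \bar R})
    (D : set T1) (f : T1 * T2 -> \bar R) : measurable D -> measurable_fun setT f ->
  measurable_fun setT (fun y => \int[m1]_(x in D) f (x, y)).
Proof.
move=> mD mf.
rewrite [X in measurable_fun _ X](_ : _ = fun y =>
    \int[m1]_x (f \_ (D `*` setT)) (x, y)); last first.
  apply/funext => y; rewrite integral_mkcond; apply: eq_integral => x _.
  rewrite !patchE; congr (if _ then _ else _).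
  by apply/idP/idP; rewrite !inE//= => -[].
apply: measurable_integral1; apply/(measurable_restrictT _ _).1 => //.
  exact: measurableX.
exact: measurable_funTS.
Qed.

Variables (m1 : {sigma_finite_measure set T1 -> \bar R}) (P : probability T2 R).
Variables (D : set T1) (X : T1 -> T2 -> R).
Hypotheses (mD : measurable D) (Doo : m1 D < +oo).
Hypothesis mX : measurable_fun [set: T1 * T2] (fun p => X p.1 p.2).

(** [fine] makes this real at every [w], with value 0 where the integral is infinite; under the
    bound [Xc] below this happens on a null set only. *)
Definition pint w : R := fine (\int[m1]_(x in D) (X x w)%:E).

Lemma measurable_pint : measurable_fun setT pint.
Proof.
apply: measurableT_comp => //.
apply: (@measurable_integral1_in m1 D (fun p => (X p.1 p.2)%:E)) => //.
exact/measurable_EFinP.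
Qed.

Variable c : R.
Hypothesis Xc : forall x, D x -> \int[P]_w `|X x w|%:E <= c%:E.

(** The factor [\1_D] moves the integral over [D] to the whole space, where Fubini on the product
    measure applies. *)
Let FX (Z : T2 -> R) (p : T1 * T2) : \bar R := ((\1_D p.1 * X p.1 p.2) * Z p.2)%:E.

Let intFX (Z : T2 -> R) (c' : R) : measurable_fun setT Z ->
  (forall x, D x -> \int[P]_w `|X x w * Z w|%:E <= c'%:E) ->
  (m1 \x P).-integrable setT (FX Z).
Proof.
move=> mZ Zc.
have mFX : measurable_fun setT (FX Z).
  apply/measurable_EFinP/measurable_funM; first apply: measurable_funM => //.
    by apply: (measurableT_comp (measurable_indic mD)).
  by apply: measurableT_comp.
apply/(integrable12ltyP m1 P) => //.
rewrite (@le_lt_trans _ _ (\int[m1]_(x in D) (`|c'|%:E)))//; last first.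
  by rewrite integral_cst//= lte_mul_pinfty// ?lee_fin.
rewrite [leRHS]integral_mkcond; apply: ge0_le_integral => //.
- by move=> x _; apply: integral_ge0.
- apply: (@measurable_integral2 P (fun p => `|FX Z p|)).
  exact: measurableT_comp.
- by apply/(measurable_restrictT _ _).1 => //; exact: measurable_cst.
move=> x _; rewrite patchE; case: ifPn => [|]; rewrite /FX /=.
  rewrite inE => Dx; under eq_integral do rewrite indicE mem_set// mul1r.
  by rewrite (le_trans (Zc x Dx))// lee_fin ler_norm.
rewrite notin_setE => Dx; rewrite integral0_eq// => w _.
by rewrite indicE memNset// !mul0r normr0.
Qed.

Let X_intD (Z : T2 -> R) w :
  \int[m1]_x FX Z (x, w) = \int[m1]_(x in D) (X x w * Z w)%:E.
Proof.
rewrite [RHS]integral_mkcond; apply: eq_integral => x _.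
rewrite patchE /FX/= indicE; case: ifPn => xD; first by rewrite mul1r.
by rewrite !mul0r.
Qed.

Lemma ae_integrable_param : {ae P, forall w, m1.-integrable D (fun x => (X x w)%:E)}.
Proof.
have intF1 : (m1 \x P).-integrable setT (FX (fun=> 1%R)).
  apply: (@intFX _ c) => // x Dx; under eq_integral do rewrite mulr1.
  exact: Xc.
apply: filterS (ae_integrable2 intF1) => w intw.
apply/integrable_mkcond => //.
rewrite (_ : _ \_ _ = fun x => FX (fun=> 1%R) (x, w))//.
apply/funext => x; rewrite patchE /FX/= indicE; case: ifPn => xD.
  by rewrite mul1r mulr1.
by rewrite !mul0r.
Qed.

(** Fubini with a weight. [Z = 1] gives the mean of an average, [Z] another average gives a
    covariance, and [Z] a conditioning residual gives orthogonality to it. *)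
Lemma pint_mulr (Z : T2 -> R) (c' : R) : measurable_fun setT Z ->
  (forall x, D x -> \int[P]_w `|X x w * Z w|%:E <= c'%:E) ->
  P.-integrable setT (fun w => (pint w * Z w)%:E) /\
  \int[P]_w (pint w * Z w)%:E = \int[m1]_(x in D) \int[P]_w (X x w * Z w)%:E.
Proof.
move=> mZ Zc.
have intF := intFX mZ Zc.
have aeE : {ae P, forall w, \int[m1]_x FX Z (x, w) = (pint w * Z w)%:E}.
  apply: filterS ae_integrable_param => w intw.
  rewrite X_intD; under eq_integral do rewrite mulrC EFinM.
  rewrite integralZl// muleC EFinM /pint fineK//.
  exact: integrable_fin_num.
have mpZ : measurable_fun setT (fun w => (pint w * Z w)%:E).
  by apply/measurable_EFinP/measurable_funM => //; exact: measurable_pint.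
have mFZ := measurable_int _ intF.
have intG : P.-integrable setT (fubini_G m1 (FX Z)).
  apply/integrableP; split; first exact: (measurable_integral1 m1 mFZ).
  apply: le_lt_trans ((integrable21ltyP m1 P mFZ).1 intF).
  apply: ge0_le_integral => //.
  - by apply: measurableT_comp => //; exact: (measurable_integral1 m1 mFZ).
  - by apply: (@measurable_integral1 m1 (abse \o FX Z)); exact: measurableT_comp.
  - move=> w _; apply: le_abse_integral => //.
    exact: (measurable_fun_pair1 _ mFZ).
have aeE' : ae_eq P setT (fubini_G m1 (FX Z)) (fun w => (pint w * Z w)%:E).
  by apply: filterS aeE => w aew _; exact: aew.
split; first exact: (ae_integrable mpZ intG aeE).
transitivity (\int[P]_w fubini_G m1 (FX Z) w).
  by apply/esym/ae_eq_integral => //; exact: (measurable_int _ intG).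
rewrite /fubini_G -(Fubini intF) [RHS]integral_mkcond.
apply: eq_integral => x _; rewrite patchE; case: ifPn => xD.
  by apply: eq_integral => w _; rewrite /FX/= indicE xD mul1r.
rewrite integral0_eq// => w _; rewrite /FX/= indicE (negPf xD).
by rewrite !mul0r.
Qed.

Lemma integral_pint : P.-integrable setT (EFin \o pint) /\
  \int[P]_w (pint w)%:E = \int[m1]_(x in D) \int[P]_w (X x w)%:E.
Proof.
have [|intp pE] := @pint_mulr (fun=> 1%R) c (measurable_cst _).
  by move=> x Dx; under eq_integral do rewrite mulr1; exact: Xc.
have E Y : (fun w => (Y w * 1)%:E) = EFin \o Y :> (T2 -> \bar R).
  by apply/funext => w; rewrite mulr1.
rewrite E in intp; split => //.
move: pE; rewrite E => ->; apply: eq_integral => x _.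
by under eq_integral do rewrite mulr1.
Qed.

(* [A] is not assumed to be measurable for [Borel x sigma(A)], so [pint] itself
   need not be [G]-measurable even when every [X x] is. *)
Lemma sub_measurable_pint (C : set (set T2)) : C `<=` measurable ->
  (forall x, D x -> sub_measurable_fun <<s C >> (X x)) ->
  exists Y : T2 -> R, sub_measurable_fun <<s C >> Y /\
    {ae P, forall w, Y w = pint w}.
Proof.
move=> CT GX; have [intp _] := integral_pint.
have mp : measurable_fun setT pint by exact/measurable_EFinP/(measurable_int _ intp).
have [Y [GY intY YE]] := condexp_exists CT intp.
have mY : measurable_fun setT Y := sub_measurable_fun_measurable CT GY.
exists Y; split => //.
suff : ae_eq P setT (EFin \o Y) (EFin \o pint).
  by apply: filterS => w /= /(_ I) [].
apply: integral_ae_eq => //; first exact: (measurable_int _ intp).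
move=> F _ mF.
(* [Y] is the conditional expectation of [pint]; they must agree on every measurable [F], not only
   on [F] in [G]. The indicator of [F] splits into [q = P(F | G)] and the residual [Dq], which is
   orthogonal to [G]-measurable variables. Each [X x] is one of these, so by Fubini [pint] is
   orthogonal to [Dq] as well; and [pint - Y] is orthogonal to [q]. *)
have [q [Gq q01 qE]] := condexp_indic P CT mF.
have mq : measurable_fun setT q := sub_measurable_fun_measurable CT Gq.
pose Dq w : R := (\1_F w - q w)%R.
have mDq : measurable_fun setT Dq by apply: measurable_funB => //; exact: measurable_indic.
have Dq1 w : (`|Dq w| <= 1)%R.
  rewrite /Dq ler_norml; have /andP[q0 q1] := q01 w.
  by rewrite indicE; case: (_ \in _) => /=; apply/andP; split; lra.
have intDq : P.-integrable setT (EFin \o Dq).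
  exact: (bounded_integrable _ mDq Dq1).
have intM (V W : T2 -> R) : measurable_fun setT W -> (forall w, `|W w| <= 1)%R ->
    P.-integrable setT (EFin \o V) -> P.-integrable setT (fun w => (V w * W w)%:E).
  exact: integrable_mul_bounded.
have DX x : D x -> \int[P]_w (X x w * Dq w)%:E = 0.
  move=> Dx; under eq_integral do rewrite mulrC.
  have mXx : measurable_fun setT (X x) := sub_measurable_fun_measurable CT (GX _ Dx).
  apply: (integral_mul_eq0 CT intDq qE (GX _ Dx)).
  under eq_fun do rewrite mulrC.
  apply: intM => //; apply/integrableP; split; first exact/measurable_EFinP.
  by rewrite (le_lt_trans (Xc Dx))// ltry.
have pD0 : \int[P]_w (pint w * Dq w)%:E = 0.
  have [|_ ->] := @pint_mulr Dq c mDq.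
    move=> x Dx; apply: le_trans (Xc Dx); apply: ge0_le_integral => //.
    - apply/measurable_EFinP/measurableT_comp => //; apply: measurable_funM => //.
      exact: (sub_measurable_fun_measurable CT (GX _ Dx)).
    - apply/measurable_EFinP/measurableT_comp => //.
      exact: (sub_measurable_fun_measurable CT (GX _ Dx)).
    - by move=> w _; rewrite lee_fin normrM ler_piMr.
  by rewrite integral0_eq// => x Dx; exact: DX.
have YD0 : \int[P]_w (Y w * Dq w)%:E = 0.
  under eq_integral do rewrite mulrC.
  apply: (integral_mul_eq0 CT intDq qE GY).
  by under eq_fun do rewrite mulrC; exact: intM.
have intpY : P.-integrable setT (EFin \o (pint \- Y)%R).
  rewrite (_ : _ \o _ = (EFin \o pint) \- (EFin \o Y))//; exact: integrableB.
have q1 w : (`|q w| <= 1)%R by have /andP[q0 ?] := q01 w; rewrite ger0_norm.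
have pYq0 : \int[P]_w ((pint w - Y w) * q w)%:E = 0.
  apply: (integral_mul_eq0 CT intpY _ Gq); last exact: intM.
  move=> E GE; have mE := sub_sigma_measurable CT GE.
  have intpE := integrableS measurableT mE (@subsetT _ _) intp.
  have intYE := integrableS measurableT mE (@subsetT _ _) intY.
  under eq_integral do rewrite EFinB.
  rewrite (integralB mE intpE intYE) (YE _ GE) subee//.
  exact: (integrable_fin_num mE intYE).
have intpD := intM _ _ mDq Dq1 intp; have intYD := intM _ _ mDq Dq1 intY.
have intpYq := intM _ _ mq q1 intpY.
have i1 w : (`|\1_F w : R| <= 1)%R by rewrite indicE ger0_norm// lern1 leq_b1.
have m1F : measurable_fun setT (\1_F : T2 -> R) by exact: measurable_indic.
(* Here [(pint - Y) \1_F = pint Dq - Y Dq + (pint - Y) q], and the three terms on the right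
   integrate to 0. *)
have : \int[P]_w (pint w * \1_F w)%:E - \int[P]_w (Y w * \1_F w)%:E = 0.
  rewrite -integralB//; [|exact: intM..].
  transitivity (\int[P]_w ((pint w * Dq w)%:E - (Y w * Dq w)%:E +
      ((pint w - Y w) * q w)%:E)).
    apply: eq_integral => w _; rewrite -!EFinB -EFinD; congr EFin.
    by rewrite /Dq; ring.
  rewrite integralD//; last exact: integrableB.
  by rewrite integralB// pD0 YD0 pYq0 sube0 adde0.
have restr (V : T2 -> R) : \int[P]_(w in F) (V w)%:E = \int[P]_w (V w * \1_F w)%:E.
  rewrite integral_mkcond; apply: eq_integral => w _.
  by rewrite patchE indicE; case: ifPn => _; rewrite ?mulr1 ?mulr0.
have intY1 : P.-integrable setT (fun w => (Y w * \1_F w)%:E).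
  exact: (intM Y _ m1F i1 intY).
have := integrable_fin_num measurableT intY1; rewrite /= !restr.
case: (\int[P]_w (Y w * _)%:E) (\int[P]_w (pint w * _)%:E) => [u| |] [v| |]//= _.
by case => /subr0_eq ->.
Qed.

End parametric_integral.

(** * Covariance of a stationary field *)

Section Lfun2.
Context d (T : measurableType d) (R : realType) (P : probability T R).
Local Open Scope ereal_scope.
Implicit Types X Y : T -> R.

Lemma Lfun2_sqr X : measurable_fun setT X -> \int[P]_w (X w ^+ 2)%:E < +oo ->
  X \in Lfun P 2%:E.
Proof.
move=> mX Xoo; rewrite inE; apply/andP; split; rewrite inE//=.
rewrite /finite_norm unlock /Lnorm poweR_lty//.
rewrite (eq_integral (fun w => (X w ^+ 2)%:E))// => w _.
by rewrite /= powR_mulrn// real_normK// num_real.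
Qed.

Lemma Lfun2_measurable X : X \in Lfun P 2%:E -> measurable_fun setT X.
Proof. by rewrite inE => /andP[]; rewrite inE. Qed.

Lemma Lfun2_sqr_lty X : X \in Lfun P 2%:E -> \int[P]_w (X w ^+ 2)%:E < +oo.
Proof.
move=> /Lfun2_integrable_sqr /integrableP[_]; apply: le_lt_trans.
rewrite le_eqVlt; apply/orP; left; apply/eqP.
by apply: eq_integral => w _; rewrite /= ger0_norm ?sqr_ge0.
Qed.

Lemma Lfun2_integrable X : X \in Lfun P 2%:E -> P.-integrable setT (EFin \o X).
Proof.
move=> X2; apply/Lfun1_integrable; apply: Lfun_subset12 => //.
by rewrite fin_num_measure.
Qed.

Lemma Lfun2_integrableM X Y : X \in Lfun P 2%:E -> Y \in Lfun P 2%:E ->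
  P.-integrable setT (fun w => (X w * Y w)%:E).
Proof. by move=> X2 Y2; have /Lfun1_integrable := Lfun2_mul_Lfun1 X2 Y2. Qed.

Lemma bounded_Lfun2 X (M : R) : measurable_fun setT X -> (forall w, `|X w| <= M)%R ->
  X \in Lfun P 2%:E.
Proof.
move=> mX XM; apply: Lfun2_sqr => //.
rewrite (@le_lt_trans _ _ (\int[P]_w (M ^+ 2)%:E))//; last first.
  apply: integrable_lty => //; exact: finite_measure_integrable_cst.
apply: ge0_le_integral => //.
- by move=> w _; rewrite lee_fin sqr_ge0.
- by apply/measurable_EFinP; exact: measurable_funX.
- move=> w _; rewrite lee_fin -real_normK ?num_real// ler_pXn2r ?nnegrE//.
  exact: le_trans (XM w).
Qed.

Lemma Lfun2_ae_eq X Y : measurable_fun setT Y -> X \in Lfun P 2%:E ->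
  {ae P, forall w, X w = Y w} -> Y \in Lfun P 2%:E.
Proof.
move=> mY X2 XY; apply: Lfun2_sqr => //.
rewrite -(@ge0_ae_eq_integral _ _ _ P setT (fun w => (X w ^+ 2)%:E))//.
- exact: Lfun2_sqr_lty.
- by apply/measurable_EFinP/measurable_funX; exact: Lfun2_measurable.
- by apply/measurable_EFinP/measurable_funX.
- by move=> w _; rewrite lee_fin sqr_ge0.
- by move=> w _; rewrite lee_fin sqr_ge0.
- by apply: filterS XY => w /= -> _.
Qed.

Lemma expectation_ae_eq X Y : measurable_fun setT X -> measurable_fun setT Y ->
  {ae P, forall w, X w = Y w} -> 'E_P[X] = 'E_P[Y].
Proof.
move=> mX mY XY; rewrite unlock; apply: ae_eq_integral => //.
- exact/measurable_EFinP.
- exact/measurable_EFinP.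
- by apply: filterS XY => w /= -> _.
Qed.

Lemma covariance_ae_eq X X' Y Y' : measurable_fun setT X ->
  measurable_fun setT X' -> measurable_fun setT Y -> measurable_fun setT Y' ->
  {ae P, forall w, X w = X' w} -> {ae P, forall w, Y w = Y' w} ->
  covariance P X Y = covariance P X' Y'.
Proof.
move=> mX mX' mY mY' XX' YY'; rewrite unlock.
rewrite (expectation_ae_eq mX mX' XX') (expectation_ae_eq mY mY' YY').
apply: expectation_ae_eq.
- by apply: measurable_funM; apply: measurable_funB.
- by apply: measurable_funM; apply: measurable_funB.
- by apply: filterS2 XX' YY' => w; rewrite /= !fctE /= => -> ->.
Qed.

End Lfun2.

Section stationary_field.
Context (R : realType) (n : nat) (dO : measure_display)
  (Omega : measurableType dO) (P : probability Omega R).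
Local Notation Rd := 'rV[R]_n.
Local Notation leb := (lebesgue_rV R n).
Variable A : Rd -> Omega -> R.
Hypotheses (mA : jointly_measurable A) (sA : stationary P A).
Local Open Scope ereal_scope.

Lemma measurable_field x : measurable_fun setT (A x).
Proof. exact: (measurable_fun_pair2 x mA). Qed.

Let tupA k (x : 'I_k -> Rd) w : k.-tuple R := [tuple A (x i) w | i < k].

Let mtupA k (x : 'I_k -> Rd) : measurable_fun setT (tupA x).
Proof.
apply/measurable_fun_tnthP => i.
rewrite (_ : _ \o _ = A (x i)); first exact: measurable_field.
by apply/funext => w; rewrite /= tnth_mktuple.
Qed.

(** Stationarity says that the two tuples push [P] forward to the same measure. Signed [psi] are
    treated through their positive and negative parts. *)
Lemma stationary_integral k (x : 'I_k -> Rd) z (psi : k.-tuple R -> \bar R) :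
  measurable_fun setT psi ->
  \int[P]_w psi [tuple A (x i + z)%R w | i < k] =
  \int[P]_w psi [tuple A (x i) w | i < k].
Proof.
have ge0 (phi : k.-tuple R -> \bar R) : measurable_fun setT phi ->
    (forall t, 0 <= phi t) ->
    \int[P]_w phi (tupA (fun i => x i + z)%R w) = \int[P]_w phi (tupA x w).
  move=> mphi phi0.
  transitivity (\int[pushforward P (tupA (fun i => x i + z)%R)]_t phi t).
    by rewrite (ge0_integral_pushforward (mtupA _) P)// => t _; exact: phi0.
  transitivity (\int[pushforward P (tupA x)]_t phi t); last first.
    by rewrite (ge0_integral_pushforward (mtupA _) P)// => t _; exact: phi0.
  apply: eq_measure_integral; [exact: mtupA|exact: mtupA|move=> ? ? B mB _].
  exact: (sA z x mB).
move=> mpsi; rewrite [LHS]integralE [RHS]integralE; congr (_ - _).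
- transitivity (\int[P]_w psi^\+ (tupA (fun i => x i + z)%R w)).
    by apply: eq_integral => w _; rewrite !funeposE.
  rewrite ge0//; last exact: measurable_funepos.
  by apply: eq_integral => w _; rewrite !funeposE.
- transitivity (\int[P]_w psi^\- (tupA (fun i => x i + z)%R w)).
    by apply: eq_integral => w _; rewrite !funenegE.
  rewrite ge0//; last exact: measurable_funeneg.
  by apply: eq_integral => w _; rewrite !funenegE.
Qed.

Lemma stationary_integral2 x y z (psi : R * R -> R) : measurable_fun setT psi ->
  \int[P]_w (psi (A (x + z)%R w, A (y + z)%R w))%:E =
  \int[P]_w (psi (A x w, A y w))%:E.
Proof.
move=> mpsi.
pose p (i : 'I_2) := if i == ord0 then x else y.
pose psi2 (t : 2.-tuple R) : \bar R := (psi (tnth t ord0, tnth t ord_max))%:E.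
transitivity (\int[P]_w psi2 [tuple A (p i + z)%R w | i < 2]).
  by apply: eq_integral => w _; rewrite /psi2 !tnth_mktuple.
transitivity (\int[P]_w psi2 [tuple A (p i) w | i < 2]); last first.
  by apply: eq_integral => w _; rewrite /psi2 !tnth_mktuple.
apply: stationary_integral.
apply/measurable_EFinP; apply: (measurableT_comp mpsi).
by apply: measurable_fun_pair; exact: measurable_tnth.
Qed.

Lemma stationary_integral1 x (psi : R -> R) : measurable_fun setT psi ->
  \int[P]_w (psi (A x w))%:E = \int[P]_w (psi (A 0%R w))%:E.
Proof.
move=> mpsi; have := @stationary_integral2 0 0 x (fun p => psi p.1).
rewrite add0r; apply; apply: measurableT_comp => //.
Qed.

Hypothesis A2 : 'E_P[(fun w => `|A 0%R w| ^+ 2)%R] < +oo.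

Lemma Lfun2_field x : A x \in Lfun P 2%:E.
Proof.
apply: Lfun2_sqr; first exact: measurable_field.
rewrite (stationary_integral1 x (measurable_funX 2 (@measurable_id _ _ _))).
move: A2; rewrite unlock; under eq_integral do rewrite real_normK ?num_real//.
by [].
Qed.

Definition field_mean : R := fine 'E_P[A 0%R].

Lemma expectation_field x : 'E_P[A x] = field_mean%:E.
Proof.
rewrite /field_mean fineK; last first.
  by rewrite unlock integrable_fin_num//; exact/Lfun2_integrable/Lfun2_field.
by rewrite unlock (@stationary_integral1 x id).
Qed.

Definition cfield x w : R := (A x w - field_mean)%R.

Lemma measurable_cfield : jointly_measurable cfield.
Proof. exact: measurable_funB. Qed.

Lemma Lfun2_cfield x : cfield x \in Lfun P 2%:E.
Proof.
apply: (rpredB (Lfun2_field x)); first by rewrite lee_fin ler1n.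
by move=> ?; exact: (Lfun_cst P field_mean 2).
Qed.

Lemma autocovarianceE x y :
  autocovariance P A (y - x) = \int[P]_w (cfield x w * cfield y w)%:E.
Proof.
rewrite /autocovariance covariance.unlock !expectation_field/= unlock.
rewrite -(@stationary_integral2 0 (y - x) x (fun p => (p.1 - field_mean) * (p.2 - field_mean))%R).
  by rewrite add0r subrK.
by apply: measurable_funM; apply: measurable_funB.
Qed.

Definition cov x : R := fine (autocovariance P A x).

Lemma covE x : autocovariance P A x = (cov x)%:E.
Proof.
rewrite /cov fineK// -(subr0 x) autocovarianceE integrable_fin_num//.
by apply: Lfun2_integrableM; exact: Lfun2_cfield.
Qed.

Lemma measurable_cov : measurable_fun setT cov.
Proof.
apply: measurableT_comp => //.
rewrite (_ : autocovariance P A = fun x => \int[P]_w (cfield 0%R w * cfield x w)%:E).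
  apply: (@measurable_integral2 _ _ _ _ _ P (fun p => (cfield 0%R p.2 * cfield p.1 p.2)%:E)).
  apply/measurable_EFinP/measurable_funM; last exact: measurable_cfield.
  apply: (@measurableT_comp _ _ _ _ _ _ (cfield 0%R)) => //.
  exact: Lfun2_measurable (Lfun2_cfield _).
by apply/funext => x; rewrite -{1}(subr0 x) autocovarianceE.
Qed.

Lemma measurable_covB : measurable_fun setT (fun p : Rd * Rd => cov (p.2 - p.1)%R).
Proof.
apply: (measurableT_comp measurable_cov).
exact: (measurableT_comp (@measurable_rV_subr R n) (@measurable_swap _ _ Rd Rd)).
Qed.

End stationary_field.

(** * Continuity in mean square *)

Lemma cvge0_ex_le (R : realType) (f : nat -> \bar R) (e : R) :
  (f @ \oo --> 0)%E -> 0 < e -> exists N, (f N <= e%:E)%E.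
Proof.
move=> f0 e0; apply: contrapT => /forallNP fe.
suff : (e%:E <= 0)%E by rewrite lee_fin leNgt e0.
apply: (cvge_ge _ f0); apply: nearW => N.
by have /negP := fe N; rewrite -ltNge => /ltW.
Qed.

Definition symdiff T (E F : set T) := (E `\` F) `|` (F `\` E).

Lemma measurable_symdiff d (T : measurableType d) (E F : set T) :
  measurable E -> measurable F -> measurable (symdiff E F).
Proof. by move=> mE mF; apply: measurableU; exact: measurableD. Qed.

Lemma cvge0_small (R : realType) (f : nat -> \bar R) : (forall k, 0 <= f k)%E ->
  (forall e : R, 0 < e -> exists N, forall k, (N <= k)%N -> (f k <= e%:E)%E) ->
  (f @ \oo --> 0)%E.
Proof.
move=> f0 fe; apply/fine_cvgP; split.
  have [N fN] := fe 1 ltr01; exists N => // k /= Nk.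
  by rewrite ge0_fin_numE// (le_lt_trans (fN _ Nk))// ltry.
apply/cvgrPdist_le => e e0; have [N fN] := fe e e0; exists N => // k /= Nk.
rewrite sub0r normrN ger0_norm ?fine_ge0//.
have := fN _ Nk; case: (f k) (f0 k) => //= r _; by rewrite lee_fin.
Qed.

(** The map [a |-> a |a|] is increasing and turns an L^2 distance into an L^1 distance, to which the
    layer cake formula applies. The factor 2 is attained at [b = - a]. *)
Lemma sqr_sub_le_signed_sqr (R : realDomainType) (a b : R) :
  (a - b) ^+ 2 <= 2 * `|a * `|a| - b * `|b| |.
Proof.
have [a0|a0] := leP 0 a; have [b0|b0] := leP 0 b.
- rewrite (ger0_norm a0) (ger0_norm b0).
  by have [ab|ab] := leP a b; [rewrite ler0_norm|rewrite gtr0_norm]; nra.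
- rewrite (ger0_norm a0) (ltr0_norm b0) ger0_norm; last by nra.
  by have := sqr_ge0 (a + b); nra.
- rewrite (ltr0_norm a0) (ger0_norm b0) ler0_norm; last by nra.
  by have := sqr_ge0 (a + b); nra.
- rewrite (ltr0_norm a0) (ltr0_norm b0).
  by have [ab|ab] := leP a b; [rewrite ler0_norm|rewrite gtr0_norm]; nra.
Qed.

(** Layer cake for a distance: [|u - v|] is the length of the set of levels separating [u] from [v].
    Averaging over [Omega] expresses an L^1 distance through probabilities of level events. *)
Lemma integral_symdiff_ray (R : realType) (u v : R) :
  (\int[lebesgue_measure]_t
     (\1_(symdiff [set t | (t < u)%R] [set t | (t < v)%R]) t)%:E = `|u - v|%:E)%E.
Proof.
wlog vu : u v / v <= u.
  move=> H; have [|uv] := leP v u; first exact: H.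
  rewrite distrC -(H v u (ltW uv)); apply: eq_integral => t _.
  by rewrite /symdiff setUC.
have -> : symdiff [set t | (t < u)%R] [set t | (t < v)%R] = `[v, u[%classic.
  apply/seteqP; split => t; rewrite /symdiff/setD/= in_itv/=.
    move=> [[tu /negP]|[tv /negP]]; rewrite -leNgt => h; first by rewrite h.
    by have := lt_le_trans tv (le_trans vu h); rewrite ltxx.
  by move=> /andP[vt ->]; left; split => //; apply/negP; rewrite -leNgt.
rewrite integral_indic// setIT/= lebesgue_measure_itv/= lte_fin.
move: vu; rewrite le_eqVlt => /predU1P[->|vu]; first by rewrite ltxx subrr normr0.
by rewrite vu gtr0_norm// subr_gt0.
Qed.

(** * Continuity of translations in measure *)

Section shift_continuity.
Context (R : realType) (n : nat) (dO : measure_display)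
  (Omega : measurableType dO) (P : probability Omega R).
Local Notation Rd := 'rV[R]_n.
Local Notation leb := (lebesgue_rV R n).
Local Notation mu := (leb \x P)%E.
Implicit Types (E F : set (Rd * Omega)) (h : Rd).
Local Open Scope ereal_scope.

Definition shift1 h (p : Rd * Omega) : Rd * Omega := ((p.1 + h)%R, p.2).

Lemma measurable_shift1 h : measurable_fun setT (shift1 h).
Proof.
apply: measurable_fun_pair => //.
exact: (measurableT_comp (measurable_rV_addr h) measurable_fst).
Qed.

Lemma measurable_shift1_preimage h E : measurable E -> measurable (shift1 h @^-1` E).
Proof.
by move=> mE; rewrite -[X in measurable X]setTI; exact: measurable_shift1.
Qed.

Lemma product_measure_shift1 h E : measurable E -> mu (shift1 h @^-1` E) = mu E.
Proof.
move=> mE; rewrite /product_measure1.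
rewrite -[RHS](ge0_integral_rV_addr h)//; last exact: measurable_fun_xsection.
Qed.

(** The window [cube 1] keeps the measure finite although [E] may be unbounded in space. *)
Definition shift_defect E h :=
  mu ((cube 1 `*` setT) `&` symdiff (shift1 h @^-1` E) E).

Definition shift_continuous E := measurable E /\
  forall e : R, (0 < e)%R -> exists2 r : R, (0 < r)%R &
    forall h, cube r h -> shift_defect E h <= e%:E.

Let mcube1 : measurable (cube 1 `*` setT : set (Rd * Omega)).
Proof. by apply: measurableX => //; exact: measurable_cube. Qed.

Let mdefect E h : measurable E ->
  measurable ((cube 1 `*` setT) `&` symdiff (shift1 h @^-1` E) E).
Proof.
move=> mE; apply: measurableI => //.
by apply: measurable_symdiff => //; exact: measurable_shift1_preimage.
Qed.

Lemma shift_defectC E h : shift_defect (~` E) h = shift_defect E h.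
Proof.
congr (mu (_ `&` _)); rewrite /symdiff preimage_setC setUC.
by rewrite !setDE !setCK [in LHS]setIC [X in _ `|` X]setIC.
Qed.

Lemma shift_defectU E F h : measurable E -> measurable F ->
  shift_defect (E `|` F) h <= shift_defect E h + shift_defect F h.
Proof.
move=> mE mF; rewrite /shift_defect.
apply: (@le_trans _ _ (mu (((cube 1 `*` setT) `&` symdiff (shift1 h @^-1` E) E) `|`
    ((cube 1 `*` setT) `&` symdiff (shift1 h @^-1` F) F)))); last first.
  by apply: measureU2; exact: mdefect.
apply: le_measure; rewrite ?inE.
- by apply: mdefect; exact: measurableU.
- by apply: measurableU; exact: mdefect.
rewrite /symdiff => p [Cp [[[Ep|Fp] /= /not_orP[nE nF]]|[[Ep|Fp] /= /not_orP[nE nF]]]].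
- by left; split => //; left.
- by right; split => //; left.
- by left; split => //; right.
- by right; split => //; right.
Qed.

Lemma shift_continuousC E : shift_continuous E -> shift_continuous (~` E).
Proof.
move=> [mE cE]; split; first exact: measurableC.
by move=> e e0; have [r r0 rE] := cE e e0; exists r => // h /rE; rewrite shift_defectC.
Qed.

Lemma shift_continuousU E F :
  shift_continuous E -> shift_continuous F -> shift_continuous (E `|` F).
Proof.
move=> [mE cE] [mF cF]; split; first exact: measurableU.
move=> e e0; have e20 : (0 < e / 2)%R by rewrite divr_gt0.
have [r r0 rE] := cE _ e20; have [s s0 sF] := cF _ e20.
exists (Num.min r s); first by rewrite lt_min r0.
move=> h rsh; apply: le_trans (shift_defectU _ mE mF) _.
rewrite (splitr e) EFinD leeD//.
  by apply: rE; apply: subset_cube rsh; rewrite ge_min lexx.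
by apply: sF; apply: subset_cube rsh; rewrite ge_min lexx orbT.
Qed.

Lemma shift_continuous0 : shift_continuous set0.
Proof.
split => // e e0; exists 1%R => // h _.
by rewrite /shift_defect/symdiff preimage_set0 setDv setU0 setI0 measure0 lee_fin ltW.
Qed.

(** A countable union is replaced by a finite one up to a remainder that is small both before and
    after the shift. *)
Lemma shift_continuous_bigcup (F : (set (Rd * Omega))^nat) :
  (forall k, shift_continuous (F k)) -> shift_continuous (\bigcup_k F k).
Proof.
move=> cF; have mF k : measurable (F k) by have [] := cF k.
have mU : measurable (\bigcup_k F k) by exact: bigcup_measurable.
pose G N := \big[setU/set0]_(k < N) F k.
have cG N : shift_continuous (G N).
  rewrite /G; elim/big_ind : _ => //; [exact: shift_continuous0|exact: shift_continuousU].
have mG N : measurable (G N) by have [] := cG N.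
split => // e e0.
(* A shift by [h] in [cube 1] carries the window [cube 1] into [cube 2]. On this larger window the
   measure is finite, so the decreasing remainders tend to 0, and invariance of the measure covers
   their shifted copies. *)
pose H N := (cube 2 `*` setT) `&` (\bigcup_k F k `\` G N) : set (Rd * Omega).
have mcube2 : measurable (cube 2 `*` setT : set (Rd * Omega)).
  by apply: measurableX => //; exact: measurable_cube.
have mH N : measurable (H N) by apply: measurableI => //; exact: measurableD.
have H0 : \bigcap_N H N = set0.
  apply/seteqP; split => // p Hp; have [_ [[k _ Fp] _]] := Hp 0%N I.
  by have [_ [_]] := Hp k.+1 I; apply; rewrite /G big_ord_recr; right.
have : mu \o H @ \oo --> 0.
  rewrite -(measure0 mu) -H0; apply: nonincreasing_cvg_mu => //.
  - apply: (@le_lt_trans _ _ (mu (cube 2 `*` setT))).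
      by apply: le_measure; rewrite ?inE//; exact: subIsetl.
    rewrite product_measure1E//; last exact: measurable_cube.
    rewrite [X in X * _](_ : _ = ((2 * 2) ^+ n)%:E); last exact: lebesgue_cube.
    by rewrite [X in _ * X](_ : _ = 1) ?mule1 ?ltry//; exact: probability_setT.
  - exact: bigcap_measurable.
  - move=> N M NM; apply/subsetPset => p [Cp [Up nG]]; split => //; split => //.
    apply: contra_not nG; rewrite /G.
    by rewrite -!bigcup_mkord => -[k /= kN Fp]; exists k => //=; exact: leq_trans NM.
move=> Hcvg.
have e40 : (0 < e / 4)%R by rewrite divr_gt0.
have [N HN] := cvge0_ex_le Hcvg e40.
have e20 : (0 < e / 2)%R by rewrite divr_gt0.
have [r r0 rG] := (cG N).2 _ e20.
exists (Num.min r 1%R); first by rewrite lt_min r0 ltr01.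
move=> h rh.
have h1 : cube 1 h by apply: subset_cube rh; rewrite ge_min lexx orbT.
have hr : cube r h by apply: subset_cube rh; rewrite ge_min lexx.
apply: (@le_trans _ _ (shift_defect (G N) h + (mu (shift1 h @^-1` H N) + mu (H N)))).
  have mS := measurable_shift1_preimage h (mH N).
  apply: (@le_trans _ _ (mu (((cube 1 `*` setT) `&` symdiff (shift1 h @^-1` G N) (G N))
     `|` (shift1 h @^-1` H N `|` H N)))).
    apply: le_measure; rewrite ?inE.
    - exact: mdefect.
    - by apply: measurableU; [exact: mdefect|exact: measurableU].
    move=> p [[Cp _]]; have GU q : G N q -> (\bigcup_k F k) q.
      by rewrite /G -bigcup_mkord => -[k _ Fq]; exists k.
    have C2 : cube 2 (p.1 + h)%R.
      by rewrite (_ : 2%R = 1 + 1)%R//; exact: cube_addr.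
    have C2' : cube 2 p.1 by apply: subset_cube Cp; rewrite ler1n.
    move=> [[/= Uph nUp]|[/= Up nUph]].
      have [Gp|nGp] := pselect (G N (shift1 h p)); last by right; left; split.
      by left; split => //; left; split => //; apply: contra_not nUp; exact: GU.
    have [Gp|nGp] := pselect (G N p); last by right; right; split.
    by left; split => //; right; split => //; apply: contra_not nUph; exact: GU.
  apply: (le_trans (measureU2 _ (mdefect _ (mG N)) (measurableU _ _ mS (mH N)))).
  by rewrite leeD2l// measureU2.
rewrite product_measure_shift1//.
rewrite (_ : e = e / 2 + (e / 4 + e / 4))%R; last by field.
by rewrite !EFinD; apply: leeD; [exact: rG|exact: leeD].
Qed.

Lemma sigma_algebra_shift_continuous : sigma_algebra setT shift_continuous.
Proof.
split; [exact: shift_continuous0| |exact: shift_continuous_bigcup].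
by move=> E cE; rewrite setTD; exact: shift_continuousC.
Qed.

Lemma shift_continuousI E F :
  shift_continuous E -> shift_continuous F -> shift_continuous (E `&` F).
Proof.
move=> cE cF; rewrite -(setCK (E `&` F)) setCI; apply: shift_continuousC.
by apply: shift_continuousU; exact: shift_continuousC.
Qed.

Lemma shift_continuous_time (B : set Omega) : measurable B ->
  shift_continuous (setT `*` B).
Proof.
move=> mB; split; first exact: measurableX.
move=> e e0; exists 1%R => // h _.
rewrite (_ : shift_defect _ _ = 0) ?lee_fin ?ltW// -(measure0 mu); congr (mu _).
by apply/seteqP; split => // p [_ [[[_ Bp] nB]|[[_ Bp] nB]]]; apply: nB.
Qed.

(** Shifting a half-space by [h] changes it only inside a slab of half-width [|h_i|] around its
    boundary. *)
Lemma shift_continuous_ray (i : 'I_n) (a : R) :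
  shift_continuous ((@rV_coord R n i @^-1` `]a, +oo[%classic) `*` setT).
Proof.
have mray : measurable (@rV_coord R n i @^-1` `]a, +oo[%classic).
  by rewrite -[X in measurable X]setTI; exact: measurable_rV_coord.
split; first exact: measurableX.
move=> e e0; have d0 : (0 < (2 * 1) ^+ n.-1 * 2 :> R)%R by rewrite mulr_gt0// exprn_gt0// mulr_gt0.
(* This makes the bound of [lebesgue_slab] on [cube 1], namely [2^(n-1) * 2 r], equal to [e]. *)
pose r := (e / ((2 * 1) ^+ n.-1 * 2))%R.
have r0 : (0 < r)%R by rewrite divr_gt0.
exists r => // h hr.
have mslab : measurable [set x : Rd | cube 1 x /\ (`|x ord0 i - a| <= r)%R].
  apply: measurableI; first exact: measurable_cube.
  rewrite [X in measurable X](_ : _ = @rV_coord R n i @^-1` `[(a - r)%R, (a + r)%R]%classic).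
    by rewrite -[X in measurable X]setTI; exact: measurable_rV_coord.
  by apply/seteqP; split => x; rewrite /= in_itv/= ler_distl /rV_coord.
apply: (@le_trans _ _ (mu ([set x : Rd | cube 1 x /\ (`|x ord0 i - a| <= r)%R] `*` setT))).
  apply: le_measure; rewrite ?inE.
  - by apply: mdefect; exact: measurableX.
  - exact: measurableX.
  move=> p [[Cp _]]; have := hr i; rewrite ler_norml /rV_coord/= => /andP[h1 h2].
  rewrite /symdiff/shift1/setD/= /rV_coord !in_itv/= !andbT mxE => -[[[+ _] +]|[[+ _] +]].
    move=> ah ap; split => //; split => //; rewrite ler_distl.
    case: (ltP a (p.1 ord0 i)) => Pa; first by exfalso; exact: ap.
    by apply/andP; split; lra.
  move=> ap ah; split => //; split => //; rewrite ler_distl.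
  case: (ltP a (p.1 ord0 i + h ord0 i)%R) => Pa; first by exfalso; exact: ah.
  by apply/andP; split; lra.
rewrite product_measure1E// [X in _ * X](_ : _ = 1) ?mule1; last exact: probability_setT.
apply: (le_trans (lebesgue_slab i a ler01 (ltW r0))).
rewrite lee_fin /r mulrA [X in (X <= _)%R](_ : _ = e)//.
by field; rewrite gt_eqF// exprn_gt0// mulr_gt0.
Qed.

Lemma shift_continuous_coord (i : 'I_n) (V : set R) : measurable V ->
  shift_continuous ((@rV_coord R n i @^-1` V) `*` setT).
Proof.
move=> mV0; have mV : (@RGenOInfty.G R).-sigma.-measurable V.
  by rewrite -RGenOInfty.measurableE.
apply: (mV [set W | shift_continuous ((@rV_coord R n i @^-1` W) `*` setT)]).
split.
  split => /=.
  - by rewrite preimage_set0 set0X; exact: shift_continuous0.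
  - move=> W cW; rewrite setTD preimage_setC.
    rewrite (_ : _ `*` _ = ~` ((@rV_coord R n i @^-1` W) `*` setT)).
      exact: shift_continuousC.
    by apply/seteqP; split => p /=; [move=> [nW _] [] //|move=> nW; split => // Wp; exact: nW].
  - move=> W cW; rewrite preimage_bigcup setX_bigcupl.
    exact: shift_continuous_bigcup.
by move=> _ [a ->]; exact: shift_continuous_ray.
Qed.

Lemma shift_continuous_space (B : set Rd) : measurable B ->
  shift_continuous (B `*` setT).
Proof.
move=> mB; apply: (mB [set W | shift_continuous (W `*` setT)]); split.
  split => /=.
  - by rewrite set0X; exact: shift_continuous0.
  - move=> W cW; rewrite setTD.
    rewrite (_ : _ `*` _ = ~` (W `*` setT)); first exact: shift_continuousC.
    by apply/seteqP; split => p /=; [move=> [nW _] [] //|move=> nW; split => // Wp; exact: nW].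
  - by move=> W cW; rewrite setX_bigcupl; exact: shift_continuous_bigcup.
move=> W /=; elim/big_ind : _ => [//|X Y hX hY [/hX//|/hY//]|i _ [V mV <-]].
by rewrite setTI; exact: shift_continuous_coord.
Qed.

(** The property is stable under complements and countable unions and holds for rectangles. This
    stands in for an approximation by continuous functions, which [Omega] does not offer. *)
Lemma shift_continuous_measurable E : measurable E -> shift_continuous E.
Proof.
rewrite measurable_prod_measurableType => mE.
apply: (mE shift_continuous); split; first exact: sigma_algebra_shift_continuous.
move=> _ [B mB [F mF <-]].
rewrite (_ : B `*` F = (B `*` setT) `&` (setT `*` F)).
  by apply: shift_continuousI; [exact: shift_continuous_space|exact: shift_continuous_time].
by apply/seteqP; split => p /=; [move=> [? ?]|move=> [[? _] [_ ?]]].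
Qed.

End shift_continuity.

Section field_continuity.
Context (R : realType) (n : nat) (dO : measure_display)
  (Omega : measurableType dO) (P : probability Omega R).
Local Notation Rd := 'rV[R]_n.
Local Notation leb := (lebesgue_rV R n).
Variable A : Rd -> Omega -> R.
Hypotheses (mA : jointly_measurable A) (sA : stationary P A).
Local Open Scope ereal_scope.

Let jump (V : set R) x y := symdiff (A x @^-1` V) (A y @^-1` V).

Let mjump V x y : measurable V -> measurable (jump V x y).
Proof.
by move=> mV; apply: measurable_symdiff; rewrite -[X in measurable X]setTI;
  exact: measurable_field.
Qed.

Lemma prob_jump_shift V x y z : measurable V ->
  P (jump V (x + z)%R (y + z)%R) = P (jump V x y).
Proof.
move=> mV; pose W : set (R * R) := symdiff (fst @^-1` V) (snd @^-1` V).
have mW : measurable W.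
  by apply: measurable_symdiff; rewrite -[X in measurable X]setTI;
    [exact: measurable_fst|exact: measurable_snd].
have J a b : P (jump V a b) = \int[P]_w (\1_W (A a w, A b w))%:E.
  transitivity (\int[P]_w (\1_(jump V a b) w)%:E).
    by rewrite integral_indic ?setIT//; exact: mjump.
  by apply: eq_integral => w _; rewrite !indicE.
by rewrite !J; exact: (stationary_integral2 mA sA x y z (measurable_indic mW)).
Qed.

(** By stationarity the probability of a jump between [x] and [x + h] is the same at every [x].
    Integrating it over [cube 1] gives the shift defect of the set where [A] lies in [V]. *)
Lemma prob_jump_small V : measurable V -> forall e : R, (0 < e)%R ->
  exists2 r : R, (0 < r)%R & forall h, cube r h -> P (jump V h 0%R) <= e%:E.
Proof.
move=> mV e e0; pose E := [set p : Rd * Omega | V (A p.1 p.2)].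
have mE : measurable E by rewrite -[X in measurable X]setTI; exact: mA.
have [r r0 rE] := (shift_continuous_measurable P mE).2 _ e0.
exists r => // h /rE; apply: le_trans.
rewrite /shift_defect /product_measure1.
rewrite (eq_integral (fun x => P (jump V h 0%R) * (\1_(cube 1) x)%:E)); last first.
  move=> x _; rewrite /= indicE; have [Cx|Cx] := boolP (x \in cube 1).
    rewrite mule1 -(prob_jump_shift h 0%R x mV); congr (P _).
    rewrite add0r addrC; apply/seteqP; split => w; rewrite /xsection/= inE.
      by move=> [].
    by move=> Jw; split => //; rewrite inE in Cx.
  rewrite mule0 -[RHS](measure0 P); congr (P _).
  apply/seteqP; split => // w; rewrite /xsection/= inE => -[[Cx' _] _].
  by rewrite notin_setE in Cx.
rewrite ge0_integralZl//; last first.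
  by apply/measurable_EFinP; apply: measurable_indic; exact: measurable_cube.
rewrite integral_indic//; last exact: measurable_cube.
rewrite setIT [X in _ * X](_ : _ = ((2 * 1) ^+ n)%:E); last exact: lebesgue_cube.
(* The volume 2^n of [cube 1] is at least 1, so the integral dominates the probability. *)
by rewrite lee_pemulr// lee_fin mulr1 exprn_ege1// ler1n.
Qed.

Hypothesis A2 : 'E_P[(fun w => `|A 0%R w| ^+ 2)%R] < +oo.

Let g (a : R) : R := (a * `|a|)%R.

Let mg : measurable_fun setT g.
Proof. by apply: measurable_funM => //; exact: normr_measurable. Qed.

Let S x : set (Omega * R) := [set p | (p.2 < g (A x p.1))%R].

Let measurable_subgraph (f : Omega -> R) : measurable_fun setT f ->
  measurable [set p : Omega * R | (p.2 < f p.1)%R].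
Proof.
move=> mf; rewrite [X in measurable X](_ : _ =
    (fun p : Omega * R => f p.1 - p.2)%R @^-1` `]0%R, +oo[%classic).
  have : measurable_fun setT (fun p : Omega * R => f p.1 - p.2)%R.
    by apply: measurable_funB => //; exact: measurableT_comp.
  by move=> mfp; rewrite -[X in measurable X]setTI; exact: mfp.
by apply/seteqP; split => p /=; rewrite in_itv/= andbT subr_gt0.
Qed.

Let integral_dist_subgraph (f f' : Omega -> R) :
  measurable_fun setT f -> measurable_fun setT f' ->
  \int[P]_w `|f w - f' w|%:E =
  \int[lebesgue_measure]_t P (symdiff [set w | (t < f w)%R] [set w | (t < f' w)%R]).
Proof.
move=> mf mf'.
pose D := symdiff [set p : Omega * R | (p.2 < f p.1)%R] [set p | (p.2 < f' p.1)%R].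
have mD : measurable D by apply: measurable_symdiff; exact: measurable_subgraph.
transitivity (\int[P]_w \int[lebesgue_measure]_t (\1_D (w, t))%:E).
  by apply: eq_integral => w _; rewrite -integral_symdiff_ray; apply: eq_integral => t _; rewrite !indicE.
rewrite (@fubini_tonelli _ _ _ _ _ P lebesgue_measure (EFin \o \1_D))//; last first.
- by move=> p; rewrite lee_fin.
- by apply/measurable_EFinP; exact: measurable_indic.
apply: eq_integral => t _ /=.
have mDt : measurable (symdiff [set w | (t < f w)%R] [set w | (t < f' w)%R]).
  have := measurable_ysection t mD; congr measurable.
  by apply/seteqP; split => w; rewrite /ysection/= inE.
transitivity (\int[P]_w (\1_(symdiff [set w | (t < f w)%R] [set w | (t < f' w)%R]) w)%:E).
  by apply: eq_integral => w _; rewrite !indicE.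
by rewrite integral_indic// setIT.
Qed.

(** Through [g] and the layer cake, the squared L^2 distance is at most twice the integral over the
    levels [t] of the probability that [t] is crossed. Each such probability tends to 0, and
    dominated convergence concludes. The argument is by contradiction because it runs along a
    sequence [h k] tending to 0. *)
Lemma field_L2_continuous (e : R) : (0 < e)%R -> exists2 r : R, (0 < r)%R &
  forall h, cube r h -> \int[P]_w ((A h w - A 0%R w) ^+ 2)%:E <= e%:E.
Proof.
move=> e0; apply: contrapT => /forall2NP nr.
have mgA x : measurable_fun setT (fun w => g (A x w)).
  by apply: measurableT_comp => //; exact: measurable_field.
have ex k : exists h, cube (k.+1%:R^-1)%R h /\
    e%:E < \int[P]_w ((A h w - A 0%R w) ^+ 2)%:E.
  have [|/existsNP[h /not_implyP[hk /negP]]] := nr (k.+1%:R^-1)%R; first by rewrite invr_gt0.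
  by rewrite -ltNge => he; exists h.
have [h hP] := choice ex.
pose V t : set R := [set a | (t < g a)%R].
have mV t : measurable (V t).
  rewrite (_ : V t = setT `&` g @^-1` `]t, +oo[%classic); first exact: mg.
  by apply/seteqP; split => a /=; rewrite in_itv/= andbT// => -[].
pose f k t := P (jump (V t) (h k) 0%R).
(* [q t] is the probability that the level [t] separates [g (A 0)] from 0. Its integral over [t] is
   the second moment of [A 0], which makes [2 * q] an integrable bound. *)
pose q t := P (symdiff [set w | (t < g (A 0%R w))%R] [set w : Omega | (t < 0)%R]).
have mdist (u v : Omega -> R) : measurable_fun setT u -> measurable_fun setT v ->
    measurable_fun setT (fun t : R =>
      P (symdiff [set w | (t < u w)%R] [set w | (t < v w)%R])).
  move=> mu mv.
  have mD : measurable (symdiff [set p : Omega * R | (p.2 < u p.1)%R] [set p | (p.2 < v p.1)%R]).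
    by apply: measurable_symdiff; exact: measurable_subgraph.
  have := measurable_fun_ysection P mD; congr measurable_fun.
  apply/funext => t /=; congr (P _).
  by apply/seteqP; split => w; rewrite /ysection/= inE.
have mf k : measurable_fun setT (f k) by exact: mdist.
have mq : measurable_fun setT q by exact: mdist.
(* A level separating [g (A (h k))] from [g (A 0)] separates one of them from 0, and the two have
   the same law. *)
have fq k t : f k t <= 2%:E * q t.
  have P1 : P (symdiff (A (h k) @^-1` V t) [set w : Omega | (t < 0)%R]) = q t.
    have mT : measurable [set w : Omega | (t < 0)%R].
      by case: (t < 0)%R; [rewrite (_ : [set _ | _] = setT)//|rewrite (_ : [set _ | _] = set0)//]; apply/seteqP; split.
    have mW : measurable (symdiff (V t) [set a : R | (t < 0)%R]).
      apply: measurable_symdiff => //.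
      by case: (t < 0)%R; [rewrite (_ : [set _ | _] = setT)//|rewrite (_ : [set _ | _] = set0)//]; apply/seteqP; split.
    have J x : P (symdiff (A x @^-1` V t) [set w : Omega | (t < 0)%R]) =
        \int[P]_w (\1_(symdiff (V t) [set a : R | (t < 0)%R]) (A x w))%:E.
      transitivity (\int[P]_w
          (\1_(symdiff (A x @^-1` V t) [set w : Omega | (t < 0)%R]) w)%:E).
        rewrite integral_indic ?setIT//; apply: measurable_symdiff => //.
        by rewrite -[X in measurable X]setTI; exact: measurable_field.
      by apply: eq_integral => w _; rewrite !indicE.
    rewrite J (stationary_integral1 mA sA (h k) (measurable_indic mW)).
    by rewrite -J.
  have mS x : measurable (symdiff (A x @^-1` V t) [set w : Omega | (t < 0)%R]).
    apply: measurable_symdiff.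
      by rewrite -[X in measurable X]setTI; exact: measurable_field.
    by case: (t < 0)%R; [rewrite (_ : [set _ | _] = setT)//|rewrite (_ : [set _ | _] = set0)//]; apply/seteqP; split.
  apply: (@le_trans _ _ (q t + q t)); last by rewrite mule_natl mule2n.
  rewrite -{1}P1; apply: le_trans (measureU2 P (mS _) (mS _)).
  apply: le_measure; rewrite ?inE; [exact: mjump|exact: measurableU|].
  move=> w [[Ah A0]|[A0 Ah]]; have [t0|t0] := pselect (t < 0)%R.
  - by right; right.
  - by left; left.
  - by left; right.
  - by right; left.
have qint : \int[lebesgue_measure]_t q t = \int[P]_w ((A 0%R w) ^+ 2)%:E.
  rewrite -(integral_dist_subgraph (mgA 0%R) (measurable_cst (0%R : R))).
  apply: eq_integral => w _; rewrite subr0 /g normrM normr_id -expr2.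
  by rewrite real_normK// num_real.
have q0 t : 0 <= q t by exact: measure_ge0.
have int2q : lebesgue_measure.-integrable setT (fun t => 2%:E * q t).
  apply: integrableZl => //; apply/integrableP; split => //.
  under eq_integral do rewrite gee0_abs//.
  by rewrite qint; apply: Lfun2_sqr_lty; exact: (Lfun2_field mA sA A2).
have [||_ _ cvf] := @dominated_convergence _ _ _ lebesgue_measure setT measurableT
  f (cst 0) (fun t => 2%:E * q t) mf (measurable_cst _) _ int2q _.
- apply: aeW => t _; apply: cvge0_small => [k|d d0]; first exact: measure_ge0.
  have [r r0 rV] := prob_jump_small (mV t) d0.
  have [N /= rN] : exists N : nat, (N.+1%:R^-1 < r)%R.
    by have [N] := ltr_add_invr r0; rewrite add0r => rN; exists N.
  exists N => k Nk; apply: rV; apply: subset_cube (hP k).1.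
  by rewrite (le_trans _ (ltW rN))// lef_pV2 ?posrE// ler_nat.
- by apply: aeW => t k _; rewrite gee0_abs ?measure_ge0.
rewrite integral0 in cvf.
have e20 : (0 < e / 2)%R by rewrite divr_gt0.
have [N] := cvge0_ex_le cvf e20; rewrite /= => fN.
have := (hP N).2; apply/negP; rewrite -leNgt.
apply: (@le_trans _ _ (2%:E * \int[lebesgue_measure]_t f N t)); last first.
  by rewrite (le_trans (lee_wpmul2l _ fN))// -EFinM lee_fin mulrC divfK.
rewrite /f -(integral_dist_subgraph (mgA (h N)) (mgA 0%R)).
rewrite -ge0_integralZl//; last first.
  apply/measurable_EFinP; apply: measurableT_comp => //.
  by apply: measurable_funB; exact: mgA.
apply: ge0_le_integral => //.
- by move=> w _; rewrite lee_fin sqr_ge0.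
- apply/measurable_EFinP; apply: measurable_funX; apply: measurable_funB; exact: measurable_field.
- apply: emeasurable_funM => //; apply/measurable_EFinP; apply: measurableT_comp => //.
  by apply: measurable_funB; exact: mgA.
- by move=> w _; rewrite -EFinM lee_fin sqr_sub_le_signed_sqr.
Qed.

End field_continuity.

(** * Conditional essential supremum and oscillation *)

Section conditional_essential_supremum.
Context d (T : measurableType d) (R : realType) (P : probability T R).
Variables (C : set (set T)).
Hypothesis CT : C `<=` measurable.
Local Notation G := (<<s C >>).
Local Notation TG := (g_sigma_algebraType C).
Local Open Scope ereal_scope.

(** Among the [G]-measurable majorants with values in [[- K, K]], the infimum along a sequence that
    minimizes the expectation is again a majorant and attains the minimal expectation. *)
Lemma cond_ess_sup_exists (X : T -> R) (K : R) :
  {ae P, forall w, (`|X w| <= K)%R} -> exists Z, is_cond_ess_sup P G X Z.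
Proof.
move=> XK0; wlog K0 : K XK0 / (0 <= K)%R.
  move=> H; apply: (H `|K|%R) => //; apply: filterS XK0 => w /le_trans; apply.
  exact: ler_norm.
have XK : {ae P, forall w, (- K <= X w <= K)%R}.
  by apply: filterS XK0 => w; rewrite ler_norml.
pose adm (Z : T -> R) := [/\ sub_measurable_fun G Z,
  forall w, (- K <= Z w <= K)%R & {ae P, forall w, (X w <= Z w)%R}].
have admK : adm (fun=> K).
  split; first exact/sub_measurable_funP.
  - by move=> _; rewrite lexx andbT; lra.
  - by apply: filterS XK => w /andP[].
have admm Z : adm Z -> measurable_fun setT Z.
  by move=> [GZ _ _]; exact: (sub_measurable_fun_measurable CT GZ).
have admi Z : adm Z -> P.-integrable setT (EFin \o Z).
  move=> aZ; apply: (@bounded_integrable _ _ _ P Z K (admm _ aZ)) => w.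
  by rewrite ler_norml; have [_ + _] := aZ.
pose J := [set \int[P]_w (Z w)%:E | Z in adm].
have J0 : J != set0 by apply/set0P; exists (\int[P]_w K%:E); exists (fun=> K).
have [u uI ucvg] := ereal_inf_seq J0.
have /choice[Z ZP] k : exists Z, adm Z /\ \int[P]_w (Z w)%:E = u k.
  by have [Z aZ Zu] := uI k; exists Z.
pose U w := infs (Z^~ w) 0%N.
have lbZ w : has_lbound (range (Z ^~ w)).
  by exists (- K)%R => _ [k _ <-]; have [[_ /(_ w) /andP[]]] := ZP k.
have sdE w : sdrop (Z ^~ w) 0%N = range (Z ^~ w).
  by apply/seteqP; split => _ [k _ <-]; exists k.
have UE w : U w = inf (range (Z ^~ w)) by rewrite -sdE.
have UZ k w : (U w <= Z k w)%R.
  by rewrite UE; apply: ge_inf => //; exists k.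
have aU : adm U.
  split.
  - apply/sub_measurable_funP; apply: measurable_fun_infs => [w _|k]; first exact: lbZ.
    by apply/sub_measurable_funP; have [[]] := ZP k.
  - move=> w; apply/andP; split.
      rewrite UE; apply: lb_le_inf; first by exists (Z 0%N w); exists 0%N.
      by move=> _ [k _ <-]; have [[_ /(_ w) /andP[]]] := ZP k.
    by apply: le_trans (UZ 0%N w) _; have [[_ /(_ w) /andP[]]] := ZP 0%N.
  - have : {ae P, forall w k, (X w <= Z k w)%R}.
      by apply/ae_foralln => k; have [[]] := ZP k.
    apply: filterS => w XZ; rewrite UE.
    apply: lb_le_inf; first by exists (Z 0%N w); exists 0%N.
    by move=> _ [k _ <-].
have Umin Z' : adm Z' -> \int[P]_w (U w)%:E <= \int[P]_w (Z' w)%:E.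
  move=> aZ'; apply: (@le_trans _ _ (ereal_inf J)); last first.
    by apply: ereal_inf_lbound; exists Z'.
  apply: (cvge_ge _ ucvg); apply: nearW => k; have [aZk <-] := ZP k.
  by apply: le_integral => //; [exact: admi|exact: admi|move=> w _; rewrite lee_fin].
exists (EFin \o U); have [GU UK XU] := aU; split.
- by apply/sub_measurable_funP/measurable_EFinP/sub_measurable_funP.
- by apply: filterS XU => w; rewrite /= lee_fin.
move=> Z' GZ' XZ'.
(* An arbitrary majorant [Z'] may be infinite or leave the range. Raised to [- K] and cut off at [U]
   it becomes a competitor [W <= U]; minimality of the expectation of [U] forces [W = U] almost
   surely, that is [U <= Z']. *)
pose W w := fine (mine (U w)%:E (maxe (- K)%:E (Z' w))).
have WE w : (W w)%:E = mine (U w)%:E (maxe (- K)%:E (Z' w)).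
  rewrite /W fineK// fin_real//; apply/andP; split.
    rewrite (@lt_le_trans _ _ (- K)%:E) ?ltNyr// le_min le_max lexx /= andbT lee_fin.
    by have /andP[] := UK w.
  by rewrite (@le_lt_trans _ _ (U w)%:E) ?ltry// ge_min lexx.
have WU w : (W w <= U w)%R by rewrite -lee_fin WE ge_min lexx.
have aW : adm W.
  split.
  - apply/sub_measurable_funP; apply: measurableT_comp => //.
    apply: measurable_mine; first by apply/measurable_EFinP/sub_measurable_funP.
    by apply: measurable_maxe => //; exact/sub_measurable_funP.
  - move=> w; apply/andP; split; last first.
      by apply: le_trans (WU w) _; have /andP[] := UK w.
    rewrite -lee_fin WE le_min le_max lexx /= andbT lee_fin.
    by have /andP[] := UK w.
  - apply: filterS2 XU XZ' => w XU XZ'.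
    by rewrite -lee_fin WE le_min lee_fin XU le_max XZ' orbT.
have UW0 : \int[P]_w `|(U w)%:E - (W w)%:E| = 0.
  rewrite (eq_integral (fun w => (U w)%:E - (W w)%:E)); last first.
    by move=> w _; rewrite -EFinB abse_EFin ger0_norm// subr_ge0.
  apply/eqP; rewrite eq_le; apply/andP; split.
    by rewrite integralB ?sube_le0//; [exact: Umin|exact: admi|exact: admi].
  by apply: integral_ge0 => w _; rewrite -EFinB lee_fin subr_ge0.
have mUW : measurable_fun setT (fun w => (U w)%:E - (W w)%:E).
  by apply: emeasurable_funB; apply/measurable_EFinP; exact: admm.
have := (ae_eq_integral_abs P measurableT mUW).1 UW0.
apply: filterS3 XZ' XK => w XZ' /andP[KX _] /(_ I)/= /eqP.
rewrite eqe subr_eq0 => /eqP UWw.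
have : mine (U w)%:E (maxe (- K)%:E (Z' w)) = (U w)%:E by rewrite -WE -UWw.
rewrite (max_idPr _); last by rewrite (le_trans _ XZ')// lee_fin.
by move=> /min_idPl.
Qed.

End conditional_essential_supremum.

Section oscillation.
Context (R : realType) (n : nat) (dO : measure_display)
  (Omega : measurableType dO) (P : probability Omega R).
Local Notation Rd := 'rV[R]_n.
Variable A : Rd -> Omega -> R.
Hypothesis mA : jointly_measurable A.
Local Open Scope ereal_scope.

Lemma field_generator_measurable (S : set Rd) :
  \bigcup_(x in S) preimage_set_system setT (A x) measurable `<=` measurable.
Proof.
by move=> _ [x _ [B mB <-]]; apply: (measurable_field mA x) => //.
Qed.

Lemma sub_measurable_field (S : set Rd) x : S x ->
  sub_measurable_fun (field_sigma A S) (A x).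
Proof. by move=> Sx E HE; apply: sub_sigma_algebra; exists x. Qed.

Lemma is_osc_exists (X : Omega -> R) (K : R) :
  {ae P, forall w, (`|X w| <= K)%R} -> exists dX, is_osc P A X dX.
Proof.
move=> XK.
have NXK : {ae P, forall w, (`|- X w| <= K)%R} by apply: filterS XK => w; rewrite normrN.
have ex (S : set Rd) : exists UV : (Omega -> \bar R) * (Omega -> \bar R),
    is_cond_ess_sup P (field_sigma A (~` S)) X UV.1 /\
    is_cond_ess_sup P (field_sigma A (~` S)) (fun w => - X w)%R UV.2.
  have [U hU] := cond_ess_sup_exists (@field_generator_measurable (~` S)) XK.
  have [V hV] := cond_ess_sup_exists (@field_generator_measurable (~` S)) NXK.
  by exists (U, V).
have [UV hUV] := choice ex.
exists (fun S w => (UV S).1 w + (UV S).2 w) => S mS.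
by exists (UV S).1, (UV S).2; have [? ?] := hUV S.
Qed.

(** [Z + c] and [- Z + c] are measurable outside [S] and dominate [X] and [- X], so the oscillation
    is at most [2 * c]. With [c = 0] it vanishes for variables that ignore [S]. *)
Lemma sq_mean_osc_le (X Z : Omega -> R) dX (S : set Rd) (c : R) :
  is_osc P A X dX -> measurable S ->
  sub_measurable_fun (field_sigma A (~` S)) Z ->
  {ae P, forall w, (`|X w - Z w| <= c)%R} ->
  sq_mean P dX S <= ((2 * c) ^+ 2)%:E.
Proof.
move=> oX mS GZ XZ; have [U [V [[GU XU Umin] [GV XV Vmin] dXE]]] := oX S mS.
have CT := @field_generator_measurable (~` S).
have mZ : measurable_fun setT (Z : g_sigma_algebraType
    (\bigcup_(x in ~` S) preimage_set_system setT (A x) measurable) -> R).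
  exact/sub_measurable_funP.
have Uc : {ae P, forall w, U w <= (Z w + c)%:E}.
  apply: Umin.
    apply/sub_measurable_funP/measurable_EFinP.
    by apply: measurable_funD.
  by apply: filterS XZ => w; rewrite lee_fin ler_norml; lra.
have Vc : {ae P, forall w, V w <= (- Z w + c)%:E}.
  apply: Vmin.
    apply/sub_measurable_funP/measurable_EFinP.
    by apply: measurable_funD => //; exact: measurable_funN.
  by apply: filterS XZ => w; rewrite lee_fin ler_norml; lra.
have mUV : measurable_fun setT (fun w => (U w + V w) ^+ 2).
  rewrite (_ : (fun w => (U w + V w) ^+ 2) = (fun w => (U w + V w) * (U w + V w))).
    by apply: emeasurable_funM; apply: emeasurable_funD;
      exact: (sub_measurable_fun_measurable CT).
  by apply/funext => w; rewrite expe2.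
rewrite /sq_mean (eq_integral (fun w => (U w + V w) ^+ 2)); last first.
  by move=> w _; rewrite dXE.
have c2 : \int[P]_w ((2 * c) ^+ 2)%:E = ((2 * c) ^+ 2)%:E.
  rewrite (integral_cst P measurableT ((2 * c) ^+ 2)%:E).
  by rewrite [X in _ * X](_ : _ = 1) ?mule1//; exact: probability_setT.
rewrite -c2; apply: ae_ge0_le_integral => //.
- by move=> w _; exact: sqre_ge0.
- by move=> w _; rewrite lee_fin sqr_ge0.
have H : {ae P, forall w, [/\ (X w)%:E <= U w, (- X w)%:E <= V w, U w <= (Z w + c)%:E & V w <= (- Z w + c)%:E]}.
  by apply: filterS2 (filterI XU XV) (filterI Uc Vc) => w [? ?] [? ?]; split.
apply: filterS H => w [] + + + + _.
case: (U w) => [u||]//; case: (V w) => [v||]//.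
rewrite !lee_fin => Xu Xv uc vc.
(* Squaring is monotone here since [X w <= u] and [- X w <= v] give [0 <= u + v]. *)
by rewrite expr2; apply: ler_pM; lra.
Qed.

End oscillation.

(** * Averages as test variables *)

Section spatial_average.
Context d1 d2 (T1 : measurableType d1) (T2 : measurableType d2) (R : realType).
Variables (m1 : {sigma_finite_measure set T1 -> \bar R}) (P : probability T2 R).
Local Open Scope ereal_scope.

(** Cauchy-Schwarz against the constant 1. A positive upper bound [v] of the measure of [D] replaces
    the measure itself, so that division by [v] makes sense on null sets too. *)
Lemma sqr_integral_le (D : set T1) (f : T1 -> R) (v : R) : measurable D ->
  (0 < v)%R -> m1 D <= v%:E -> m1.-integrable D (EFin \o f) ->
  ((fine (\int[m1]_(x in D) (f x)%:E)) ^+ 2)%:E <=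
    v%:E * \int[m1]_(x in D) (f x ^+ 2)%:E.
Proof.
move=> mD v0 Dv intf; set a := fine _.
have mf : measurable_fun D f by exact/measurable_EFinP/(measurable_int _ intf).
have mf2 : measurable_fun D (fun x => (f x ^+ 2)%:E).
  by apply/measurable_EFinP; exact: measurable_funX.
have [q0|] := leP +oo (\int[m1]_(x in D) (f x ^+ 2)%:E).
  by move: q0; rewrite leye_eq => /eqP ->; rewrite gt0_muley ?leey// lte_fin.
move=> qoo.
have int2 : m1.-integrable D (fun x => (f x ^+ 2)%:E).
  apply/integrableP; split => //; apply: le_lt_trans qoo.
  rewrite le_eqVlt; apply/orP; left; apply/eqP.
  by apply: eq_integral => x _; rewrite /= ger0_norm ?sqr_ge0.
have Dfin : m1 D \is a fin_num by rewrite ge0_fin_numE// (le_lt_trans Dv)// ltry.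
have intc (c : R) : m1.-integrable D (EFin \o (fun=> c)).
  apply/integrableP; split; first exact: measurable_cst.
  rewrite (integral_cst m1 mD `|c|%:E) lte_mul_pinfty//.
  by rewrite (le_lt_trans Dv)// ltry.
(* The optimal parameter in [2 l f <= f^2 + l^2]. *)
pose l := (a / v)%R.
set t := fine (m1 D); have Dt : m1 D = t%:E by rewrite /t fineK.
have tv : (t <= v)%R by rewrite -lee_fin -Dt.
have cE : \int[m1]_(x in D) (l ^+ 2)%:E = (l ^+ 2 * t)%:E.
  by rewrite (integral_cst m1 mD (l ^+ 2)%:E) [X in _ * X](_ : _ = t%:E).
have : \int[m1]_(x in D) ((2 * l)%:E * (f x)%:E) <=
    \int[m1]_(x in D) ((f x ^+ 2)%:E + (l ^+ 2)%:E).
  apply: le_integral => //.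
  - exact: integrableZl.
  - by apply: integrableD => //; exact: intc.
  - move=> x _; rewrite -EFinM -EFinD lee_fin -subr_ge0.
    rewrite (_ : _ - _ = (f x - l) ^+ 2)%R ?sqr_ge0//; ring.
rewrite integralZl// integralD//; last exact: intc.
rewrite cE.
have -> : \int[m1]_(x in D) (f x)%:E = a%:E.
  by rewrite /a fineK//; exact: (integrable_fin_num mD intf).
have := integrable_fin_num mD int2.
case: (\int[m1]_(x in D) _) => // q _.
rewrite -EFinD -!EFinM !lee_fin /l => H.
have {}H : (2 * (a / v) * a <= q + (a / v) ^+ 2 * v)%R.
  by rewrite (le_trans H)// lerD2l ler_wpM2l// sqr_ge0.
rewrite -(ler_pM2l (_ : 0 < v^-1)%R) ?invr_gt0// mulrA mulVf ?gt_eqF// mul1r.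
have E1 : (2 * (a / v) * a = 2 * (v^-1 * a ^+ 2))%R by ring.
have E2 : ((a / v) ^+ 2 * v = v^-1 * a ^+ 2)%R by field; rewrite gt_eqF.
by rewrite E1 E2 in H; lra.
Qed.

Variables (D : set T1) (X : T1 -> T2 -> R) (c : R).
Hypotheses (mD : measurable D) (Doo : m1 D < +oo).
Hypothesis mX : measurable_fun [set: T1 * T2] (fun p => X p.1 p.2).
Hypothesis Xc : forall x, D x -> \int[P]_w `|X x w|%:E <= c%:E.

Lemma Lfun2_pint (c2 : R) :
  (forall x, D x -> \int[P]_w (X x w ^+ 2)%:E <= c2%:E) ->
  pint m1 D X \in Lfun P 2%:E.
Proof.
move=> X2; apply: Lfun2_sqr; first exact: measurable_pint.
pose v : R := (fine (m1 D) + 1)%R.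
have v0 : (0 < v)%R by rewrite ltr_wpDl// fine_ge0.
have Dv : m1 D <= v%:E.
  by rewrite -[m1 D]fineK ?ge0_fin_numE// lee_fin lerDl.
have mX2 : measurable_fun setT (fun p : T1 * T2 => (X p.1 p.2 ^+ 2)%:E).
  by apply/measurable_EFinP; exact: measurable_funX.
have mX2D : measurable_fun setT (fun w => \int[m1]_(x in D) (X x w ^+ 2)%:E).
  exact: (measurable_integral1_in m1 mD mX2).
apply: (@le_lt_trans _ _ (\int[P]_w (v%:E * \int[m1]_(x in D) (X x w ^+ 2)%:E))).
  apply: ae_ge0_le_integral => //.
  - by move=> w _; rewrite lee_fin sqr_ge0.
  - by apply/measurable_EFinP; apply: measurable_funX; exact: measurable_pint.
  - move=> w _; apply: mule_ge0; first by rewrite lee_fin ltW.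
    by apply: integral_ge0 => x _; rewrite lee_fin sqr_ge0.
  - exact: measurable_funeM.
  - by apply: filterS (ae_integrable_param mD Doo mX Xc) => w intw _; exact: sqr_integral_le.
rewrite ge0_integralZl//; last 2 first.
- by move=> w _; apply: integral_ge0 => x _; rewrite lee_fin sqr_ge0.
- by rewrite lee_fin ltW.
rewrite lte_mul_pinfty ?lee_fin ?ltW//.
under eq_integral do rewrite integral_mkcond.
have mX2' : measurable_fun setT
    ((fun p : T1 * T2 => (X p.1 p.2 ^+ 2)%:E) \_ (D `*` setT)).
  by apply/(measurable_restrictT _ _).1; [exact: measurableX|exact: measurable_funTS].
rewrite (eq_integral (fun w => \int[m1]_x
    ((fun p : T1 * T2 => (X p.1 p.2 ^+ 2)%:E) \_ (D `*` setT)) (x, w))); last first.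
  move=> w _; apply: eq_integral => x _; rewrite !patchE.
  by congr (if _ then _ else _); apply/idP/idP; rewrite !inE//= => -[].
rewrite -(@fubini_tonelli _ _ _ _ _ m1 P _ mX2'); last first.
  by move=> p; rewrite patchE; case: ifPn => // _; rewrite lee_fin sqr_ge0.
apply: (@le_lt_trans _ _ (\int[m1]_(x in D) `|c2|%:E)); last first.
  by rewrite (integral_cst m1 mD `|c2|%:E) lte_mul_pinfty.
rewrite [leRHS]integral_mkcond; apply: ge0_le_integral => //.
- by move=> x _; apply: integral_ge0 => w _; rewrite patchE; case: ifPn => // _; rewrite lee_fin sqr_ge0.
- exact: (measurable_integral2 P mX2').
- by apply/(measurable_restrictT _ _).1 => //; exact: measurable_cst.
move=> x _; rewrite patchE; case: ifPn => xD.
  rewrite (eq_integral (fun w => (X x w ^+ 2)%:E)); last first.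
    by move=> w _; rewrite patchE ifT// inE; split => //; rewrite inE in xD.
  rewrite inE in xD.
  by rewrite (le_trans (X2 x xD))// lee_fin ler_norm.
rewrite integral0_eq// => w _; rewrite patchE ifF//.
by apply/negP; rewrite inE => -[/= Dx _]; rewrite notin_setE in xD.
Qed.

End spatial_average.

Lemma integral_probability_cst d (T : measurableType d) (R : realType)
  (P : probability T R) (c : \bar R) : (\int[P]_w c = c)%E.
Proof.
rewrite (integral_cst P measurableT c) [X in (_ * X)%E](_ : _ = 1%E) ?mule1//.
exact: probability_setT.
Qed.

(** * Essentially bounded functions *)

Section essentially_bounded.
Context (R : realType) (n : nat).
Local Notation Rd := 'rV[R]_n.
Local Notation leb := (lebesgue_rV R n).
Local Open Scope ereal_scope.

(** The norm of index [+oo] is an essential supremum only for a nonzero measure. *)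
Lemma lebesgue_rV_setT_gt0 : 0 < leb setT.
Proof.
apply: (@lt_le_trans _ _ (leb (cube 1))).
  by rewrite lebesgue_cube// lte_fin exprn_gt0// mulr_gt0.
by apply: le_measure; rewrite ?inE//; exact: measurable_cube.
Qed.

Lemma Linfty_bounded (u : Rd -> R) : u \in Lfun leb +oo ->
  measurable_fun setT u /\ exists M : R, {ae leb, forall x, (`|u x| <= M)%R}.
Proof.
rewrite inE => /andP[]; rewrite !inE => mu /=.
rewrite /finite_norm unlock /Lnorm lebesgue_rV_setT_gt0 => ub; split => //.
by have [M uM] := @ess_supr_bounded _ _ _ leb (fun x => `|u x|)%R ub; exists M.
Qed.

Lemma Linfty_integrable (u : Rd -> R) (T : set Rd) : u \in Lfun leb +oo ->
  measurable T -> leb T < +oo -> leb.-integrable T (EFin \o u).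
Proof.
move=> /Linfty_bounded[mu [M uM]] mT Too.
have muT : measurable_fun T (EFin \o u).
  by apply: measurable_funTS; exact/measurable_EFinP.
apply/integrableP; split => //.
apply: (@le_lt_trans _ _ (`|M|%:E * leb T)); last by rewrite lte_mul_pinfty.
apply: integral_le_bound => //.
by apply: filterS uM => x uM _; rewrite lee_fin (le_trans uM)// ler_norm.
Qed.

End essentially_bounded.

Section averages.
Context (R : realType) (n : nat) (dO : measure_display)
  (Omega : measurableType dO) (P : probability Omega R).
Local Notation Rd := 'rV[R]_n.
Local Notation leb := (lebesgue_rV R n).
Variable A : Rd -> Omega -> R.
Hypotheses (mA : jointly_measurable A) (sA : stationary P A).
Local Open Scope ereal_scope.
Hypothesis A2 : 'E_P[(fun w => `|A 0%R w| ^+ 2)%R] < +oo.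

Lemma field_L1_bound : exists c : R, forall x, \int[P]_w `|A x w|%:E <= c%:E.
Proof.
have int0 := Lfun2_integrable (Lfun2_field mA sA A2 0%R).
exists (fine (\int[P]_w `|A 0%R w|%:E)) => x; rewrite fineK.
  by rewrite (stationary_integral1 mA sA x (@normr_measurable R setT)).
by rewrite ge0_fin_numE; [have /integrableP[] := int0|exact: integral_ge0].
Qed.

Lemma field_L2_bound : exists c : R, forall x, \int[P]_w ((A x w) ^+ 2)%:E <= c%:E.
Proof.
have A02 := Lfun2_sqr_lty (Lfun2_field mA sA A2 0%R).
exists (fine (\int[P]_w (A 0%R w ^+ 2)%:E)) => x; rewrite fineK.
  by rewrite (stationary_integral1 mA sA x (measurable_funX 2 (@measurable_id _ _ _))).
by rewrite ge0_fin_numE//; apply: integral_ge0 => w _; rewrite lee_fin sqr_ge0.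
Qed.

Variable T : set Rd.
Hypotheses (mT : measurable T) (Too : leb T < +oo).

Local Notation avg := (pint leb T A).

Lemma Lfun2_avg : avg \in Lfun P 2%:E.
Proof.
have [c1 Ac1] := field_L1_bound; have [c2 Ac2] := field_L2_bound.
by apply: (Lfun2_pint mT Too mA (c := c1) _ (c2 := c2)) => x _.
Qed.

Lemma avg_modification (S : set Rd) : T `<=` S ->
  exists Y, sub_measurable_fun (field_sigma A S) Y /\
    {ae P, forall w, Y w = avg w}.
Proof.
move=> TS; have [c1 Ac1] := field_L1_bound.
apply: (sub_measurable_pint mT Too mA (fun x _ => Ac1 x)) => //.
  exact: field_generator_measurable.
by move=> x Tx; apply: sub_measurable_field; exact: TS.
Qed.

(** The bound on [A x] holds off a null event depending on [x]. By Tonelli, for almost every [w] it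
    then holds at almost every [x], which is enough under the integral. *)
Lemma avg_bound (K : R) : bounded_field P A K -> (0 <= K)%R ->
  {ae P, forall w, (`|avg w| <= K * fine (leb T))%R}.
Proof.
move=> AK K0; have [c1 Ac1] := field_L1_bound.
pose N := [set p : Rd * Omega | (K < `|A p.1 p.2|)%R].
have mN : measurable N.
  rewrite (_ : N = (fun p => `|A p.1 p.2|)%R @^-1` `]K, +oo[%classic).
    rewrite -[X in measurable X]setTI.
    have : measurable_fun setT (fun p : Rd * Omega => `|A p.1 p.2|)%R.
      by apply: measurableT_comp.
    by apply.
  by apply/seteqP; split => p /=; rewrite in_itv/= andbT.
have : \int[P]_w `|leb (ysection N w)| = 0.
  rewrite (eq_integral (fun w => \int[leb]_x (\1_N (x, w))%:E)); last first.
    move=> w _; rewrite gee0_abs//; apply/esym.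
    exact: (congr1 (fun f => f w) (indic_fubini_tonelli_GE leb mN)).
  rewrite -(@fubini_tonelli _ _ _ _ _ leb P (EFin \o \1_N))/=; last first.
  - by move=> p; rewrite lee_fin.
  - by apply/measurable_EFinP; exact: measurable_indic.
  apply: integral0_eq => x _; have [B [mB B0 BN]] := AK x.
  have mNx : measurable (xsection N x) by exact: measurable_xsection.
  rewrite (eq_integral (fun w => (\1_(xsection N x) w)%:E)); last first.
    by move=> w _; rewrite !indicE mem_xsection.
  rewrite integral_indic// setIT; apply/eqP; rewrite eq_le measure_ge0 andbT -B0.
  apply: le_measure; rewrite ?inE// => w; rewrite /xsection/= inE /N/= => KA.
  by apply: BN => /=; apply/negP; rewrite -ltNge.
have mNy : measurable_fun setT (fun w => leb (ysection N w)).
  exact: (measurable_fun_ysection leb mN).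
move/(ae_eq_integral_abs P measurableT mNy).
apply: filterS2 (ae_integrable_param mT Too mA (fun x _ => Ac1 x)) => w intw /(_ I) Nw.
have mAw : measurable_fun T (fun x => (A x w)%:E) := measurable_int _ intw.
rewrite -lee_fin EFinM fineK ?ge0_fin_numE//.
have H : \int[leb]_(x in T) `|(A x w)%:E| <= K%:E * leb T.
  apply: integral_le_bound => //.
  exists (ysection N w); split => //; first exact: measurable_ysection.
  move=> x /= /not_implyP[Tx /negP]; rewrite lee_fin -ltNge => KA.
  by rewrite /ysection/= inE.
apply: le_trans H; apply: le_trans (le_abse_integral leb mT mAw).
rewrite /pint; have := integrable_fin_num mT intw.
by case: (\int[leb]_(x in T) (A x w)%:E).
Qed.

End averages.

(** * Averages as admissible variables *)

Section admissible_averages.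
Context (R : realType) (n : nat) (dO : measure_display)
  (Omega : measurableType dO) (P : probability Omega R).
Local Notation Rd := 'rV[R]_n.
Local Notation leb := (lebesgue_rV R n).
Variables (A : Rd -> Omega -> R) (k : derivative_kind) (M : set (Rd -> R)) (K : R).
Hypotheses (mA : jointly_measurable A) (sA : stationary P A).
Local Open Scope ereal_scope.
Hypothesis A2 : 'E_P[(fun w => `|A 0%R w| ^+ 2)%R] < +oo.

(** One constant for both derivatives: per unit of volume an average has oscillation at most [2 |K|]
    and functional derivative at most 1. *)
Definition osc_const (K : R) : R := (2 * `|K| + 1)%R.

Section fixed_domain.
Variables (T : set Rd) (s : R).
Hypotheses (mT : measurable T) (Too : leb T < +oo) (s1 : (`|s| <= 1)%R).
Local Notation avg := (pint leb T A).

Let scale_modification : exists X,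
  [/\ sub_measurable_fun (field_sigma A setT) X, measurable_fun setT X,
      {ae P, forall w, X w = (s * avg w)%R} & X \in Lfun P 2%:E].
Proof.
have [Y [GY YE]] := avg_modification mA sA A2 mT Too (@subsetT _ T).
have CT := field_generator_measurable mA (S := setT).
have GX : sub_measurable_fun (field_sigma A setT) (fun w => s * Y w)%R.
  apply/sub_measurable_funP; apply: measurable_funM => //.
  exact/sub_measurable_funP.
have XE : {ae P, forall w, (s * Y w)%R = (s * avg w)%R} by apply: filterS YE => w ->.
exists (fun w => s * Y w)%R; split => //.
  exact: (sub_measurable_fun_measurable CT GX).
apply: (@Lfun2_ae_eq _ _ _ _ (fun w => s * avg w)%R).
- exact: (sub_measurable_fun_measurable CT GX).
- rewrite (_ : (fun w => s * avg w)%R = (s \o* avg)%R).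
    exact: (Lfun_scale s (ler1n R 2) (Lfun2_avg mA sA A2 mT Too)).
  by apply/funext => w /=; rewrite mulrC.
- by apply: filterS XE => w ->.
Qed.

Lemma avg_setD (S : set Rd) : measurable S ->
  {ae P, forall w, (pint leb T A w - pint leb (T `\` S) A w = pint leb (S `&` T) A w)%R}.
Proof.
move=> mS; have [c1 Ac1] := field_L1_bound mA sA A2.
apply: filterS (ae_integrable_param mT Too mA (fun x _ => Ac1 x)) => w intw.
have mTS : measurable (T `\` S) by exact: measurableD.
have mST : measurable (S `&` T) by exact: measurableI.
have int1 : leb.-integrable (T `\` S) (fun x => (A x w)%:E).
  by apply: integrableS intw => //; exact: subDsetl.
have int2 : leb.-integrable (S `&` T) (fun x => (A x w)%:E).
  by apply: integrableS intw => //; exact: subIsetr.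
have TE : T = (T `\` S) `|` (S `&` T).
  apply/seteqP; split => x /=; first by move=> Tx; have [Sx|Sx] := pselect (S x); [right|left].
  by move=> [[]|[]].
rewrite /pint {1}TE integral_setU//.
- by rewrite fineD ?integrable_fin_num// addrAC subrr add0r.
- by rewrite -TE; exact: measurable_int intw.
- by apply/disj_setPS => x [[_ nSx] [Sx _]].
Qed.

(** The average over [T] minus [S] has a modification measurable outside [S], and it differs from
    the average over [T] by the integral over the common part of [S] and [T], of size at most [|K|]
    times its volume. *)
Lemma osc_average : bounded_field P A K -> exists X dX,
  [/\ admissible P osc M A X dX, {ae P, forall w, X w = (s * avg w)%R} &
      forall S, measurable S ->
        sq_mean P dX S <= ((osc_const K * fine (leb (S `&` T))) ^+ 2)%:E].
Proof.
move=> AK0; have AK : bounded_field P A `|K|%R.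
  by move=> x; apply: filterS (AK0 x) => w /le_trans; apply; exact: ler_norm.
have K0 : (0 <= `|K|)%R by [].
have [X [GX mX XE X2]] := scale_modification.
have XK : {ae P, forall w, (`|X w| <= `|K| * fine (leb T))%R}.
  apply: filterS2 XE (avg_bound mA sA A2 mT Too AK K0) => w -> avgK.
  by rewrite normrM (le_trans _ avgK)// ler_piMl.
have [dX oX] := is_osc_exists mA XK.
exists X, dX; split => // S mS.
have mTS : measurable (T `\` S) by exact: measurableD.
have mST : measurable (S `&` T) by exact: measurableI.
have TSoo : leb (T `\` S) < +oo.
  by apply: le_lt_trans Too; apply: le_measure; rewrite ?inE//; exact: subDsetl.
have SToo : leb (S `&` T) < +oo.
  by apply: le_lt_trans Too; apply: le_measure; rewrite ?inE//; exact: subIsetr.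
have [|Y [GY YE]] := avg_modification mA sA A2 mTS TSoo (S := ~` S).
  by move=> x [].
have GZ : sub_measurable_fun (field_sigma A (~` S)) (fun w => s * Y w)%R.
  apply/sub_measurable_funP; apply: measurable_funM => //.
  exact/sub_measurable_funP.
apply: (@le_trans _ _ ((2 * (`|K| * fine (leb (S `&` T)))) ^+ 2)%:E).
  apply: (sq_mean_osc_le mA oX mS GZ).
  apply: filterS3 (filterI XE YE) (avg_setD mS)
    (avg_bound mA sA A2 mST SToo AK K0) => w [-> ->] dE avgK.
  by rewrite -mulrBr dE normrM (le_trans _ avgK)// ler_piMl.
have v0 : (0 <= fine (leb (S `&` T)))%R by rewrite fine_ge0.
rewrite lee_fin; apply: lerXn2r; rewrite ?nnegrE ?mulr_ge0 ?addr_ge0 ?mulr_ge0//.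
by rewrite mulrA ler_wpM2r// lerDl.
Qed.

Let SToo S : measurable S -> leb (S `&` T) < +oo.
Proof.
move=> mS; have mST : measurable (S `&` T) by exact: measurableI.
by apply: le_lt_trans Too; apply: le_measure; rewrite ?inE//; exact: subIsetr.
Qed.

(** The functional [u |-> s \int_T u] is linear: its difference quotient does not depend on [t], and
    its derivative is the deterministic function [s \1_T]. *)
Lemma fct_average : (forall w, M (A ^~ w)) -> open_Linfty M -> exists X dX,
  [/\ admissible P fct M A X dX, {ae P, forall w, X w = (s * avg w)%R} &
      forall S, measurable S -> (exists r, S `<=` eball 0 r) ->
        sq_mean P dX S <= ((osc_const K * fine (leb (S `&` T))) ^+ 2)%:E].
Proof.
move=> MA [MLoo _].
have [X [GX mX XE X2]] := scale_modification.
pose Xt (u : Rd -> R) : R := (s * fine (\int[leb]_(x in T) (u x)%:E))%R.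
pose g (x : Rd) (w : Omega) : R := (s * \1_T x)%R.
pose dX (S : set Rd) (w : Omega) : \bar R := \int[leb]_(x in S) `|g x w|%:E.
have dXE S w : measurable S -> dX S w = `|s|%:E * leb (S `&` T).
  move=> mS; rewrite /dX (eq_integral (fun x => `|s|%:E * (\1_T x)%:E)); last first.
    by move=> x _; rewrite /g normrM EFinM [X in _ * X%:E]ger0_norm.
  rewrite ge0_integralZl//; last by apply/measurable_EFinP; apply: measurable_indic.
  by rewrite integral_indic// setIC.
have gT x w : `|g x w|%:E = `|s|%:E * (\1_T x)%:E.
  by rewrite /g normrM EFinM [X in _ * X%:E]ger0_norm.
have fctX : is_fct P A M X dX.
  exists Xt, g; split => //.
  - split; last by apply: filterS XE => w ->.
    move=> u v Mu Mv uv; rewrite /Xt; congr (_ * fine _)%R.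
    have [mu _] := Linfty_bounded (MLoo _ Mu); have [mv _] := Linfty_bounded (MLoo _ Mv).
    apply: ae_eq_integral => //.
    + by apply: measurable_funTS; exact/measurable_EFinP.
    + by apply: measurable_funTS; exact/measurable_EFinP.
    + by apply: filterS uv => x /= -> _.
  - split.
    + apply: measurable_funM => //.
      by apply: (measurableT_comp (measurable_indic mT)).
    + move=> r; rewrite (eq_integral (fun=> (`|s|%:E * leb (eball 0 r `&` T)) ^+ 2)); last first.
        by move=> w _; rewrite -(dXE _ w)//; exact: measurable_eball.
      rewrite integral_probability_cst.
      have : leb (eball 0 r `&` T) \is a fin_num.
        by rewrite ge0_fin_numE// SToo//; exact: measurable_eball.
      by case: (leb _) => // q _; rewrite -EFinM -EFin_expe ltry.
    + move=> B BLoo _; apply: aeW => w.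
      have intA := Linfty_integrable (MLoo _ (MA w)) mT Too.
      have intB := Linfty_integrable BLoo mT Too.
      have -> : (\int[leb]_x (B x * g x w))%R = Xt B.
        rewrite /Xt /Rintegral -[s in RHS]/(fine s%:E) -fineM//; last first.
          exact: integrable_fin_num.
        rewrite -integralZl// [in RHS]integral_mkcond; congr fine.
        apply: eq_integral => x _; rewrite patchE /g indicE.
        by case: ifPn => _; rewrite ?mulr1 ?mulr0 ?mulr0 // -EFinM mulrC.
      apply: cvg_near_cst; near=> t.
      have t0 : t != 0%R by near: t; exact: nbhs_dnbhs_neq.
      rewrite /Xt; under eq_integral do rewrite EFinD EFinM.
      rewrite integralD//; last exact: integrableZl.
      rewrite integralZl// fineD ?integrable_fin_num//; last first.
        by rewrite fin_numM// integrable_fin_num.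
      rewrite fineM ?integrable_fin_num//=.
      by field.
exists X, dX; split => // S mS _.
rewrite /sq_mean (eq_integral (fun=> (`|s|%:E * leb (S `&` T)) ^+ 2)); last first.
  by move=> w _; rewrite dXE.
rewrite integral_probability_cst.
set q := fine (leb (S `&` T)).
have q0 : (0 <= q)%R by rewrite /q fine_ge0.
have -> : leb (S `&` T) = q%:E by rewrite /q fineK// ge0_fin_numE// SToo.
rewrite -EFinM -EFin_expe lee_fin.
apply: lerXn2r; rewrite ?nnegrE ?mulr_ge0 ?addr_ge0 ?mulr_ge0//.
by rewrite ler_wpM2r// (le_trans s1)// lerDr mulr_ge0.
Unshelve. all: by end_near. Qed.

End fixed_domain.

(** The factor [s] serves to change the sign of the average, as the covariance inequalities are
    one-sided. *)
Lemma avg_admissible (T : set Rd) (s : R) : measurable T -> leb T < +oo ->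
  (`|s| <= 1)%R -> (k = osc -> bounded_field P A K) ->
  (k = fct -> open_Linfty M /\ forall w, M (A ^~ w)) -> exists X dX,
  [/\ admissible P k M A X dX, {ae P, forall w, X w = (s * pint leb T A w)%R} &
      forall x r, sq_mean P dX (eball x r) <=
        ((osc_const K * fine (leb (eball x r `&` T))) ^+ 2)%:E].
Proof.
move=> mT Too s1; case: k => [/(_ erefl) AK _|_ /(_ erefl)[oM MA]].
  have [X [dX [aX XE dXle]]] := osc_average mT Too s1 AK.
  by exists X, dX; split => // x r; apply: dXle; exact: measurable_eball.
have [X [dX [aX XE dXle]]] := fct_average mT Too s1 MA oM.
exists X, dX; split => // x r; apply: dXle; first exact: measurable_eball.
exists (enorm x + r)%R => y; rewrite /eball/= subr0 => yx.
by rewrite -(subrK x y) (le_lt_trans (enormD _ _))// addrC ltrD2l.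
Qed.

End admissible_averages.

(** * Integrability of the covariance function *)

Section weighted_geometric_sums.
Context (R : realType).
Implicit Types (q m : R).

Lemma geometric_sum_le q (N : nat) : 0 <= q < 1 -> \sum_(k < N) q ^+ k <= (1 - q)^-1.
Proof.
move=> /andP[q0 q1]; have q10 : 0 < 1 - q by rewrite subr_gt0.
rewrite -[leRHS]mul1r ler_pdivlMr// mulrC -opprB mulNr -subrX1 opprB.
by rewrite gerBl exprn_ge0.
Qed.

Lemma powR2_lt1 (x : R) : x < 0 -> 2 `^ x < 1.
Proof.
by move=> x0; rewrite /powR gt_eqF//= expR_lt1 pmulr_llt0// ln_gt0// ltr1n.
Qed.

Lemma powR2_gt1 (x : R) : 0 < x -> 1 < 2 `^ x.
Proof.
by move=> x0; rewrite /powR gt_eqF//= expR_gt1 mulr_gt0// ln_gt0// ltr1n.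
Qed.

(** This is what the dyadic decomposition of the weight leaves under the integral over [l], with
    [q = 2^(-a)] and [m = l + 1]. *)
Definition truncated_sum q (d N : nat) m := \sum_(k < N) q ^+ k * Num.min m (2 ^+ k) ^+ d.

(** Self-similarity: for [1 <= m] the first term is 1, and the others form [2^d q] times the sum for
    [m / 2]. Any [f] that dominates this recursion and the starting range [1/2 <= m < 1] is a
    majorant; the three regimes of [a] amount to three choices of [f]. *)
Lemma truncated_sum_le q (d : nat) (f : R -> R) : 0 <= q < 1 ->
  (forall m, 2^-1 <= m -> 0 <= f m) ->
  (forall m, 2^-1 <= m < 1 -> (1 - q)^-1 <= f m) ->
  (forall m, 1 <= m -> 1 + 2 ^+ d * q * f (m / 2) <= f m) ->
  forall N m, 2^-1 <= m -> truncated_sum q d N m <= f m.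
Proof.
move=> /andP[q0 q1] f0 fs fl; elim=> [|N ih] m m2.
  by rewrite /truncated_sum big_ord0 f0.
have [m1|m1] := leP 1 m; last first.
  apply: le_trans (fs m _); last by rewrite m2.
  apply: le_trans (geometric_sum_le N.+1 _); last by rewrite q0.
  apply: ler_sum => k _; rewrite ler_piMr ?exprn_ge0// exprn_ile1//.
    by rewrite le_min (le_trans _ m2) ?invr_ge0// exprn_ge0.
  by rewrite ge_min (ltW m1).
rewrite /truncated_sum big_ord_recl/= !expr0 mul1r (min_idPr m1) expr1n.
apply: le_trans (fl m m1); rewrite lerD2l.
have m22 : 2^-1 <= m / 2 by rewrite -[leLHS]mul1r ler_pM2r// invr_gt0.
apply: (@le_trans _ _ (2 ^+ d * q * truncated_sum q d N (m / 2))); last first.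
  by rewrite ler_wpM2l ?ih// mulr_ge0// exprn_ge0.
rewrite le_eqVlt; apply/orP; left; apply/eqP.
rewrite /truncated_sum mulr_sumr; apply: eq_bigr => k _ /=.
have -> : Num.min m (2 ^+ (bump 0 k)) = 2 * Num.min (m / 2) (2 ^+ k).
  by rewrite minr_pMr// mulrC divfK// -exprS.
by rewrite exprMn exprS; ring.
Qed.

Lemma truncated_sum_lt (d : nat) (a : R) : 0 < a -> a < d%:R -> exists2 C : R, 0 < C &
  forall N m, 1 <= m -> truncated_sum (2 `^ (- a)) d N m <= C * m `^ (d%:R - a).
Proof.
move=> a0 ad; set q := 2 `^ (- a).
have q0 : 0 < q by rewrite powR_gt0.
have q1 : q < 1 by rewrite powR2_lt1// oppr_lt0.
pose b : R := 2 ^+ d * q.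
have bE : b = 2 `^ (d%:R - a).
  by rewrite /b /q -powR_mulrn// -powRD//; apply/implyP.
have b1 : 1 < b by rewrite bE powR2_gt1// subr_gt0.
(* With [b = 2^(d - a) > 1], the function [C m^(d - a) - D] solves the recursion exactly because
   [(b - 1) D = 1]. The value of [C] makes it at least [(1 - q)^-1] for [1/2 <= m], where
   [m^(d - a)] is at least [b^-1]. *)
pose D := (b - 1)^-1; pose C := b * ((1 - q)^-1 + D).
have D0 : 0 < D by rewrite invr_gt0 subr_gt0.
have p0 : 0 < (1 - q)^-1 by rewrite invr_gt0 subr_gt0.
have C0 : 0 < C by rewrite mulr_gt0// ?addr_gt0// (lt_trans _ b1).
exists C => // N m m1.
have half m' : 2^-1 <= m' -> (1 - q)^-1 <= C * m' `^ (d%:R - a) - D.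
  move=> m2; rewrite lerBrDr /C -mulrAC.
  rewrite -[leLHS]mul1r ler_wpM2r ?addr_ge0 ?(ltW p0) ?(ltW D0)//.
  have m'2 : 1 <= 2 * m' by rewrite -ler_pdivrMl// mulr1.
  rewrite bE -powRM//; last by rewrite (le_trans _ m2)// invr_ge0.
  rewrite [leLHS](_ : 1 = 1 `^ (d%:R - a)); last by rewrite powR1.
  by rewrite ge0_ler_powR// ?nnegrE ?subr_ge0 ?(ltW ad)// (le_trans _ m'2).
apply: (@le_trans _ _ (C * m `^ (d%:R - a) - D)); last by rewrite gerBl ltW.
apply: (@truncated_sum_le q d (fun m => C * m `^ (d%:R - a) - D)).
- by rewrite (ltW q0).
- by move=> m' /half; apply: le_trans; exact: ltW.
- by move=> m' /andP[/half].
- move=> m' m1'; rewrite powRM ?invr_ge0 ?(le_trans _ m1')//.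
  have -> : (2^-1 : R) `^ (d%:R - a) = b^-1.
    have b0 : b != 0 by rewrite gt_eqF// (lt_trans _ b1).
    apply: (mulfI b0); rewrite mulfV// bE -powRM ?invr_ge0// mulfV//.
    by rewrite powR1.
  have bD : (b - 1) * D = 1 by rewrite mulfV// gt_eqF// subr_gt0.
  have b0 : b != 0 by rewrite gt_eqF// (lt_trans _ b1).
  rewrite -/b; set t := m' `^ _.
  have -> : b * (C * (t / b) - D) = C * t - b * D by field.
  lra.
- by rewrite (le_trans _ m1)// invf_le1// ler1n.
Qed.

Lemma truncated_sum_eq (d : nat) : (0 < d)%N -> exists2 C : R, 0 < C &
  forall N m, 1 <= m -> truncated_sum (2 `^ (- d%:R)) d N m <= C * ln (1 + m) ^+ 2.
Proof.
move=> d0; set q := 2 `^ (- d%:R).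
have q0 : 0 < q by rewrite powR_gt0.
have q1 : q < 1 by rewrite powR2_lt1// oppr_lt0 ltr0n.
have b1 : 2 ^+ d * q = 1.
  by rewrite /q powRN powR_mulrn// divff// expf_neq0.
have l2 : 0 < ln 2 :> R by rewrite ln_gt0// ltr1n.
have p0 : 0 < (1 - q)^-1 by rewrite invr_gt0 subr_gt0.
(* For [a = d] each halving of [m] adds 1, so [f] is the logarithm in base 2 plus [D]; the 1 in [D]
   offsets the value -1 of the logarithm at [m = 1/2]. *)
pose D := 1 + (1 - q)^-1.
have half m : 2^-1 <= m -> - 1 <= ln m / ln 2.
  move=> m2; rewrite ler_pdivlMr// mulN1r -lnV ?posrE// ler_ln// posrE ?invr_gt0//.
  by rewrite (lt_le_trans _ m2)// invr_gt0.
exists ((1 + D) / ln 2 ^+ 2); first by rewrite divr_gt0 ?exprn_gt0// /D; lra.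
move=> N m m1; apply: (@le_trans _ _ (ln m / ln 2 + D)).
  apply: (@truncated_sum_le q d (fun m => ln m / ln 2 + D)).
  - by rewrite (ltW q0).
  - by move=> m' /half; rewrite /D; lra.
  - by move=> m' /andP[/half]; rewrite /D; lra.
  - move=> m' m1'; rewrite b1 mul1r ln_div ?posrE//; last exact: lt_le_trans m1'.
    rewrite mulrBl divff ?gt_eqF//; lra.
  - by rewrite (le_trans _ m1)// invf_le1// ler1n.
(* The recursion gives a single logarithm. Since [ln (1 + m) / ln 2] is at least 1, its square
   dominates it. *)
set l := ln (1 + m).
have l2l : 1 <= l / ln 2.
  by rewrite ler_pdivlMr// mul1r ler_ln ?posrE; lra.
have lml : ln m / ln 2 <= l / ln 2.
  by rewrite ler_pM2r ?invr_gt0// ler_ln ?posrE; lra.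
rewrite mulrAC -[_ / ln 2 ^+ 2]mulrA -expr_div_n.
have : l / ln 2 <= (l / ln 2) ^+ 2 by rewrite expr2 ler_peMl// (le_trans _ l2l).
have D0 : 0 <= D by rewrite /D; lra.
have : 1 <= (l / ln 2) ^+ 2 by rewrite expr_ge1// (le_trans _ l2l).
nra.
Qed.

Lemma truncated_sum_gt (d : nat) (a : R) : d%:R < a -> exists2 C : R, 0 < C &
  forall N m, 1 <= m -> truncated_sum (2 `^ (- a)) d N m <= C.
Proof.
move=> ad; set q := 2 `^ (- a).
have a0 : 0 < a by rewrite (le_lt_trans _ ad).
have q0 : 0 < q by rewrite powR_gt0.
have q1 : q < 1 by rewrite powR2_lt1// oppr_lt0.
pose b : R := 2 ^+ d * q.
have bE : b = 2 `^ (d%:R - a).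
  by rewrite /b /q -powR_mulrn// -powRD//; apply/implyP.
have b1 : b < 1 by rewrite bE powR2_lt1// subr_lt0.
have p0 : 0 < (1 - q)^-1 by rewrite invr_gt0 subr_gt0.
have p1 : 0 < (1 - b)^-1 by rewrite invr_gt0 subr_gt0.
(* With [b < 1] a constant [f] suffices: the first summand is the fixed point of [f = 1 + b f], the
   second covers the starting range. *)
exists ((1 - b)^-1 + (1 - q)^-1); first exact: addr_gt0.
move=> N m m1; apply: (@truncated_sum_le q d (fun=> (1 - b)^-1 + (1 - q)^-1)).
- by rewrite (ltW q0).
- by move=> _ _; rewrite ltW// addr_gt0.
- by move=> _ _; rewrite lerDr ltW.
- move=> _ _; rewrite -/b; have : (1 - b)^-1 * (1 - b) = 1 by rewrite mulVf// gt_eqF// subr_gt0.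
  have : 0 <= (1 - q)^-1 * (1 - b) by rewrite mulr_ge0// ltW// subr_gt0.
  by lra.
- by rewrite (le_trans _ m1)// invf_le1// ler1n.
Qed.

End weighted_geometric_sums.

Section nonmeasurable_integrand.
Context d (T : measurableType d) (R : realType) (mu : {measure set T -> \bar R}).
Local Open Scope ereal_scope.

(* The integral of a nonnegative function is a supremum over the simple
   functions below it, hence monotone whether or not the integrands are
   measurable. *)
Lemma ge0_le_integral_nonmeasurable (D : set T) (f g : T -> \bar R) :
  (forall x, D x -> 0 <= f x) -> (forall x, D x -> f x <= g x) ->
  \int[mu]_(x in D) f x <= \int[mu]_(x in D) g x.
Proof.
move=> f0 fg; rewrite !ge0_integralE//; last first.
  by move=> x Dx; rewrite (le_trans (f0 x Dx))// fg.
apply: ereal_sup_le => _ [h hf <-]; exists h => // x.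
rewrite (le_trans (hf x))// !patchE; case: ifPn => //; rewrite inE => Dx.
exact: fg.
Qed.

End nonmeasurable_integrand.

Section averages.
Context (R : realType) (n : nat) (dO : measure_display)
  (Omega : measurableType dO) (P : probability Omega R).
Local Notation Rd := 'rV[R]_n.
Local Notation leb := (lebesgue_rV R n).
Local Open Scope ereal_scope.

Lemma integral_normM_le (X Y : Omega -> R) :
  measurable_fun setT X -> measurable_fun setT Y ->
  \int[P]_w `|X w * Y w|%:E <= \int[P]_w (X w ^+ 2)%:E + \int[P]_w (Y w ^+ 2)%:E.
Proof.
move=> mX mY; rewrite -ge0_integralD//; last 4 first.
- by move=> w _; rewrite lee_fin sqr_ge0.
- exact/measurable_EFinP/measurable_funX.
- by move=> w _; rewrite lee_fin sqr_ge0.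
- exact/measurable_EFinP/measurable_funX.
apply: ge0_le_integral => //.
- by apply/measurable_EFinP/measurableT_comp => //; exact: measurable_funM.
- by apply: emeasurable_funD; apply/measurable_EFinP/measurable_funX.
move=> w _; rewrite lee_fin normrM.
rewrite -[(X w ^+ 2)%R]real_normK ?num_real// -[(Y w ^+ 2)%R]real_normK ?num_real//.
have := sqr_ge0 (`|X w| - `|Y w|)%R; rewrite sqrrB.
have := mulr_ge0 (normr_ge0 (X w)) (normr_ge0 (Y w)).
rewrite -mulr_natr; lra.
Qed.

Variable A : Rd -> Omega -> R.
Hypotheses (mA : jointly_measurable A) (sA : stationary P A).
Hypothesis A2 : 'E_P[(fun w => `|A 0%R w| ^+ 2)%R] < +oo.

Lemma cfield_L2_bound : exists c : R, forall x,
  \int[P]_w (cfield P A x w ^+ 2)%:E <= c%:E.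
Proof.
exists (fine (\int[P]_w (cfield P A 0%R w ^+ 2)%:E)) => x.
rewrite /cfield (stationary_integral1 mA sA x (psi := fun t => (t - field_mean P A) ^+ 2)%R).
  rewrite fineK// ge0_fin_numE; last by apply: integral_ge0 => w _; rewrite lee_fin sqr_ge0.
  exact: (Lfun2_sqr_lty (Lfun2_cfield mA sA A2 0%R)).
by apply: measurable_funX; exact: measurable_funB.
Qed.

Lemma cfield_L1_bound : exists c : R, forall x,
  \int[P]_w `|cfield P A x w|%:E <= c%:E.
Proof.
exists (fine (\int[P]_w `|cfield P A 0%R w|%:E)) => x.
rewrite /cfield (stationary_integral1 mA sA x (psi := fun t => `|t - field_mean P A|)%R).
  rewrite fineK// ge0_fin_numE; last exact: integral_ge0.
  have /integrableP[_] := Lfun2_integrable (Lfun2_cfield mA sA A2 0%R).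
  by [].
by apply: measurableT_comp => //; exact: measurable_funB.
Qed.

Lemma measurable_cfield1 x : measurable_fun setT (cfield P A x).
Proof. exact: Lfun2_measurable (Lfun2_cfield mA sA A2 x). Qed.

Lemma Lfun2_cavg T : measurable T -> leb T < +oo ->
  pint leb T (cfield P A) \in Lfun P 2%:E.
Proof.
move=> mT Too; have [c1 h1] := cfield_L1_bound; have [c2 h2] := cfield_L2_bound.
apply: (@Lfun2_pint _ _ _ _ _ leb P T (cfield P A) c1 mT Too _ _ c2) => //.
exact: measurable_cfield.
Qed.

Let integral_cstE (c : R) T : measurable T -> leb T < +oo ->
  \int[leb]_(x in T) c%:E = (c * fine (leb T))%:E.
Proof.
move=> mT Too; rewrite EFinM fineK ?ge0_fin_numE//.
exact: (integral_cst leb mT c%:E).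
Qed.

Lemma expectation_avg T : measurable T -> leb T < +oo ->
  'E_P[pint leb T A] = (field_mean P A * fine (leb T))%:E.
Proof.
move=> mT Too; have [c h1] := field_L1_bound mA sA A2.
have [_] := @integral_pint _ _ _ _ _ leb P T A mT Too mA c (fun x _ => h1 x).
rewrite unlock => ->; rewrite (eq_integral (fun=> (field_mean P A)%:E)).
  exact: integral_cstE.
by move=> x _; rewrite -(expectation_field mA sA A2 x) unlock.
Qed.

Lemma avg_centered T : measurable T -> leb T < +oo ->
  {ae P, forall w, (pint leb T A w - field_mean P A * fine (leb T))%R =
    pint leb T (cfield P A) w}.
Proof.
move=> mT Too; have [c h1] := field_L1_bound mA sA A2.
apply: filterS (ae_integrable_param mT Too mA (fun x _ => h1 x)) => w intw.
rewrite /pint /cfield; under [in RHS]eq_integral do rewrite EFinB.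
have intc : leb.-integrable T (fun=> (field_mean P A)%:E).
  apply/integrableP; split; first exact: measurable_cst.
  rewrite (integral_cst leb mT `|field_mean P A|%:E) lte_mul_pinfty//.
rewrite [X in _ = fine X](integralB mT intw intc) [RHS]fineB ?integrable_fin_num//.
by rewrite (integral_cstE _ mT Too).
Qed.

Lemma covariance_avg T S : measurable T -> leb T < +oo -> measurable S -> leb S < +oo ->
  covariance P (pint leb T A) (pint leb S A) =
  \int[leb]_(x in T) \int[leb]_(y in S) (cov P A (y - x))%:E.
Proof.
move=> mT Too mS Soo; rewrite covariance.unlock !expectation_avg//= unlock.
have [c1 h1] := cfield_L1_bound; have [c2 h2] := cfield_L2_bound.
have mcT := Lfun2_measurable (Lfun2_cavg mT Too).
have mcS := Lfun2_measurable (Lfun2_cavg mS Soo).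
have mIT := Lfun2_measurable (Lfun2_avg mA sA A2 mT Too).
have mIS := Lfun2_measurable (Lfun2_avg mA sA A2 mS Soo).
transitivity (\int[P]_w (pint leb T (cfield P A) w * pint leb S (cfield P A) w)%:E).
  apply: ae_eq_integral => //.
  - by apply/measurable_EFinP/measurable_funM; exact: measurable_funB.
  - exact/measurable_EFinP/measurable_funM.
  - apply: filterS2 (avg_centered mT Too) (avg_centered mS Soo) => w hT hS _ /=.
    by rewrite -hT -hS.
have [q qE] : exists q : R, \int[P]_w (pint leb S (cfield P A) w ^+ 2)%:E = q%:E.
  exists (fine (\int[P]_w (pint leb S (cfield P A) w ^+ 2)%:E)).
  rewrite fineK// ge0_fin_numE; first exact: (Lfun2_sqr_lty (Lfun2_cavg mS Soo)).
  by apply: integral_ge0 => w _; rewrite lee_fin sqr_ge0.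
have [|_ ->] := @pint_mulr _ _ _ _ _ leb P T _ mT Too (measurable_cfield P mA) c1
  (fun x _ => h1 x) _ (c2 + q)%R mcS.
  move=> x _; rewrite (le_trans (integral_normM_le _ _))//; first exact: measurable_cfield1.
  by rewrite qE EFinD leeD.
apply: eq_integral => x _; under eq_integral do rewrite mulrC.
have [|_ ->] := @pint_mulr _ _ _ _ _ leb P S _ mS Soo (measurable_cfield P mA) c1
  (fun x _ => h1 x) _ (c2 + c2)%R (measurable_cfield1 x).
  move=> y _; rewrite (le_trans (integral_normM_le _ _))//; [exact: measurable_cfield1..|].
  by rewrite EFinD leeD.
apply: eq_integral => y _; rewrite -(covE mA sA A2) (autocovarianceE mA sA A2).
by apply: eq_integral => w _; rewrite mulrC.
Qed.

End averages.

(** * Intersections of balls with a fixed set *)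

Section ball_intersections.
Context (R : realType) (n : nat).
Local Notation Rd := 'rV[R]_n.
Local Notation leb := (lebesgue_rV R n).
Local Open Scope ereal_scope.
Implicit Types (T : set Rd) (r : R).

Lemma measurable_leb_ballI T r : measurable T ->
  measurable_fun setT (fun x => leb (eball x r `&` T)).
Proof.
move=> mT.
have mE : measurable ([set p : Rd * Rd | eball p.1 r p.2] `&` (setT `*` T)).
  by apply: measurableI; [exact: measurable_eball2|exact: measurableX].
have := @measurable_fun_xsection _ _ _ _ _ leb _ mE.
rewrite (_ : _ \o _ = fun x => leb (eball x r `&` T))//.
apply/funext => x /=; congr (leb _); apply/seteqP; split => y.
  by rewrite /xsection/= inE/= => -[? []].
by rewrite /xsection/= inE/= => -[? ?].
Qed.

(** Tonelli: a point [y] of [T] lies in [eball x r] exactly when [x] lies in [eball y r]. *)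
Lemma integral_leb_ballI T r : measurable T -> (0 <= r)%R ->
  \int[leb]_x leb (eball x r `&` T) <= ((2 * r) ^+ n)%:E * leb T.
Proof.
move=> mT r0.
have mE : measurable ([set p : Rd * Rd | eball p.1 r p.2] `&` (setT `*` T)).
  by apply: measurableI; [exact: measurable_eball2|exact: measurableX].
set E := _ `&` _ in mE.
have m1 : measurable_fun setT (fun p => (\1_E p)%:E : \bar R).
  by apply/measurable_EFinP; exact: measurable_indic.
have ->  : \int[leb]_x leb (eball x r `&` T) = \int[leb]_x \int[leb]_y (\1_E (x, y))%:E.
  apply: eq_integral => x _; rewrite -[X in leb X]setIT -integral_indic//; last first.
    by apply: measurableI => //; exact: measurable_eball.
  apply: eq_integral => y _; congr (_%:E); rewrite !indicE.
  have [[? ?]|nE] := pselect ((eball x r `&` T) y).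
    by rewrite !mem_set.
  by rewrite !memNset// => -[? [_ ?]]; apply: nE.
rewrite (@fubini_tonelli _ _ _ _ _ leb leb (fun p => (\1_E p)%:E))//.
apply: (@le_trans _ _ (\int[leb]_(y in T) ((2 * r) ^+ n)%:E)); last first.
  by rewrite (integral_cst leb mT ((2 * r) ^+ n)%:E).
rewrite [leRHS]integral_mkcond.
apply: ge0_le_integral => //.
- by move=> y _; apply: integral_ge0 => x _.
- exact: (measurable_integral1 leb m1).
- by apply/(measurable_restrictT _ _).1 => //; exact: measurable_cst.
move=> y _; rewrite patchE; case: ifPn => yT.
  rewrite (le_trans _ (lebesgue_eball y r0))// -[X in _ <= leb X]setIT -integral_indic//; last exact: measurable_eball.
  apply: ge0_le_integral => //.
  - by apply/measurable_EFinP; apply: measurableT_comp; [exact: measurable_indic|].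
  - apply/measurable_EFinP; apply: measurable_indic; exact: measurable_eball.
  move=> x _; rewrite lee_fin !indicE ler_nat.
  have [[/= xy _]|nE] := pselect (E (x, y)); last by rewrite [(x, y) \in E]memNset.
  by rewrite (mem_set (eball_sym xy)) leq_b1.
rewrite integral0_eq// => x _; rewrite indicE memNset// => -[_ /= [_ Ty]].
by move: yT; rewrite notin_setE.
Qed.

Lemma leb_ballI_le x r T : measurable T -> leb (eball x r `&` T) <= leb T.
Proof.
move=> mT; have mB := measurable_eball x r.
by apply: le_measure; rewrite ?inE//; exact: measurableI.
Qed.

Lemma leb_ballI_fin x r T : measurable T -> leb T < +oo ->
  leb (eball x r `&` T) \is a fin_num.
Proof.
move=> mT Too; rewrite ge0_fin_numE//; apply: le_lt_trans Too; exact: leb_ballI_le.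
Qed.

Lemma integral_sqr_leb_ballI T r (c t : R) : measurable T -> (0 <= r)%R ->
  leb T <= t%:E ->
  \int[leb]_x ((c * fine (leb (eball x r `&` T))) ^+ 2)%:E <=
  (c ^+ 2 * Num.min ((2 * r) ^+ n) t * ((2 * r) ^+ n * t))%:E.
Proof.
move=> mT r0 Tt; have Too : leb T < +oo by rewrite (le_lt_trans Tt)// ltry.
set q := Num.min _ _.
have t0 : (0 <= t)%R by rewrite -lee_fin (le_trans _ Tt).
have q0 : (0 <= q)%R by rewrite le_min t0 exprn_ge0// mulr_ge0.
apply: (@le_trans _ _ (\int[leb]_x ((c ^+ 2 * q)%:E * leb (eball x r `&` T)))).
  apply: ge0_le_integral => //.
  - by move=> x _; rewrite lee_fin sqr_ge0.
  - apply/measurable_EFinP/measurable_funX; apply: measurable_funM => //.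
    by apply: measurableT_comp => //; exact: measurable_leb_ballI.
  - by apply: measurable_funeM; exact: measurable_leb_ballI.
  move=> x _; have lf := leb_ballI_fin x r mT Too.
  rewrite -[in leRHS](fineK lf) -EFinM lee_fin exprMn -[leRHS]mulrA ler_wpM2l ?sqr_ge0//.
  rewrite expr2 ler_wpM2r ?fine_ge0// le_min -!lee_fin !fineK//; apply/andP; split.
    apply: le_trans (lebesgue_eball x r0); apply: le_measure; rewrite ?inE.
    - by apply: measurableI => //; exact: measurable_eball.
    - exact: measurable_eball.
    - exact: subIsetl.
  by apply: le_trans Tt; exact: leb_ballI_le.
rewrite ge0_integralZl//; last 2 first.
- exact: measurable_leb_ballI.
- by rewrite lee_fin mulr_ge0// sqr_ge0.
have cq0 : (0 <= c ^+ 2 * q)%R by rewrite mulr_ge0// sqr_ge0.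
rewrite [leRHS]EFinM lee_wpmul2l ?lee_fin//.
rewrite (le_trans (integral_leb_ballI mT r0))// EFinM lee_wpmul2l// lee_fin.
by rewrite exprn_ge0// mulr_ge0.
Qed.

End ball_intersections.

Section exhaustion.
Context d (T : measurableType d) (R : realType) (mu : {measure set T -> \bar R}).
Local Open Scope ereal_scope.

Lemma ge0_integral_exhaustion_le (E : (set T)^nat) (f : T -> \bar R) (b : \bar R) :
  nondecreasing_seq E -> (forall k, measurable (E k)) -> \bigcup_k E k = setT ->
  measurable_fun setT f -> (forall x, 0 <= f x) ->
  (forall k, \int[mu]_(x in E k) f x <= b) -> \int[mu]_x f x <= b.
Proof.
move=> ndE mE ET mf f0 fb.
have := @ge0_nondecreasing_set_cvg_integral _ _ _ E f mu ndE mE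
  (fun k => measurable_funTS mf) (fun k x _ => f0 x).
rewrite ET => cf; rewrite -(cvg_lim _ cf)//; apply: lime_le.
  by apply/cvg_ex; eexists; exact: cf.
by apply: nearW.
Qed.

End exhaustion.

Section weight_kernel.
Context (R : realType).
Implicit Types (a l : R) (n : nat).

(** The factor of [w] in the three cases of [weight_bound], gathered so that one computation serves
    all of them. *)
Definition weight_kernel n a l : R :=
  if a < n%:R then (l + 1) `^ (n%:R - a)
  else if a == n%:R then ln (2 + l) ^+ 2 else 1.

Lemma weight_kernel_ge0 n a l : 0 <= weight_kernel n a l.
Proof.
by rewrite /weight_kernel; case: ifP => _; [exact: powR_ge0|case: ifP => _ //; exact: sqr_ge0].
Qed.

Lemma measurable_weight_kernel n a : measurable_fun setT (weight_kernel n a).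
Proof.
have -> : weight_kernel n a = if a < n%:R then fun l => (l + 1) `^ (n%:R - a)
    else if a == n%:R then fun l => ln (2 + l) ^+ 2 else fun=> 1.
  by apply/funext => l; rewrite /weight_kernel; case: ifP => // _; case: ifP.
case: ifP => _.
  apply: (measurableT_comp (measurable_powR (n%:R - a))).
  exact: measurable_funD.
case: ifP => _; last exact: measurable_cst.
apply: measurable_funX; apply: (measurableT_comp (@measurable_ln R)).
exact: measurable_funD.
Qed.

Lemma weight_boundE n a (w : R -> R) : weight_bound n a w =
  (\int[lebesgue_measure]_(l in `[0%R, +oo[) (weight_kernel n a l * w l)%:E)%E.
Proof.
rewrite /weight_bound; case: ifPn => [an|an].
  by apply: eq_integral => l _; rewrite /weight_kernel an.
case: ifPn => [aE|aE]; apply: eq_integral => l _.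
  by rewrite /weight_kernel (negPf an) aE.
by rewrite /weight_kernel (negPf an) (negPf aE) mul1r.
Qed.

Lemma truncated_sum_weight n a : (0 < n)%N -> 0 < a -> exists2 c : R, 0 < c &
  forall N l, 0 <= l ->
    truncated_sum (2 `^ (- a)) n N (l + 1) <= c * weight_kernel n a l.
Proof.
move=> n0 a0; rewrite /weight_kernel; have [an|na|->] := ltgtP a n%:R.
- have [c c0 h] := truncated_sum_lt a0 an; exists c => // N l l0.
  by apply: h; lra.
- have [c c0 h] := truncated_sum_gt na; exists c => // N l l0.
  by rewrite mulr1; apply: h; lra.
- have [c c0 h] := @truncated_sum_eq R n n0; exists c => // N l l0.
  apply: (le_trans (h N (l + 1) _)); first lra.
  by rewrite (_ : 1 + (l + 1) = 2 + l)//; ring.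
Qed.

Lemma dyadic_bracket (y : R) (N : nat) : 1 <= y -> y < 2 ^+ N ->
  exists2 i, (i < N)%N & 2 ^+ i <= y < 2 ^+ i.+1.
Proof.
move=> y1; elim: N => [|N ih]; first by rewrite expr0 ltNge y1.
have [yN _|Ny yN] := ltP y (2 ^+ N); last by exists N => //; rewrite Ny.
by have [i iN yi] := ih yN; exists i => //; exact: ltnW.
Qed.

End weight_kernel.

(** * From variance inequalities to integrals of the covariance *)

Section integrability.
Context (R : realType) (n : nat) (dO : measure_display)
  (Omega : measurableType dO) (P : probability Omega R).
Local Notation Rd := 'rV[R]_n.
Local Notation leb := (lebesgue_rV R n).
Local Open Scope ereal_scope.
Variables (A : Rd -> Omega -> R) (k : derivative_kind) (M : set (Rd -> R)) (K : R).
Hypotheses (mA : jointly_measurable A) (sA : stationary P A).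
Hypothesis A2 : 'E_P[(fun w => `|A 0%R w| ^+ 2)%R] < +oo.
Hypothesis bA : k = osc -> bounded_field P A K.
Hypothesis MA : k = fct -> open_Linfty M /\ forall w, M (A ^~ w).

Local Notation C := (cov P A).
Local Notation kappa := (osc_const K).

Hypothesis C0 : forall x, (0 <= C x)%R.

Let cube_oo (L : R) : (0 <= L)%R -> leb (cube L) < +oo.
Proof. by move=> L0; rewrite lebesgue_cube// ltry. Qed.

Let mC : measurable_fun setT (EFin \o C).
Proof. by apply/measurable_EFinP; exact: (measurable_cov mA sA A2). Qed.

(** For [x] in [cube L], the translate of [cube (2 * L)] by [- x] contains [cube L]. All other
    contributions to the double integral are nonnegative and dropped. *)
Lemma integral_cov_cube_le_variance (L : R) : (0 <= L)%R ->
  ((2 * L) ^+ n)%:E * \int[leb]_(x in cube L) (C x)%:E <=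
  'V_P[pint leb (cube (2 * L)) A].
Proof.
move=> L0; have L20 : (0 <= 2 * L)%R by rewrite mulr_ge0.
have mc l : measurable (cube l : set Rd) by exact: measurable_cube.
rewrite /variance (covariance_avg mA sA A2 (mc _) (cube_oo L20) (mc _) (cube_oo L20)).
have mCB : measurable_fun setT (fun p : Rd * Rd => (C (p.2 - p.1))%:E).
  by apply/measurable_EFinP; exact: measurable_covB.
have mCT (T : set Rd) : measurable T ->
    measurable_fun setT (fun x : Rd => \int[leb]_(y in T) (C (y - x))%:E).
  move=> mT.
  apply: (@measurable_integral1_in _ _ _ _ _ leb T (fun p : Rd * Rd => (C (p.1 - p.2))%:E) mT).
  exact: (measurableT_comp mCB (@measurable_swap _ _ Rd Rd)).
apply: (@le_trans _ _ (\int[leb]_(x in cube L) \int[leb]_(y in cube (2 * L)) (C (y - x))%:E)); last first.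
  apply: ge0_subset_integral => //.
  - exact: measurable_funTS (mCT _ (mc _)).
  - by move=> x _; apply: integral_ge0 => y _; rewrite lee_fin.
  - by apply: subset_cube; rewrite ler_peMl// ler1n.
rewrite -lebesgue_cube// muleC -(integral_cst leb (mc L)).
apply: ge0_le_integral => //.
- by move=> x _; apply: integral_ge0 => y _; rewrite lee_fin.
- exact: measurable_funTS (mCT _ (mc _)).
move=> x Lx; rewrite integral_mkcond [leRHS]integral_mkcond.
rewrite -[leRHS](ge0_integral_rV_addr x); last 2 first.
- apply/(measurable_restrictT _ _).1 => //; apply: measurable_funTS.
  exact: (measurableT_comp mC (measurable_rV_addr (- x)%R)).
- by move=> y; rewrite patchE; case: ifP => // _; rewrite lee_fin.
apply: ge0_le_integral_nonmeasurable => y _; rewrite !patchE.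
  by case: ifP => // _; rewrite lee_fin.
case: ifPn => [|_]; last by case: ifP => // _; rewrite lee_fin.
rewrite inE => Ly; rewrite ifT ?addrK//.
by rewrite inE (_ : 2 * L = L + L)%R ?mulr_natl//; exact: cube_addr.
Qed.

(** Common reduction for the one-scale and the multiscale inequality: the average is replaced by an
    admissible modification with the same variance, whose derivative obeys the bound on ball
    intersections. *)
Lemma variance_avg_le (T : set Rd) (t : R) (b : \bar R) : measurable T ->
  leb T <= t%:E ->
  (forall X dX, admissible P k M A X dX ->
    (forall r : R, (0 <= r)%R -> \int[leb]_x sq_mean P dX (eball x r) <=
      (kappa ^+ 2 * Num.min ((2 * r) ^+ n) t * ((2 * r) ^+ n * t))%:E) ->
    'V_P[X] <= b) ->
  'V_P[pint leb T A] <= b.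
Proof.
move=> mT Tt Vb; have Too : leb T < +oo by rewrite (le_lt_trans Tt)// ltry.
have [|X [dX [aX XE sX]]] := avg_admissible (s := 1%R) mA sA A2 mT Too _ bA MA.
  by rewrite normr1.
have mX : measurable_fun setT X by case: aX => _ /Lfun2_measurable.
have mI := Lfun2_measurable (Lfun2_avg mA sA A2 mT Too).
have XI : {ae P, forall w, X w = pint leb T A w}.
  by apply: filterS XE => w ->; rewrite mul1r.
rewrite /variance -(covariance_ae_eq mX mI mX mI XI XI).
apply: (Vb X dX aX) => r r0.
apply: le_trans (integral_sqr_leb_ballI kappa mT r0 Tt).
apply: ge0_le_integral_nonmeasurable => x _; last exact: sX.
by apply: integral_ge0 => w _; rewrite sqre_ge0.
Qed.

Lemma integrable_cov (b : R) :
  (forall N : nat, \int[leb]_(x in cube N%:R) (C x)%:E <= b%:E) ->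
  leb.-integrable setT (autocovariance P A).
Proof.
move=> Cb; rewrite (_ : autocovariance P A = EFin \o C); last first.
  by apply/funext => x; rewrite /= -(covE mA sA A2).
apply/integrableP; split; first exact: mC.
under eq_integral do rewrite gee0_abs ?lee_fin//.
apply: le_lt_trans (ltry b).
apply: (@ge0_integral_exhaustion_le _ _ _ _ (fun N => cube N%:R)) => //.
- by move=> i j ij; apply/subsetPset/subset_cube; rewrite ler_nat.
- by move=> i; exact: measurable_cube.
- apply/seteqP; split => // x _.
  exists (Num.truncn (enorm x)).+1 => // i; apply: le_trans (coord_le_enorm x i) _.
  exact/ltW/truncnS_gt.
Qed.

Lemma SG_cov_integrable (r c : R) : (0 < r)%R -> (0 < c)%R -> SG P k M A r c ->
  leb.-integrable setT (autocovariance P A).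
Proof.
(* Both sides scale like the volume [(2 * L)^n] of [cube L]; the last factor 2^n of [b] is the ratio
   of the volumes of [cube (2 * L)] and [cube L]. *)
move=> r0 c0 sg; pose b := (c * (kappa ^+ 2 * (2 * r) ^+ n * ((2 * r) ^+ n * 2 ^+ n)))%R.
apply: (@integrable_cov b) => N.
(* Passing to [N.+1] makes the half-side positive, as the division by the volume requires. *)
apply: (@le_trans _ _ (\int[leb]_(x in cube N.+1%:R) (C x)%:E)).
  apply: ge0_subset_integral; [exact: measurable_cube|exact: measurable_cube|exact: measurable_funTS mC| |].
    by move=> x _; rewrite lee_fin.
  by apply: subset_cube; rewrite ler_nat.
have L0 : (0 < N.+1%:R :> R)%R by rewrite ltr0n.
set L : R := N.+1%:R in L0 *.
have L20 : (0 < 2 * L)%R by rewrite mulr_gt0.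
have tE : leb (cube (2 * L)) <= ((2 * (2 * L)) ^+ n)%:E.
  by rewrite lebesgue_cube// ltW.
rewrite -(@lee_pmul2l _ ((2 * L) ^+ n)%:E)//; last by rewrite lte_fin exprn_gt0.
apply: (le_trans (integral_cov_cube_le_variance (ltW L0))).
apply: (variance_avg_le (measurable_cube _) tE) => X dX aX sX.
apply: (le_trans (sg X dX aX)).
apply: (le_trans (lee_wpmul2l _ (sX r (ltW r0)))); first by rewrite lee_fin ltW.
rewrite -!EFinM lee_fin /b [leRHS]mulrCA; apply: ler_wpM2l; first exact: ltW.
set u := ((2 * r) ^+ n)%R; have u0 : (0 <= u)%R by rewrite exprn_ge0// mulr_ge0// ltW.
have -> : ((2 * L) ^+ n * (kappa ^+ 2 * u * (u * 2 ^+ n)) =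
           kappa ^+ 2 * u * (u * (2 * (2 * L)) ^+ n))%R.
  by rewrite [((2 * (2 * L)) ^+ n)%R]exprMn; ring.
apply: ler_wpM2r; first by rewrite mulr_ge0// exprn_ge0// mulr_ge0// ltW.
by rewrite ler_wpM2l ?sqr_ge0// ge_min lexx.
Qed.

Let min_exprn (x y : R) : (0 <= x)%R -> (0 <= y)%R ->
  Num.min (x ^+ n)%R (y ^+ n)%R = (Num.min x y ^+ n)%R.
Proof.
move=> x0 y0; have [xy|/ltW xy] := leP x y; [rewrite min_l|rewrite min_r] => //.
  by apply: lerXn2r.
by apply: lerXn2r.
Qed.

Section multiscale.
Variable w : R -> R.
Hypotheses (hw : is_weight w) (msg : MSG P k M A w).
Local Notation D := (`[0%R, +oo[%classic : set R).

Let w0 l : D l -> (0 <= w l)%R.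
Proof. by rewrite /= in_itv/= andbT; exact: hw.1. Qed.

Let mw : measurable_fun D w.
Proof. by case: hw => _ /integrableP[/measurable_EFinP]. Qed.

Let l0 (l : R) : D l -> (0 <= l)%R.
Proof. by rewrite /= in_itv/= andbT. Qed.

(** The cap [m] records that a ball larger than the cube meets no more than the cube. It keeps the
    moment finite for a weight that is merely integrable. *)
Definition capped_moment (m : R) : \bar R :=
  \int[lebesgue_measure]_(l in D) (Num.min (l + 1) m ^+ n * w l)%:E.

Lemma MSG_cov_cube (L : R) : (0 < L)%R ->
  \int[leb]_(x in cube L) (C x)%:E <= (kappa ^+ 2 * 8 ^+ n)%:E * capped_moment (2 * L).
Proof.
move=> L0; have L20 : (0 < 2 * L)%R by rewrite mulr_gt0.
have tE : leb (cube (2 * L)) <= ((2 * (2 * L)) ^+ n)%:E.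
  by rewrite lebesgue_cube// ltW.
rewrite -(@lee_pmul2l _ ((2 * L) ^+ n)%:E)//; last by rewrite lte_fin exprn_gt0.
apply: (le_trans (integral_cov_cube_le_variance (ltW L0))).
apply: (variance_avg_le (measurable_cube _) tE) => X dX aX sX.
apply: (le_trans (msg aX)); rewrite muleA -EFinM.
have cst0 : (0 <= (2 * L) ^+ n * (kappa ^+ 2 * 8 ^+ n))%R.
  by rewrite mulr_ge0 ?exprn_ge0 ?(ltW L20)// mulr_ge0 ?sqr_ge0// exprn_ge0.
rewrite /capped_moment -ge0_integralZl//; last 2 first.
- apply/measurable_EFinP/measurable_funM => //; apply: measurable_funX.
  by apply: measurable_funTS; apply: measurable_minr => //; exact: measurable_funD.
- move=> l Dl; rewrite lee_fin mulr_ge0 ?w0// exprn_ge0// le_min (ltW L20) andbT.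
  by rewrite addr_ge0// l0.
apply: ge0_le_integral_nonmeasurable => l Dl.
  rewrite mule_ge0//.
    by apply: integral_ge0 => x _; apply: integral_ge0 => ? _; rewrite sqre_ge0.
  by rewrite lee_fin mulr_ge0 ?w0// invr_ge0 exprn_ge0// addr_ge0// l0.
have l10 : (0 < l + 1)%R by rewrite ltr_wpDl// l0.
rewrite (le_trans (lee_wpmul2r _ (sX _ (ltW l10))))//.
  by rewrite lee_fin mulr_ge0 ?w0// invr_ge0 exprn_ge0// ltW.
rewrite -!EFinM lee_fin.
(* Origin of 8^n: one factor 2^n from this minimum, one from [(2 * (l + 1))^n], one from the ratio
   of the two cubes. The power [(l + 1)^n] cancels against the weight. *)
have -> : (Num.min ((2 * (l + 1)) ^+ n) ((2 * (2 * L)) ^+ n) =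
    2 ^+ n * Num.min (l + 1) (2 * L) ^+ n)%R.
  rewrite -exprMn minr_pMr// min_exprn// ?mulr_ge0// ltW//.
set m := (Num.min _ _ ^+ n)%R; rewrite !exprMn.
have -> : (8 = 2 * 2 * 2 :> R)%R by rewrite -!natrM.
rewrite !exprMn le_eqVlt; apply/orP; left; apply/eqP; field.
by rewrite expf_neq0// gt_eqF.
Qed.

Lemma capped_moment_le (m : R) : (0 <= m)%R ->
  capped_moment m <= \int[lebesgue_measure]_(l in D) ((l + 1) ^+ n * w l)%:E.
Proof.
move=> m0; apply: ge0_le_integral_nonmeasurable => l Dl.
  rewrite lee_fin mulr_ge0 ?w0// exprn_ge0// le_min m0 andbT.
  by rewrite addr_ge0// l0.
rewrite lee_fin ler_wpM2r ?w0//; apply: lerXn2r; rewrite ?nnegrE.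
- by rewrite le_min m0 andbT addr_ge0// l0.
- by rewrite addr_ge0// l0.
- by rewrite ge_min lexx.
Qed.

Lemma MSG_cov_integrable :
  \int[lebesgue_measure]_(l in D) (l ^+ n * w l)%:E < +oo ->
  leb.-integrable setT (autocovariance P A).
Proof.
move=> woo.
pose H := \int[lebesgue_measure]_(l in D) ((l + 1) ^+ n * w l)%:E.
have H0 : 0 <= H.
  apply: integral_ge0 => l Dl.
  by rewrite lee_fin mulr_ge0 ?w0// exprn_ge0// addr_ge0// l0.
have wE : \int[lebesgue_measure]_(l in D) (w l)%:E < +oo.
  have /integrableP[_] := hw.2; apply: le_lt_trans.
  rewrite le_eqVlt; apply/orP; left; apply/eqP; apply: eq_integral => l.
  by rewrite inE => Dl; rewrite /= ger0_norm ?w0.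
have mlw : measurable_fun D (fun l => (l ^+ n * w l)%:E).
  by apply/measurable_EFinP/measurable_funM => //; exact: measurable_funX.
have mw' : measurable_fun D (fun l => (w l)%:E) by exact/measurable_EFinP.
(* The hypothesis concerns [l^n] while the bound has [(l + 1)^n], which is at most [2^n (1 + l^n)];
   integrability of [w] handles the term 1. *)
have Hoo : H < +oo.
  apply: (@le_lt_trans _ _ (\int[lebesgue_measure]_(l in D)
      ((2 ^+ n)%:E * ((w l)%:E + (l ^+ n * w l)%:E)))); last first.
    rewrite ge0_integralZl; last 4 first.
    - by [].
    - exact: (emeasurable_funD mw' mlw).
    - by move=> l Dl; rewrite -EFinD lee_fin addr_ge0 ?mulr_ge0 ?w0// exprn_ge0// l0.
    - by rewrite lee_fin exprn_ge0.
    rewrite ge0_integralD//; last first.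
      by move=> l Dl; rewrite lee_fin mulr_ge0 ?w0// exprn_ge0// l0.
    by rewrite lte_mul_pinfty ?lee_fin ?exprn_ge0// lte_add_pinfty.
  apply: ge0_le_integral_nonmeasurable => l Dl.
    by rewrite lee_fin mulr_ge0 ?w0// exprn_ge0// addr_ge0// l0.
  rewrite -EFinD -EFinM lee_fin -[X in (_ <= _ * (X + _))%R]mul1r -mulrDl mulrA.
  rewrite ler_wpM2r ?w0//; have {}Dl := l0 Dl.
  have [l1|l1] := leP l 1%R.
    apply: (@le_trans _ _ (2 ^+ n)%R).
      apply: lerXn2r; rewrite ?nnegrE; lra.
    by rewrite ler_peMr ?exprn_ge0// lerDl exprn_ge0.
  apply: (@le_trans _ _ ((2 * l) ^+ n)%R).
    apply: lerXn2r; rewrite ?nnegrE; lra.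
  by rewrite exprMn ler_wpM2l ?exprn_ge0// lerDr.
apply: (@integrable_cov (kappa ^+ 2 * 8 ^+ n * fine H)) => N.
apply: (@le_trans _ _ (\int[leb]_(x in cube N.+1%:R) (C x)%:E)).
  apply: ge0_subset_integral; [exact: measurable_cube|exact: measurable_cube|exact: measurable_funTS mC| |].
    by move=> x _; rewrite lee_fin.
  by apply: subset_cube; rewrite ler_nat.
apply: (le_trans (MSG_cov_cube _)); first by rewrite ltr0n.
rewrite [leRHS]EFinM fineK ?ge0_fin_numE//; apply: lee_wpmul2l.
  by rewrite lee_fin mulr_ge0 ?sqr_ge0// exprn_ge0.
by apply: capped_moment_le; rewrite mulr_ge0.
Qed.

(** For [a = 0] the ratio [q] is 1 and the dyadic sum has no geometric decay, so this case is
    treated directly by exhausting the space with cubes. *)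
Lemma MSG_cov_weighted0 : (0 < n)%N ->
  \int[leb]_x ((1 + enorm x) `^ (- 0) * C x)%:E <=
  (kappa ^+ 2 * 8 ^+ n)%:E * weight_bound n 0 w.
Proof.
move=> n0; rewrite oppr0; under eq_integral do rewrite powRr0 mul1r.
apply: (@ge0_integral_exhaustion_le _ _ _ _ (fun N => cube N.+1%:R)) => //.
- by move=> i j ij; apply/subsetPset/subset_cube; rewrite ler_nat ltnS.
- by move=> i; exact: measurable_cube.
- apply/seteqP; split => // x _.
  exists (Num.truncn (enorm x)) => // i; apply: le_trans (coord_le_enorm x i) _.
  exact/ltW/truncnS_gt.
move=> N; apply: (le_trans (MSG_cov_cube _)); first by rewrite ltr0n.
apply: lee_wpmul2l; first by rewrite lee_fin mulr_ge0 ?sqr_ge0// exprn_ge0.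
apply: (le_trans (capped_moment_le _)); first by rewrite mulr_ge0.
rewrite weight_boundE; apply: ge0_le_integral_nonmeasurable => l Dl.
  by rewrite lee_fin mulr_ge0 ?w0// exprn_ge0// addr_ge0// l0.
by rewrite /weight_kernel ltr0n n0 subr0 powR_mulrn// addr_ge0// l0.
Qed.

Lemma MSG_cov_weighted (a c : R) : (0 <= a)%R -> (0 < c)%R ->
  (forall N l, (0 <= l)%R ->
    (truncated_sum (2 `^ (- a)) n N (l + 1) <= c * weight_kernel n a l)%R) ->
  \int[leb]_x ((1 + enorm x) `^ (- a) * C x)%:E <=
  (kappa ^+ 2 * 32 ^+ n * c)%:E * weight_bound n a w.
Proof.
move=> a0 c0 truncated_sum_c; set cst := (kappa ^+ 2 * 32 ^+ n)%R.
have cst0 : (0 <= cst)%R by rewrite mulr_ge0 ?sqr_ge0// exprn_ge0.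
rewrite weight_boundE EFinM -muleA.
set B := _ * \int[_]_(_ in _) _.
have mf : measurable_fun setT (fun x => ((1 + enorm x) `^ (- a) * C x)%:E).
  apply/measurable_EFinP/measurable_funM; last exact: (measurable_cov mA sA A2).
  apply: (measurableT_comp (measurable_powR (- a))).
  exact: measurable_funD (measurable_cst _) (@measurable_enorm R n).
have f0 x : 0 <= ((1 + enorm x) `^ (- a) * C x)%:E.
  by rewrite lee_fin mulr_ge0// powR_ge0.
pose q := (2 `^ (- a) : R)%R.
have q0 : (0 <= q)%R by exact: powR_ge0.
(* On this ball [1 + |x| < 2^N], so the [N] dyadic shells [2^i <= 1 + |x| < 2^(i + 1)] cover it. On
   the shell [i] the weight is at most [q^i], and [x] lies in [cube (2^(i + 1))]. *)
apply: (@ge0_integral_exhaustion_le _ _ _ _ (fun N => eball 0 (2 ^+ N - 1))) => //.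
- move=> i j ij; apply/subsetPset => x; rewrite /eball/= => /lt_le_trans; apply.
  by rewrite lerD2r ler_weXn2l// ler1n.
- by move=> N; exact: measurable_eball.
- apply/seteqP; split => // x _.
  exists (Num.truncn (1 + enorm x)).+1 => //; rewrite /eball/= subr0.
  rewrite ltrBrDl; apply: (lt_trans (truncnS_gt _)).
  by rewrite -natrX ltr_nat ltn_expl.
move=> N; set E := eball _ _.
apply: (@le_trans _ _ (\int[leb]_x \sum_(i < N) ((q ^+ i)%:E * (\1_(cube (2 ^+ i.+1)) x * C x)%:E))).
  rewrite integral_mkcond; apply: ge0_le_integral_nonmeasurable => x _; rewrite patchE.
    by case: ifP.
  have sum0 (i : 'I_N) : true -> 0 <= (q ^+ i)%:E * (\1_(cube (2 ^+ i.+1)) x * C x)%:E.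
    by move=> _; rewrite -EFinM lee_fin mulr_ge0 ?exprn_ge0// mulr_ge0.
  case: ifPn => [|_]; last exact: sume_ge0.
  rewrite inE /E /eball/= subr0 ltrBrDl => xN.
  have [i iN /andP[ix xi]] : exists2 i, (i < N)%N & (2 ^+ i <= 1 + enorm x < 2 ^+ i.+1)%R.
    by apply: dyadic_bracket => //; rewrite lerDl enorm_ge0.
  rewrite (bigD1 (Ordinal iN))//=; apply: (@le_trans _ _ ((q ^+ i)%:E * (\1_(cube (2 ^+ i.+1)) x * C x)%:E)); last first.
    by apply: leeDl; apply: sume_ge0 => j _; exact: sum0.
  rewrite -EFinM lee_fin indicE mem_set; last first.
    move=> j; apply: le_trans (coord_le_enorm x j) _; apply/ltW/(lt_trans _ xi).
    by rewrite ltrDr.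
  rewrite mul1r ler_wpM2r// /q -powR_mulrn ?powR_ge0// -powRrM mulrC powRrM powRN powRN.
  rewrite powR_mulrn// lef_pV2 ?posrE ?powR_gt0 ?exprn_gt0//; last first.
    by rewrite ltr_wpDr ?enorm_ge0.
  by rewrite ge0_ler_powR// ?nnegrE ?exprn_ge0// addr_ge0// enorm_ge0.
rewrite ge0_integral_sum//; last 2 first.
- move=> i; apply: measurable_funeM; apply/measurable_EFinP/measurable_funM.
    by apply: measurable_indic; exact: measurable_cube.
  exact: (measurable_cov mA sA A2).
- by move=> i x _; rewrite -EFinM lee_fin mulr_ge0 ?exprn_ge0// mulr_ge0.
apply: (@le_trans _ _ (\sum_(i < N) (cst%:E * \int[lebesgue_measure]_(l in D)
    (q ^+ i * Num.min (l + 1) (2 ^+ i) ^+ n * w l)%:E))).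
  apply: lee_sum => i _.
  rewrite ge0_integralZl//; last 3 first.
  - apply/measurable_EFinP/measurable_funM.
      by apply: measurable_indic; exact: measurable_cube.
    exact: (measurable_cov mA sA A2).
  - by move=> x _; rewrite lee_fin mulr_ge0.
  - by rewrite lee_fin exprn_ge0.
  have -> : \int[leb]_x (\1_(cube (2 ^+ i.+1)) x * C x)%:E =
      \int[leb]_(x in cube (2 ^+ i.+1)) (C x)%:E.
    rewrite [RHS]integral_mkcond; apply: eq_integral => x _.
    by rewrite patchE indicE; case: ifP => _; rewrite ?mul1r ?mul0r.
  have qi0 : 0 <= (q ^+ i)%:E by rewrite lee_fin exprn_ge0.
  apply: (le_trans (lee_wpmul2l qi0 (MSG_cov_cube _))); first by rewrite exprn_gt0.
  have mmin m : measurable_fun D (fun l => (Num.min (l + 1) m ^+ n * w l)%:E).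
    apply/measurable_EFinP/measurable_funM => //; apply: measurable_funX.
    by apply: measurable_funTS; apply: measurable_minr => //; exact: measurable_funD.
  have min0 m l : (0 <= m)%R -> D l -> 0 <= (Num.min (l + 1) m ^+ n * w l)%:E.
    move=> m0 Dl; rewrite lee_fin mulr_ge0 ?w0// exprn_ge0// le_min m0 andbT.
    by rewrite addr_ge0// l0.
  under [in leRHS]eq_integral do rewrite -mulrA EFinM.
  rewrite [in leRHS]ge0_integralZl//; last 2 first.
  - exact: mmin.
  - by move=> l; apply: min0; rewrite exprn_ge0.
  (* The cap for [cube (2^(i + 1))] is [2^(i + 2)]. Lowering it to [2^i] costs a factor 4 inside the
     power, hence [32 = 8 x 4]. *)
  rewrite [leRHS]muleCA lee_wpmul2l// /cst (_ : 32 ^+ n = 8 ^+ n * 4 ^+ n)%R; last first.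
    by rewrite -exprMn -natrM.
  rewrite mulrA [in leRHS]EFinM -[leRHS]muleA lee_wpmul2l//.
    by rewrite lee_fin mulr_ge0 ?sqr_ge0// exprn_ge0.
  rewrite -ge0_integralZl//; last 2 first.
  - exact: mmin.
  - by move=> l; apply: min0; rewrite exprn_ge0.
  apply: ge0_le_integral_nonmeasurable => l Dl.
    by apply: min0 => //; rewrite mulr_ge0// exprn_ge0.
  rewrite -EFinM lee_fin mulrA ler_wpM2r ?w0// -exprMn.
  have l1 : (0 <= l + 1)%R by rewrite addr_ge0// l0.
  have t0 : (0 <= (2 : R) ^+ i)%R by rewrite exprn_ge0.
  apply: lerXn2r; rewrite ?nnegrE.
  - by rewrite le_min l1 mulr_ge0// exprn_ge0.
  - by rewrite mulr_ge0// le_min l1.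
  rewrite minr_pMr// le_min !ge_min; apply/andP; split.
    by apply/orP; left; lra.
  by apply/orP; right; rewrite exprS; lra.
rewrite -ge0_sume_distrr; last first.
  move=> i _; apply: integral_ge0 => l Dl; rewrite lee_fin mulr_ge0 ?w0//.
  rewrite mulr_ge0 ?exprn_ge0// le_min exprn_ge0// andbT.
  by rewrite addr_ge0// l0.
rewrite /B; apply: lee_wpmul2l; first by rewrite lee_fin.
rewrite -ge0_integral_sum//; last 2 first.
- move=> i; apply/measurable_EFinP/measurable_funM => //; apply: measurable_funM => //.
  apply: measurable_funX.
  by apply: measurable_funTS; apply: measurable_minr => //; exact: measurable_funD.
- move=> i l Dl; rewrite lee_fin mulr_ge0 ?w0//.
  rewrite mulr_ge0 ?exprn_ge0// le_min exprn_ge0// andbT.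
  by rewrite addr_ge0// l0.
rewrite -ge0_integralZl//; last 3 first.
- apply/measurable_EFinP/measurable_funM => //.
  exact: measurable_funTS (measurable_weight_kernel n a).
- by move=> l Dl; rewrite lee_fin mulr_ge0 ?w0// weight_kernel_ge0// l0.
- by rewrite lee_fin ltW.
apply: ge0_le_integral_nonmeasurable => l Dl.
  apply: sume_ge0 => i _; rewrite lee_fin mulr_ge0 ?w0//.
  rewrite mulr_ge0 ?exprn_ge0// le_min exprn_ge0// andbT.
  by rewrite addr_ge0// l0.
rewrite sumEFin -mulr_suml -EFinM lee_fin mulrA ler_wpM2r ?w0//.
by apply: truncated_sum_c; exact: l0.
Qed.

End multiscale.

End integrability.

(** * Decay of the covariance function *)

Lemma poweR_half_le (R : realType) (x : \bar R) (b : R) : (0 <= x)%E -> 0 <= b ->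
  (x <= (b ^+ 2)%:E)%E -> (x `^ 2^-1 <= b%:E)%E.
Proof.
move=> x0 b0 xb; rewrite poweR12_sqrt//.
have -> : (b%:E = sqrte (b ^+ 2)%:E :> \bar R)%E by rewrite /= sqrtr_sqr ger0_norm.
by rewrite lee_sqrt// lee_fin sqr_ge0.
Qed.

Lemma integral_near_cst d (T : measurableType d) (R : realType)
    (mu : {measure set T -> \bar R}) (D : set T) (f : T -> R) (v c e : R) :
  measurable D -> mu D = v%:E -> measurable_fun D f ->
  (forall x, D x -> `|f x - c| <= e) ->
  exists2 J : R, (\int[mu]_(x in D) (f x)%:E = J%:E)%E & `|J - c * v| <= e * v.
Proof.
move=> mD Dv mf fc; have Doo : (mu D < +oo)%E by rewrite Dv ltry.
have bint (g : T -> R) b : measurable_fun D g -> (forall x, D x -> `|g x| <= b) ->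
    mu.-integrable D (EFin \o g).
  move=> mg gb; apply: measurable_bounded_integrable => //.
  by exists b; split; [exact: num_real|move=> z bz x Dx; exact: le_trans (gb x Dx) (ltW bz)].
have intf : mu.-integrable D (EFin \o f).
  apply: (bint f (`|c| + e)) => // x Dx.
  by rewrite -[f x](subrK c) (le_trans (ler_normD _ _))// addrC lerD2l fc.
have intg : mu.-integrable D (EFin \o (fun x => f x - c)).
  by apply: (bint _ e) => //; apply: measurable_funB.
have intc : mu.-integrable D (EFin \o (fun=> c)) by apply: (bint _ `|c|).
have ffin := integrable_fin_num mD intf.
exists (fine (\int[mu]_(x in D) (f x)%:E)); first by rewrite fineK.
rewrite -lee_fin [leRHS]EFinM -Dv -(integral_cst mu mD e%:E).
have -> : (`|fine (\int[mu]_(x in D) (f x)%:E) - c * v|%:E =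
    `|\int[mu]_(x in D) (f x - c)%:E|)%E.
  transitivity (`|(\int[mu]_(x in D) (f x)%:E - \int[mu]_(x in D) (c)%:E)|)%E.
    by rewrite (integral_cst mu mD c%:E) Dv -(fineK ffin).
  by rewrite -integralB.
apply: (le_trans (le_abse_integral mu mD (measurable_int _ intg))).
apply: ge0_le_integral => //.
- exact: measurableT_comp (measurable_int _ intg).
Qed.

Section covariance_of_squares.
Context d (T : measurableType d) (R : realType) (P : probability T R).
Implicit Types X Y : T -> R.

Lemma covarianceZr2 (s : R) X Y : X \in Lfun P 2%:E -> Y \in Lfun P 2%:E ->
  covariance P X (fun w => s * Y w) = (s%:E * covariance P X Y)%E.
Proof.
move=> X2 Y2.
have L1 Z : Z \in Lfun P 2%:E -> Z \in Lfun P 1.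
  by move=> /Lfun2_integrable /Lfun1_integrable.
have LXY : (X * Y)%R \in Lfun P 1.
  apply/Lfun1_integrable; rewrite (_ : EFin \o _ = fun w => (X w * Y w)%:E)//.
  exact: Lfun2_integrableM.
rewrite -(covarianceZr s (L1 _ X2) (L1 _ Y2) LXY).
by congr covariance; apply/funext => w /=; rewrite mulrC.
Qed.

End covariance_of_squares.

Section covariance_decay.
Context (R : realType) (n : nat) (dO : measure_display)
  (Omega : measurableType dO) (P : probability Omega R).
Local Notation Rd := 'rV[R]_n.
Local Notation leb := (lebesgue_rV R n).
Local Open Scope ereal_scope.
Variables (A : Rd -> Omega -> R).
Hypotheses (mA : jointly_measurable A) (sA : stationary P A).
Hypothesis A2 : 'E_P[(fun w => `|A 0%R w| ^+ 2)%R] < +oo.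

Local Notation C := (cov P A).

(** [C y - C x] is the expectation of [cfield 0] times [A y - A x]. Splitting the product with a
    parameter [t] bounds it by [t^2] times the variance plus [t^-2] times the squared L^2 increment
    of the field. *)
Lemma cov_uniformly_continuous (e : R) : (0 < e)%R -> exists2 r : R, (0 < r)%R &
  forall x y : Rd, cube r (y - x)%R -> (`|C y - C x| <= e)%R.
Proof.
move=> e0; have [S hS] := cfield_L2_bound mA sA A2.
have S0 : (0 <= S)%R.
  by rewrite -lee_fin (le_trans _ (hS 0%R))// integral_ge0// => w _; rewrite lee_fin sqr_ge0.
(* Then [t <= 1], hence [t^2 <= t] and [t^2 S <= e / 2]; the radius is taken afterwards, so that the
   increment contributes at most [e / 2]. *)
pose t := (e / (2 * (S + 1) + e))%R.
have den0 : (0 < 2 * (S + 1) + e)%R by lra.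
have t0 : (0 < t)%R by rewrite divr_gt0.
have tS : (t ^+ 2 * S <= e / 2)%R.
  have t1 : (t <= 1)%R by rewrite ler_pdivrMr// mul1r; lra.
  have tt : (t ^+ 2 <= t)%R by rewrite expr2 ler_piMr// ltW.
  have tS2 : (t * (2 * S) <= e)%R.
    rewrite /t mulrAC ler_pdivrMr// ler_wpM2l ?(ltW e0)//; lra.
  have : (t ^+ 2 * S <= t * S)%R by rewrite ler_wpM2r.
  lra.
have et0 : (0 < e / 2 * t ^+ 2)%R by rewrite mulr_gt0 ?divr_gt0// exprn_gt0.
have [r r0 hr] := field_L2_continuous mA sA A2 et0.
exists r => // x y xy.
have m0 := measurable_cfield1 mA sA A2.
have L2 := Lfun2_cfield mA sA A2.
have E1 : (C y - C x)%:E = \int[P]_w (cfield P A 0%R w * (A y w - A x w))%:E.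
  rewrite EFinB -!(covE mA sA A2) -{1}(subr0 y) -{1}(subr0 x) !(autocovarianceE mA sA A2).
  rewrite -integralB//; last 2 first.
  - exact: Lfun2_integrableM.
  - exact: Lfun2_integrableM.
  apply: eq_integral => w _; rewrite -EFinB -mulrBr; congr ((_ * _)%:E).
  by rewrite /cfield; ring.
have mAx z : measurable_fun setT (A z) by exact: measurable_field.
rewrite -lee_fin -[X in X <= _]/(`|(C y - C x)%:E|) E1.
apply: le_trans (le_abse_integral P measurableT _) _.
  by apply/measurable_EFinP/measurable_funM => //; exact: measurable_funB.
apply: (@le_trans _ _ (\int[P]_w `|(t * cfield P A 0%R w) * (t^-1 * (A y w - A x w))|%:E)).
  rewrite le_eqVlt; apply/orP; left; apply/eqP; apply: eq_integral => w _ /=.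
  by congr (`|_|%:E); rewrite mulrACA mulfV ?gt_eqF// mul1r.
have mB : measurable_fun setT (fun w => A y w - A x w)%R by exact: measurable_funB.
apply: le_trans (integral_normM_le P (measurable_funM _ (m0 0%R)) (measurable_funM _ mB)) _ => //.
under eq_integral do rewrite exprMn EFinM.
rewrite ge0_integralZl//; last 3 first.
- exact/measurable_EFinP/measurable_funX.
- by move=> w _; rewrite lee_fin sqr_ge0.
- by rewrite lee_fin sqr_ge0.
under [X in _ + X]eq_integral do rewrite exprMn EFinM.
rewrite ge0_integralZl//; last 3 first.
- exact/measurable_EFinP/measurable_funX.
- by move=> w _; rewrite lee_fin sqr_ge0.
- by rewrite lee_fin sqr_ge0.
have -> : e%:E = (e / 2)%:E + (t^-1 ^+ 2 * (e / 2 * t ^+ 2))%:E.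
  by rewrite -EFinD; congr EFin; field; rewrite gt_eqF.
apply: leeD.
  rewrite (le_trans (lee_wpmul2l _ (hS 0%R))) ?lee_fin ?sqr_ge0//.
rewrite [leRHS]EFinM lee_wpmul2l ?lee_fin ?sqr_ge0//; apply: le_trans (hr _ xy).
rewrite -(stationary_integral2 mA sA (y - x)%R 0%R x (psi := fun p => (p.1 - p.2) ^+ 2)%R).
  by rewrite subrK add0r.
by apply: measurable_funX; exact: measurable_funB.
Qed.

Variables (k : derivative_kind) (M : set (Rd -> R)) (K : R).
Hypothesis bA : k = osc -> bounded_field P A K.
Hypothesis MA : k = fct -> open_Linfty M /\ forall w, M (A ^~ w).
Local Notation kappa := (osc_const K).

Variable w : R -> R.
Hypotheses (hw : is_weight w) (mci : MCI P k M A w).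
Local Notation D := (`[0%R, +oo[%classic : set R).

Let w0 l : D l -> (0 <= w l)%R.
Proof. by rewrite /= in_itv/= andbT; exact: hw.1. Qed.

Let mw : measurable_fun D w.
Proof. by case: hw => _ /integrableP[/measurable_EFinP]. Qed.

Let l0 (l : R) : D l -> (0 <= l)%R.
Proof. by rewrite /= in_itv/= andbT. Qed.

(* No ball of radius [l + 1] meets both cubes unless [l] is at least about
   [(|x| - 2) / 2]. *)
Lemma MCI_near_cov (x : Rd) (s dl e : R) : `|s|%R = 1%R -> (0 < dl)%R ->
  (forall y, cube (2 * dl)%R (y - x)%R -> (`|C y - C x| <= e)%R) ->
  (s * C x - e)%:E <= (kappa ^+ 2 * 2 ^+ n)%:E *
    \int[lebesgue_measure]_(l in D)
      ((w l)%:E * (\1_[set l : R | (2^-1 * (enorm x - 2) - n%:R * dl < l)%R] l)%:E).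
Proof.
move=> s1 dl0 Cx.
pose T : set Rd := cube dl; pose S := cell dl x.
have mT : measurable T by exact: measurable_cube.
have mS : measurable S by exact: measurable_cell.
pose v : R := ((2 * dl) ^+ n)%R.
have v0 : (0 < v)%R by rewrite exprn_gt0// mulr_gt0.
have Tv : leb T = v%:E by rewrite lebesgue_cube// ltW.
have Sv : leb S = v%:E by rewrite lebesgue_cell// ltW.
have Too : leb T < +oo by rewrite Tv ltry.
have Soo : leb S < +oo by rewrite Sv ltry.
have [|X [dX [aX XE sX]]] := avg_admissible (s := 1%R) mA sA A2 mT Too _ bA MA.
  by rewrite normr1.
have [|Y [dY [aY YE sY]]] := avg_admissible (s := s) mA sA A2 mS Soo _ bA MA.
  by rewrite s1.
have mX : measurable_fun setT X by case: aX => _ /Lfun2_measurable.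
have mY : measurable_fun setT Y by case: aY => _ /Lfun2_measurable.
have LT := Lfun2_avg mA sA A2 mT Too; have LS := Lfun2_avg mA sA A2 mS Soo.
have mIT := Lfun2_measurable LT; have mIS := Lfun2_measurable LS.
have XI : {ae P, forall w, X w = pint leb T A w}.
  by apply: filterS XE => w' ->; rewrite mul1r.
have := mci aX aY.
rewrite (covariance_ae_eq mX mIT mY (measurable_funM (measurable_cst s) mIS) XI YE).
rewrite (covarianceZr2 s LT LS) (covariance_avg mA sA A2 mT Too mS Soo).
have mCB := measurable_covB mA sA A2.
have inner y : T y -> exists2 J : R, \int[leb]_(z in S) (C (z - y)%R)%:E = J%:E &
    (`|J - C x * v| <= e * v)%R.
  move=> Ty; apply: (@integral_near_cst _ _ _ leb S (fun z => C (z - y)%R)) => //.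
    apply: measurable_funTS; apply: (measurableT_comp (measurable_cov mA sA A2)).
    exact: measurable_rV_addr.
  move=> z Sz; apply: Cx; rewrite (_ : _ - _ - _ = (z - x) + (- y))%R; last by rewrite addrAC.
  by rewrite mulr_natl mulr2n; apply: cube_addr => //; exact: cubeN.
pose J y := fine (\int[leb]_(z in S) (C (z - y)%R)%:E).
have JE y : T y -> \int[leb]_(z in S) (C (z - y)%R)%:E = (J y)%:E.
  by move=> Ty; rewrite /J; have [j -> _] := inner y Ty.
rewrite (eq_integral (fun y => (J y)%:E)); last first.
  by move=> y; rewrite inE => Ty; rewrite JE.
have mJ : measurable_fun T J.
  apply: measurable_funTS; apply: measurableT_comp => //.
  apply: (@measurable_integral1_in _ _ _ _ _ leb S (fun p : Rd * Rd => (C (p.1 - p.2))%:E) mS).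
  by apply/measurable_EFinP; exact: (measurableT_comp mCB (@measurable_swap _ _ Rd Rd)).
(* The explicit proof term transports the bound on the witness given by [inner y] to [J y], which
   equals it. *)
have [q -> qE] := @integral_near_cst _ _ _ leb T J v (C x * v) (e * v) mT Tv mJ
  (fun y Ty => let: ex_intro2 j jE jv := inner y Ty in
    eq_rect j (fun u => `|u - C x * v| <= e * v)%R jv (J y) (esym (congr1 fine jE))).
move=> H.
(* The averages are not normalized: their covariance is close to [v^2 C x]. *)
rewrite -(@lee_pmul2l _ (v ^+ 2)%:E)//; last by rewrite lte_fin exprn_gt0.
apply: (@le_trans _ _ (s%:E * q%:E)).
  rewrite -!EFinM lee_fin.
  have : (`|s * q - s * (C x * v * v)| <= e * v * v)%R.
    by rewrite -mulrBr normrM s1 mul1r.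
  rewrite ler_norml => /andP[h _].
  have -> : (v ^+ 2 * (s * C x - e) = s * (C x * v * v) - e * v * v)%R by ring.
  lra.
apply: (le_trans H); rewrite muleA -EFinM.
have m1 : measurable_fun D (fun l : R =>
    (w l)%:E * (\1_[set l : R | (2^-1 * (enorm x - 2) - n%:R * dl < l)%R] l)%:E).
  apply: emeasurable_funM; first exact/measurable_EFinP.
  apply/measurable_EFinP/measurable_indic.
  rewrite (_ : [set _ | _] = `](2^-1 * (enorm x - 2) - n%:R * dl)%R, +oo[%classic)//.
  by apply/seteqP; split => l /=; rewrite in_itv/= andbT.
rewrite -ge0_integralZl//; last 2 first.
- by move=> l Dl; rewrite mule_ge0// lee_fin w0.
- by rewrite lee_fin mulr_ge0 ?sqr_ge0// mulr_ge0 ?sqr_ge0// exprn_ge0.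
apply: ge0_le_integral_nonmeasurable => l Dl.
  rewrite mule_ge0//.
    by apply: integral_ge0 => z _; rewrite mule_ge0// poweR_ge0.
  by rewrite lee_fin mulr_ge0 ?w0// invr_ge0 exprn_ge0// addr_ge0// l0.
have l10 : (0 < l + 1)%R by rewrite ltr_wpDl// l0.
have K0 : (0 <= kappa)%R by rewrite /osc_const addr_ge0// mulr_ge0.
have fT z := leb_ballI_fin z (l + 1)%R mT Too.
have fS z := leb_ballI_fin z (l + 1)%R mS Soo.
have sqm0 (dZ : set Rd -> Omega -> \bar R) E : 0 <= sq_mean P dZ E.
  by apply: integral_ge0 => ? _; rewrite sqre_ge0.
have prod_le z : sq_mean P dX (eball z (l + 1)) `^ 2^-1 *
    sq_mean P dY (eball z (l + 1)) `^ 2^-1 <=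
    (kappa ^+ 2)%:E * (leb (eball z (l + 1) `&` T) * leb (eball z (l + 1) `&` S)).
  rewrite -(fineK (fT z)) -(fineK (fS z)) -!EFinM expr2 mulrACA EFinM.
  apply: lee_pmul; rewrite ?poweR_ge0//; apply: poweR_half_le => //.
    by rewrite mulr_ge0// fine_ge0.
  by rewrite mulr_ge0// fine_ge0.
(* A ball of radius [l + 1] meeting both cubes gives [|x| < 2 (l + 1) + 2 n dl], that is [al]. If
   [al] fails, one of the two intersections is empty at every centre [z]. *)
rewrite indicE; have [al|al] := pselect (2^-1 * (enorm x - 2) - n%:R * dl < l)%R; last first.
  rewrite memNset// mule0 mule0 integral0_eq ?mul0e// => z _.
  apply/eqP; rewrite eq_le mule_ge0 ?poweR_ge0// andbT; apply: (le_trans (prod_le z)).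
  have [[y [zy Ty]]|NT] := pselect (eball z (l + 1) `&` T !=set0); last first.
    by rewrite (_ : _ `&` T = set0) ?measure0 ?mul0e ?mule0//; exact/nonemptyPn.
  have [[y' [zy' Sy']]|NS] := pselect (eball z (l + 1) `&` S !=set0); last first.
    by rewrite (_ : _ `&` S = set0) ?measure0 ?mule0//; exact/nonemptyPn.
  exfalso; apply: al.
  have y1 := enorm_cube Ty; have y2 := enorm_cube Sy'.
  have h : (enorm x <= enorm (x - y') + enorm (y' - z) + (enorm (z - y) + enorm y))%R.
    apply: (le_trans _ (lerD (enormD _ _) (enormD _ _))).
    by apply: (le_trans _ (enormD _ _)); rewrite subrK subrKA subrK.
  move: zy zy'; rewrite /eball/= => zy zy'.
  rewrite (enormB x) (enormB z) in h; lra.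
rewrite mem_set// mule1.
have kv0 : (0 <= kappa ^+ 2 * v)%R by rewrite mulr_ge0 ?sqr_ge0// ltW.
apply: (@le_trans _ _ ((kappa ^+ 2 * v * ((2 * (l + 1)) ^+ n * v))%:E *
    ((l + 1) ^- n * w l)%:E)); last first.
  rewrite -!EFinM lee_fin le_eqVlt; apply/orP; left; apply/eqP.
  by rewrite exprMn; field; rewrite expf_neq0// gt_eqF.
apply: lee_wpmul2r.
  by rewrite lee_fin mulr_ge0 ?w0// invr_ge0 exprn_ge0// ltW.
(* The overlap with [S] is bounded by its volume [v] and the overlap with [T] is integrated, which
   yields [kappa^2 v^2 (2 (l + 1))^n]. *)
apply: (@le_trans _ _ (\int[leb]_z ((kappa ^+ 2 * v)%:E * leb (eball z (l + 1) `&` T)))).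
  apply: ge0_le_integral_nonmeasurable => z _; first by rewrite mule_ge0// poweR_ge0.
  apply: (le_trans (prod_le z)); rewrite [in leRHS]EFinM -muleA lee_wpmul2l ?lee_fin ?sqr_ge0//.
  by rewrite muleC lee_wpmul2r// -Sv leb_ballI_le.
rewrite ge0_integralZl//; last exact: measurable_leb_ballI.
rewrite [leRHS]EFinM lee_wpmul2l ?lee_fin//.
by rewrite (le_trans (integral_leb_ballI mT (ltW l10)))// Tv -EFinM.
Qed.

(** The cubes shrink while the continuity error [e] stays fixed; then [e] tends to 0. Both signs of
    [s] give the absolute value. *)
Lemma MCI_cov (x : Rd) :
  `|autocovariance P A x| <= (kappa ^+ 2 * 2 ^+ n)%:E *
    \int[lebesgue_measure]_(l in `[Num.max (2^-1 * (enorm x - 2))%R 0%R, +oo[) (w l)%:E.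
Proof.
rewrite (covE mA sA A2); set a := (2^-1 * (enorm x - 2))%R.
set c := (kappa ^+ 2 * 2 ^+ n)%R.
have c0 : (0 <= c)%R by rewrite mulr_ge0 ?sqr_ge0// exprn_ge0.
(* The strict thresholds increase to [a], so the indicators decrease to that of the closed half-line
   [a <= l]; [w] dominates them all. *)
pose f (i : nat) (l : R) := (w l)%:E * (\1_[set l : R | (a - i.+1%:R^-1 < l)%R] l)%:E.
have m1 (b : R) : measurable_fun D (fun l : R => (w l)%:E * (\1_[set l : R | (b < l)%R] l)%:E).
  apply: emeasurable_funM; first exact/measurable_EFinP.
  apply/measurable_EFinP/measurable_indic.
  rewrite (_ : [set _ | _] = `]b, +oo[%classic)//.
  by apply/seteqP; split => l /=; rewrite in_itv/= andbT.
pose g (l : R) := (w l)%:E * (\1_[set l : R | (a <= l)%R] l)%:E.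
have fg : \int[lebesgue_measure]_(l in D) f i l @[i --> \oo] --> \int[lebesgue_measure]_(l in D) g l.
  apply: (@dominated_cvg _ _ _ lebesgue_measure D _ f g (EFin \o w)) => //.
  - by move=> i; exact: m1.
  - move=> l Dl; rewrite /f /g; have [al|la] := leP a l.
      rewrite (_ : (fun _ => _) = cst ((w l)%:E * (\1_[set l : R | (a <= l)%R] l)%:E)); first exact: cvg_cst.
      apply/funext => i /=; rewrite !indicE !mem_set//=.
      by apply: lt_le_trans al; rewrite ltrBlDr ltrDl invr_gt0.
    have al : (0 < a - l)%R by rewrite subr_gt0.
    apply: cvg_near_cst; near=> i.
    have N2 : ~ (a <= l)%R by apply/negP; rewrite -ltNge.
    have N1 : ~ (a - i.+1%:R^-1 < l)%R.
      apply/negP; rewrite -leNgt lerBrDr -lerBrDl.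
      by apply/ltW; near: i; exact: (near_infty_natSinv_lt (PosNum al)).
    by rewrite !indicE !memNset.
  - by case: hw.
  - move=> i l Dl; rewrite /f abseM gee0_abs ?lee_fin ?w0// indicE.
    by rewrite /=; case: (_ \in _) => /=; rewrite ?normr1 ?normr0 ?mulr1 ?mulr0// w0.
have gE : \int[lebesgue_measure]_(l in D) g l =
    \int[lebesgue_measure]_(l in `[Num.max a 0%R, +oo[) (w l)%:E.
  rewrite integral_mkcond [RHS]integral_mkcond; apply: eq_integral => l _.
  rewrite !patchE /g !mem_setE !in_itv/= !andbT ge_max indicE.
  rewrite (_ : (l \in [set _ | _]) = (a <= l)%R); last by apply/idP/idP; rewrite inE.
  by case: (a <= l)%R; case: (0 <= l)%R; rewrite ?mule1 ?mule0.
rewrite -gE.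
have W0 : 0 <= \int[lebesgue_measure]_(l in D) g l.
  by apply: integral_ge0 => l Dl; rewrite mule_ge0// lee_fin w0.
have Woo : \int[lebesgue_measure]_(l in D) g l < +oo.
  case: (hw) => _ /integrableP[_]; apply: le_lt_trans.
  apply: ge0_le_integral_nonmeasurable => l Dl; first by rewrite mule_ge0// lee_fin w0.
  rewrite /g /= ger0_norm ?w0// indicE.
  by case: (_ \in _) => /=; rewrite ?mule1 ?mule0// lee_fin w0.
have sgn (s : R) : `|s|%R = 1%R -> (s * C x)%:E <= c%:E * \int[lebesgue_measure]_(l in D) g l.
  move=> s1; apply/lee_addgt0Pr => e e0.
  have [r r0 hr] := cov_uniformly_continuous e0.
  rewrite addeC -leeBlDl// -EFinB.
  have cf : c%:E * \int[lebesgue_measure]_(l in D) f i l @[i --> \oo] -->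
      c%:E * \int[lebesgue_measure]_(l in D) g l by exact: cvgeZl.
  rewrite -(cvg_lim _ cf)//; apply: lime_ge; first by apply/cvg_ex; eexists; exact: cf.
  apply: nearW => i.
  (* The first bound keeps [cube (2 * dl)] within the continuity radius, the second moves the
     threshold by at most [1 / (i + 1)]. The divisor [n.+1] is nonzero in every dimension. *)
  pose dl : R := Num.min (r / 2)%R (i.+1%:R^-1 / n.+1%:R)%R.
  have dl0 : (0 < dl)%R by rewrite lt_min !divr_gt0// invr_gt0.
  have dlr : (2 * dl <= r)%R.
    by rewrite mulrC -ler_pdivlMr// ge_min lexx.
  have dli : (n%:R * dl <= i.+1%:R^-1)%R.
    apply: (@le_trans _ _ (n.+1%:R * dl)%R).
      by rewrite ler_wpM2r ?(ltW dl0)// ler_nat.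
    by rewrite mulrC -ler_pdivlMr// ge_min lexx orbT.
  apply: (le_trans (@MCI_near_cov x s dl e s1 dl0 _)).
    by move=> y xy; apply: hr; exact: (subset_cube dlr).
  apply: lee_wpmul2l; first by rewrite lee_fin.
  apply: ge0_le_integral_nonmeasurable => l Dl; first by rewrite mule_ge0// lee_fin w0.
  rewrite /f; apply: lee_wpmul2l; first by rewrite lee_fin w0.
  rewrite lee_fin !indicE ler_nat.
  have [h|h] := pselect ((2^-1 * (enorm x - 2) - n%:R * dl < l)%R); last by rewrite memNset.
  rewrite [in leqRHS]mem_set ?leq_b1//=.
  by apply: le_lt_trans h; rewrite lerD2l lerN2.
rewrite -[`|_|]/(`|C x|%:E).
have [C0|C0] := leP 0%R (C x).
  by rewrite ger0_norm// -[C x]mul1r sgn// normr1.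
by rewrite ltr0_norm// -mulN1r sgn// normrN1.
Unshelve. all: by end_near. Qed.

End covariance_decay.

(** * Range of dependence *)

Section independence.
Context d (T : measurableType d) (R : realType) (P : probability T R).
Local Open Scope ereal_scope.
Implicit Types G H : set (set T).

(** For fixed [F], the finite measures [E |-> P (E n F)] and [E |-> P F * P E] agree on a pi-system,
    hence on the sigma-algebra it generates. The argument is applied twice, once for each
    variable. *)
Lemma independent_sigma_generated G H :
  G `<=` measurable -> H `<=` measurable -> setI_closed G -> setI_closed H ->
  G setT -> H setT ->
  (forall E F, G E -> H F -> P (E `&` F) = P E * P F) ->
  independent_sigma P <<s G >> <<s H >>.
Proof.
have half G' F : G' `<=` measurable -> setI_closed G' -> G' setT -> measurable F ->
    (forall E, G' E -> P (E `&` F) = P F * P E) ->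
    forall E, <<s G' >> E -> P (E `&` F) = P F * P E.
  move=> mG IG GT mF GF E GE.
  have PFfin : P F \is a fin_num by exact: fin_num_measure.
  have PF0 : (0 <= fine (P F))%R by rewrite fine_ge0.
  have PFE : P F = (fine (P F))%:E by rewrite fineK.
  have scE B : mscale (NngNum PF0) P B = P F * P B by rewrite [in RHS]PFE.
  rewrite -scE -[LHS]/(mrestr P mF E).
  apply: (@g_sigma_algebra_measure_unique _ _ _ G' mG (fun=> setT) (fun=> GT) _
    (mrestr P mF) (mscale (NngNum PF0) P) IG) => //.
  - by apply/seteqP; split => // x _; exists 0%N.
  - by move=> B GB; rewrite [RHS]scE -GF.
  - move=> k; rewrite -[X in X < _]/(P (setT `&` F)) setTI.
    by rewrite (le_lt_trans (probability_le1 P mF))// ltry.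
move=> mG mH IG IH GT HT GH E F GE HF.
have mE : measurable E := sub_sigma_measurable mG GE.
rewrite setIC; apply: (half H E mH IH HT mE _ F HF) => {HF}F HF.
rewrite setIC muleC; have mF := mH _ HF.
apply: (half G F mG IG GT mF _ E GE) => {mE GE}E GE.
by rewrite GH// muleC.
Qed.

End independence.

(** * A pi-system of exceedance events *)

Section field_levels.
Context (R : realType) (n : nat) (dO : measure_display)
  (Omega : measurableType dO) (P : probability Omega R).
Local Notation Rd := 'rV[R]_n.
Variable A : Rd -> Omega -> R.
Hypothesis mA : jointly_measurable A.

Definition exceeds (s : seq (Rd * R)) : set Omega :=
  [set w | forall p, p \in s -> p.2 < A p.1 w].

(** Finite lists encode finite intersections: concatenation makes the family a pi-system, and the
    empty list gives the whole space. *)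
Definition exceedances (S : set Rd) : set (set Omega) :=
  [set exceeds s | s in [set s : seq (Rd * R) | forall p, p \in s -> S p.1]].

Lemma exceeds_cons p s : exceeds (p :: s) = [set w | p.2 < A p.1 w] `&` exceeds s.
Proof.
apply/seteqP; split => w.
  by move=> h; split; [apply: h; rewrite mem_head|move=> q qs; apply: h; rewrite in_cons qs orbT].
by move=> [h1 h2] q; rewrite in_cons => /orP[/eqP ->//|]; exact: h2.
Qed.

Lemma measurable_exceeds s : measurable (exceeds s).
Proof.
elim: s => [|p s ih]; first by rewrite (_ : exceeds [::] = setT)//; apply/seteqP; split.
rewrite exceeds_cons; apply: measurableI => //.
rewrite (_ : [set _ | _] = A p.1 @^-1` `]p.2, +oo[%classic).
  by rewrite -[X in measurable X]setTI; apply: (measurable_field mA).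
by apply/seteqP; split => w /=; rewrite in_itv/= andbT.
Qed.

Lemma setI_closed_exceedances S : setI_closed (exceedances S).
Proof.
move=> _ _ [s hs <-] [t ht <-]; exists (s ++ t).
  by move=> p; rewrite mem_cat => /orP[/hs|/ht].
apply/seteqP; split => w.
  by move=> h; split => p ps; apply: h; rewrite mem_cat ps// orbT.
by move=> [h1 h2] p; rewrite mem_cat => /orP[/h1|/h2].
Qed.

Lemma exceedancesT S : exceedances S setT.
Proof. by exists [::] => //; apply/seteqP; split. Qed.

Lemma field_sigma_exceedances S : field_sigma A S `<=` <<s exceedances S >>.
Proof.
apply: smallest_sub; first exact: smallest_sigma_algebra.
move=> _ [x Sx [B mB <-]]; rewrite setTI.
have : measurable_fun setT (A x : g_sigma_algebraType (exceedances S) -> R).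
  apply: (measurability _ (RGenOInfty.measurableE R)) => _ [_ [a ->] <-].
  apply: sub_sigma_algebra; exists [:: (x, a)].
    by move=> p; rewrite inE => /eqP ->.
  rewrite exceeds_cons setTI; apply/seteqP; split => w /=.
    by move=> [h _]; rewrite in_itv/= andbT.
  by rewrite in_itv/= andbT => h; split.
by move=> /(_ measurableT B mB); rewrite setTI.
Qed.

End field_levels.

Lemma field_sigmaS (R : realType) (n : nat) (dO : measure_display)
    (Omega : measurableType dO) (A : 'rV[R]_n -> Omega -> R) (S T : set 'rV[R]_n) :
  S `<=` T -> field_sigma A S `<=` field_sigma A T.
Proof.
move=> ST; apply: smallest_sub; first exact: smallest_sigma_algebra.
by move=> E [x Sx xE]; apply: sub_sigma_algebra; exists x => //; exact: ST.
Qed.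

Section range_of_dependence.
Context (R : realType) (n : nat) (dO : measure_display)
  (Omega : measurableType dO) (P : probability Omega R).
Local Notation Rd := 'rV[R]_n.
Local Notation leb := (lebesgue_rV R n).
Variables (A : Rd -> Omega -> R) (k : derivative_kind) (M : set (Rd -> R)).
Hypothesis mA : jointly_measurable A.
Local Open Scope ereal_scope.

Lemma edist_set_gap (S T : set Rd) (r : R) : (r%:E < edist_set S T) ->
  exists2 r' : R, (r < r')%R & forall x y, S x -> T y -> (r' <= enorm (x - y)%R)%R.
Proof.
move=> rST; have [r' rr' r'ST] : exists2 r' : R, (r < r')%R & r'%:E <= edist_set S T.
  move: rST; case: (edist_set S T) => [q| |//].
    by rewrite lte_fin => rq; exists q.
  (* The distance is infinite when one of the sets is empty; any larger real number then serves. *)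
  by move=> _; exists (r + 1)%R; rewrite ?ltrDl// leey.
exists r' => // x y Sx Ty; rewrite -lee_fin (le_trans r'ST)//.
by apply: ereal_inf_lbound; exists x => //; exists y.
Qed.

Lemma CI_covariance_le0 (r c : R) X dX Y dY : CI P k M A r c ->
  admissible P k M A X dX -> admissible P k M A Y dY ->
  (forall z, sq_mean P dX (eball z r) = 0 \/ sq_mean P dY (eball z r) = 0) ->
  covariance P X Y <= 0.
Proof.
move=> ci aX aY XY0; apply: (le_trans (ci _ _ _ _ aX aY)).
rewrite integral0_eq ?mule0// => z _.
have p0 : (0 : \bar R) `^ 2^-1 = 0 by rewrite poweR12_sqrt//= sqrtr0.
by case: (XY0 z) => ->; rewrite p0 ?mul0e ?mule0.
Qed.

Lemma covariance_indic (E F : set Omega) : measurable E -> measurable F ->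
  covariance P (\1_E : Omega -> R) (\1_F : Omega -> R) = P (E `&` F) - P E * P F.
Proof.
move=> mE mF.
have L2 (G : set Omega) : measurable G -> (\1_G : Omega -> R) \in Lfun P 2%:E.
  move=> mG; apply: (@bounded_Lfun2 _ _ _ _ _ 1%R); first exact: measurable_indic.
  by move=> w; rewrite indicE ger0_norm// lern1 leq_b1.
have L1 Z : Z \in Lfun P 2%:E -> Z \in Lfun P 1.
  by move=> /Lfun2_integrable /Lfun1_integrable.
have EP (G : set Omega) : measurable G -> 'E_P[(\1_G : Omega -> R)] = P G.
  by move=> mG; rewrite unlock integral_indic// setIT.
have IEF : ((\1_E : Omega -> R) * \1_F = \1_(E `&` F))%R.
  by rewrite indicI.
have mEF : measurable (E `&` F) by exact: measurableI.
rewrite covarianceE ?L1 ?L2// ?IEF ?L1 ?L2//.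
by rewrite EP// (EP _ mE) (EP _ mF).
Qed.

(** The indicator of an event of [sigma(A|_S)] is measurable outside every ball that misses [S], so
    its oscillation there is 0. No ball of radius [rho] meets both sets. *)
Lemma osc_CI_independent (r : R) (S T : set Rd) : k = osc ->
  (forall e : R, (0 < e)%R -> exists2 c : R, (0 < c)%R & CI P k M A (r + e) c) ->
  (2 * r)%:E < edist_set S T ->
  independent_sigma P (field_sigma A S) (field_sigma A T).
Proof.
move=> kosc ci rST; have [r' rr' r'ST] := edist_set_gap rST.
(* This makes [2 * rho = r']: two points of an open ball of radius [rho] are at distance less than
   [r']. *)
have e0 : (0 < (r' - 2 * r) / 2)%R by rewrite divr_gt0// subr_gt0.
have [c c0 {}ci] := ci _ e0; set rho := (r + _)%R in ci.
have mS (Q : set Rd) E : field_sigma A Q E -> measurable E.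
  by apply: sub_sigma_measurable; exact: field_generator_measurable.
have indic_adm (Q : set Rd) E : field_sigma A Q E -> exists dX,
    admissible P k M A (\1_E : Omega -> R) dX /\
    forall z, (forall x, Q x -> ~ eball z rho x) -> sq_mean P dX (eball z rho) = 0.
  move=> QE; have mE := mS _ _ QE.
  have i1 w : (`|\1_E w : R| <= 1)%R by rewrite indicE ger0_norm// lern1 leq_b1.
  have QI (Q' : set Rd) : Q `<=` Q' ->
      sub_measurable_fun (field_sigma A Q') (\1_E : Omega -> R).
    move=> QQ'; apply/sub_measurable_funP; apply: measurable_indic.
    exact: field_sigmaS QE.
  have [dX oX] := is_osc_exists mA (aeW P i1).
  exists dX; split.
    split; [exact: QI| |by rewrite kosc].
    exact: bounded_Lfun2 (measurable_indic mE) i1.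
  move=> z Qz; apply/eqP; rewrite eq_le integral_ge0 ?andbT; last first.
    by move=> w _; rewrite sqre_ge0.
  have := @sq_mean_osc_le _ _ _ _ _ _ mA _ (\1_E) _ (eball z rho) 0%R oX (measurable_eball z rho) (QI _ _).
  rewrite mulr0 expr0n/=; apply.
    by move=> x Qx zx; exact: (Qz x Qx zx).
  by apply: aeW => w; rewrite subrr normr0.
move=> E F SE TF; have mE := mS _ _ SE; have mF := mS _ _ TF.
have gap z : (forall x, S x -> ~ eball z rho x) \/ (forall x, T x -> ~ eball z rho x).
  have [|nS] := pselect (forall x, S x -> ~ eball z rho x); first by left.
  right=> y Ty zy; apply: nS => x Sx zx.
  have := r'ST x y Sx Ty; apply/negP; rewrite -ltNge.
  rewrite -(subrKA z) (le_lt_trans (enormD _ _))//.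
  move: zx zy; rewrite /eball/= [enorm (y - z)]enormB /rho; lra.
have cov_le0 E' : field_sigma A S E' -> P (E' `&` F) - P E' * P F <= 0.
  move=> SE'; rewrite -covariance_indic//; last exact: mS SE'.
  have [dX [aX X0]] := indic_adm _ _ SE'; have [dY [aY Y0]] := indic_adm _ _ TF.
  apply: (CI_covariance_le0 ci aX aY) => z.
  by have [h|h] := gap z; [left; exact: X0|right; exact: Y0].
(* Replacing [E] by its complement changes the sign of the covariance, so the one-sided bound
   becomes an equality. *)
have SCE : field_sigma A S (~` E) by rewrite -setTD; exact: sigma_algebraCD.
have := cov_le0 _ SE; have := cov_le0 _ SCE.
have fin G : measurable G -> P G \is a fin_num by move=> mG; exact: fin_num_measure.
have mEF : measurable (E `&` F) by exact: measurableI.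
have mCEF : measurable (~` E `&` F) by apply: measurableI => //; exact: measurableC.
have PF : P F = P (E `&` F) + P (~` E `&` F).
  rewrite -measureU//; first by rewrite -setIUl setUv setTI.
  by rewrite setIACA setICr set0I.
rewrite probability_setC//.
move: PF (fin _ mE) (fin _ mF) (fin _ mEF) (fin _ mCEF).
case: (P E) => // p; case: (P F) => // q; case: (P (E `&` F)) => // u.
case: (P (~` E `&` F)) => // v [->] _ _ _ _.
by rewrite -!EFinM -!EFinB !lee_fin => h1 h2; congr (_%:E); lra.
Qed.

End range_of_dependence.

(** * Smooth approximation of exceedance indicators *)

Section smoothed_exceedance.
Context (R : realType).
Implicit Types m z : R.

(* A smooth approximation of the indicator of the positive reals: it tends to 1
   for [0 < z] and to 0 for [z <= 0] as [m] tends to infinity. *)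
Definition smooth_pos m z : R := expR (- (m * expR (- (m * z)))).

Lemma smooth_pos_gt0 m z : 0 < smooth_pos m z. Proof. exact: expR_gt0. Qed.

Lemma smooth_pos_le1 m z : 0 <= m -> smooth_pos m z <= 1.
Proof. by move=> m0; rewrite /smooth_pos expR_le1 oppr_le0 mulr_ge0// expR_ge0. Qed.

Lemma measurable_smooth_pos m : measurable_fun setT (smooth_pos m).
Proof.
apply: measurableT_comp; first exact: measurable_expR.
apply: measurableT_comp => //; apply: measurable_funM => //.
apply: measurableT_comp; first exact: measurable_expR.
by apply: measurableT_comp => //; exact: measurable_funM.
Qed.

(** The inequality [y exp(-y) <= 1] at [y = m exp(- m z)]. The derivative of [smooth_pos] is [m]
    times this product, hence at most [m]. *)
Lemma smooth_pos_slope m z : 0 <= m -> smooth_pos m z * (m * expR (- (m * z))) <= 1.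
Proof.
move=> m0; rewrite /smooth_pos expRN mulrC ler_pdivrMr ?expR_gt0// mul1r.
by apply: le_trans (expR_ge1Dx _); rewrite lerDr.
Qed.

(** With [y = m exp(- m z')] and [h = m (z' - z)] the difference is [exp(-y) - exp(- y exp(h))]. For
    [h < 1] it is at most [exp(-y) y (exp(h) - 1)]; there [exp(h) - 1 <= h e], and
    [y e exp(-y) <= 1]. *)
Lemma smooth_pos_lipschitz m z z' : 0 <= m ->
  `|smooth_pos m z - smooth_pos m z'| <= m * `|z - z'|.
Proof.
move=> m0; wlog zz : z z' / z <= z'.
  move=> H; have [/H//|/ltW /H] := leP z z'.
  by rewrite distrC (distrC z').
pose y := m * expR (- (m * z')); pose h := m * (z' - z).
have y0 : 0 <= y by rewrite mulr_ge0// expR_ge0.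
have h0 : 0 <= h by rewrite mulr_ge0// subr_ge0.
have yE : m * expR (- (m * z)) = y * expR h.
  by rewrite /y -mulrA -expRD /h; congr (_ * expR _); ring.
have -> : m * `|z - z'| = h by rewrite distrC ger0_norm// subr_ge0.
have eh : 1 <= expR h by rewrite -expR0 ler_expR.
have yyh : y <= y * expR h by rewrite ler_peMr.
rewrite /smooth_pos yE -/y distrC ger0_norm; last by rewrite subr_ge0 ler_expR lerN2.
(* For [1 <= h] the bound exceeds any difference of two values in [0, 1]. *)
have [h1|h1] := leP 1 h.
  apply: le_trans h1; rewrite lerBlDr (@le_trans _ _ 1)//; last by rewrite lerDl expR_ge0.
  by rewrite expR_le1 oppr_le0.
pose u := expR (- y); have u0 : 0 < u by exact: expR_gt0.
have E1 : expR (- (y * expR h)) = u * expR (- (y * (expR h - 1))).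
  by rewrite /u -expRD; congr expR; ring.
have := expR_ge1Dx (- (y * (expR h - 1))) => H1.
have e1h : expR h - 1 <= h * expR h.
  have := expR_ge1Dx (- h); rewrite expRN => H2.
  have := expR_gt0 h => H3.
  have : (1 - h) * expR h <= 1 by rewrite -ler_pdivlMr// mul1r.
  lra.
have ehe : expR h <= expR 1 by rewrite ler_expR ltW.
have uye : u * (y * expR 1) <= 1.
  have := expR_ge1Dx (y - 1); rewrite addrCA subrr addr0 => H2.
  have E2 : u * expR 1 * expR (y - 1) = 1.
    by rewrite /u -!expRD (_ : _ + _ = 0) ?expR0//; ring.
  rewrite (_ : u * (y * expR 1) = u * expR 1 * y); last by ring.
  by rewrite -[leRHS]E2 ler_wpM2l// mulr_ge0 ?expR_ge0.
have : y * (expR h - 1) <= y * (h * expR 1).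
  rewrite ler_wpM2l// (le_trans e1h)// ler_wpM2l//.
rewrite E1 -/u => H2.
have H3 : u * (1 - expR (- (y * (expR h - 1)))) <= u * (y * (h * expR 1)).
  by rewrite ler_pM2l//; lra.
have H4 : u * (y * (h * expR 1)) <= h.
  rewrite (_ : u * (y * (h * expR 1)) = h * (u * (y * expR 1))); last by ring.
  by rewrite ler_piMr.
lra.
Qed.

Lemma smooth_pos_ge m z : 0 < m -> 0 < z -> 1 - 4 / (m * z ^+ 2) <= smooth_pos m z.
Proof.
move=> m0 z0; have mz0 : 0 < m * z by rewrite mulr_gt0.
apply: (@le_trans _ _ (1 - m * expR (- (m * z)))); last exact: expR_ge1Dx.
rewrite lerD2l lerN2 expRN ler_pdivrMr ?expR_gt0//.
(* A quadratic lower bound is required: a linear one would leave [m exp(- m z)] merely bounded as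
   [m] grows. It is the square of [x <= exp x] at [x = m z / 2]. *)
have E : (m * z) ^+ 2 / 4 <= expR (m * z).
  have -> : m * z = m * z / 2 + m * z / 2 by field.
  rewrite expRD -expr2 (_ : _ / 4 = (m * z / 2) ^+ 2); last by field.
  rewrite lerXn2r ?nnegrE ?expR_ge0 ?divr_ge0 ?ltW//.
  by apply: lt_le_trans (expR_ge1Dx _); rewrite ltrDr.
apply: (@le_trans _ _ (4 / (m * z ^+ 2) * ((m * z) ^+ 2 / 4))).
  by rewrite le_eqVlt; apply/orP; left; apply/eqP; field; rewrite !gt_eqF.
by rewrite ler_wpM2l// divr_ge0// mulr_ge0 ?sqr_ge0 ?ltW.
Qed.

Lemma smooth_pos_le m z : 0 < m -> z <= 0 -> smooth_pos m z <= m^-1.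
Proof.
move=> m0 z0; rewrite /smooth_pos expRN lef_pV2 ?posrE ?expR_gt0//.
apply: (@le_trans _ _ (m * expR (- (m * z)))).
  by rewrite ler_peMr ?(ltW m0)// -expR0 ler_expR oppr_ge0 pmulr_rle0.
by apply: le_trans (expR_ge1Dx _); rewrite lerDr.
Qed.

Lemma smooth_pos_cvg z :
  (fun i : nat => smooth_pos i.+1%:R z) @ \oo --> ((0 < z)%R%:R : R).
Proof.
have inv0 : (fun i : nat => i.+1%:R^-1 : R) @ \oo --> (0 : R) by exact: cvg_harmonic.
have [z0|z0] := ltP 0 z.
  apply: (@squeeze_cvgr _ _ _ _ (fun i : nat => 1 - 4 / z ^+ 2 * i.+1%:R^-1) (fun=> 1)).
  - apply: nearW => i; rewrite smooth_pos_le1// andbT.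
    apply: le_trans (smooth_pos_ge _ z0) => //.
    rewrite lerD2l lerN2 le_eqVlt; apply/orP; left; apply/eqP; field.
    by rewrite (gt_eqF z0) nat1r pnatr_eq0.
  - have := cvgB (cvg_cst (1 : R)) (cvgM (cvg_cst (4 / z ^+ 2)) inv0).
    by rewrite mulr0 subr0; apply.
  - exact: cvg_cst.
apply: (@squeeze_cvgr _ _ _ _ (fun=> 0) (fun i : nat => i.+1%:R^-1)) => //; last exact: cvg_cst.
by apply: nearW => i; rewrite ltW ?smooth_pos_gt0//= smooth_pos_le.
Qed.

Let is_derive_affine (p q x : R) : is_derive x 1 (fun t => p + t * q) q.
Proof.
rewrite (_ : (fun t => p + t * q) = cst p + q *: id); last first.
  by apply/funext => t; rewrite /= /GRing.scale/= mulrC.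
have := is_deriveD (is_derive_cst p x 1) (is_deriveZ q (is_derive_id x 1)).
by rewrite add0r /GRing.scale/= mulr1.
Qed.

Lemma is_derive_smooth_pos m (c b : R) :
  is_derive (0 : R) 1 (fun t => smooth_pos m (c + t * b))
    (smooth_pos m c * (m ^+ 2 * expR (- (m * c)) * b)).
Proof.
have D1 := is_derive_affine (- (m * c)) (- (m * b)) 0.
have D2 := is_derive1_comp (is_derive_expR _) D1.
have D3 := is_derive1_comp (is_derive_affine 0 (- m) _) D2.
have D4 := is_derive1_comp (is_derive_expR _) D3.
move: D4; rewrite (_ : _ \o _ = fun t => smooth_pos m (c + t * b)).
  by move=> D4; apply: (is_derive_eq D4); rewrite /= mul0r addr0 add0r /smooth_pos;
    set E := expR (- (m * c)); rewrite (_ : E * - m = - (m * E)); ring.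
by apply/funext => t; rewrite /smooth_pos/=; congr expR; rewrite add0r mulrN mulrC;
  congr (- (_ * expR _)); ring.
Qed.

End smoothed_exceedance.

Section smoothed_exceedances.
Context (R : realType) (X : eqType).
Implicit Types (m : R) (s : seq (X * R)) (u v : X -> R).

Definition smooth_exceeds m s u : R := \prod_(p <- s) smooth_pos m (u p.1 - p.2).

(** The logarithmic derivative of the factor [p] of [smooth_exceeds] with respect to the value
    [u p.1]. *)
Definition smooth_exceeds_slope m u (p : X * R) : R :=
  m ^+ 2 * expR (- (m * (u p.1 - p.2))).

Lemma smooth_exceeds_ge0 m s u : 0 <= smooth_exceeds m s u.
Proof. by apply: prodr_ge0 => p _; rewrite ltW// smooth_pos_gt0. Qed.

Lemma smooth_exceeds_le1 m s u : 0 <= m -> smooth_exceeds m s u <= 1.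
Proof.
move=> m0; rewrite /smooth_exceeds; elim: s => [|p s ih]; first by rewrite big_nil.
rewrite big_cons mulr_ile1 ?ih ?smooth_pos_le1 ?(ltW (smooth_pos_gt0 _ _))//.
exact: smooth_exceeds_ge0.
Qed.

(** The slope alone is unbounded, but the factor belonging to [p] compensates it and the other
    factors are at most 1. A bounded Gateaux derivative is what puts these variables within reach of
    the inequality. *)
Lemma smooth_exceeds_slope_le m s u p : 0 <= m -> p \in s ->
  smooth_exceeds m s u * smooth_exceeds_slope m u p <= m.
Proof.
move=> m0; rewrite /smooth_exceeds_slope; set E := expR _.
have mE : 0 <= m ^+ 2 * E by rewrite mulr_ge0 ?sqr_ge0 ?expR_ge0.
elim: s => // q s ih; rewrite in_cons /smooth_exceeds big_cons => /orP[/eqP <-|/ih h].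
  rewrite mulrAC (@le_trans _ _ (smooth_pos m (u p.1 - p.2) * (m ^+ 2 * E)))//.
    apply: ler_piMr; last exact: smooth_exceeds_le1.
    by rewrite mulr_ge0// ltW// smooth_pos_gt0.
  rewrite expr2 -mulrA mulrCA -[leRHS]mulr1; apply: ler_wpM2l => //.
  exact: smooth_pos_slope.
rewrite -mulrA (le_trans _ h)// ler_piMl ?smooth_pos_le1//.
by rewrite mulr_ge0// smooth_exceeds_ge0.
Qed.

Lemma smooth_exceeds_lipschitz m s u v : 0 <= m ->
  `|smooth_exceeds m s u - smooth_exceeds m s v| <=
  m * \sum_(p <- s) `|u p.1 - v p.1|.
Proof.
move=> m0; rewrite /smooth_exceeds; elim: s => [|p s ih].
  by rewrite !big_nil subrr normr0 mulr0.
rewrite !big_cons mulrDr; set a := smooth_pos _ _; set b := smooth_pos _ _.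
set a' := \prod_(_ <- _) _; set b' := \prod_(_ <- _) _.
have -> : a * a' - b * b' = (a - b) * a' + b * (a' - b') by ring.
rewrite (le_trans (ler_normD _ _))// !normrM lerD//.
  rewrite (@le_trans _ _ `|a - b|)//.
    by rewrite ler_piMr// ger0_norm ?smooth_exceeds_ge0// smooth_exceeds_le1.
  apply: (le_trans (smooth_pos_lipschitz _ _ m0)).
  by rewrite (_ : u p.1 - p.2 - (v p.1 - p.2) = u p.1 - v p.1)//; ring.
apply: le_trans ih; rewrite ler_piMl// ger0_norm ?smooth_pos_le1//.
by rewrite ltW// smooth_pos_gt0.
Qed.

Lemma is_derive_smooth_exceeds m s u v :
  is_derive (0 : R) 1 (fun t => smooth_exceeds m s (fun x => u x + t * v x))
    (smooth_exceeds m s u * \sum_(p <- s) smooth_exceeds_slope m u p * v p.1).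
Proof.
rewrite /smooth_exceeds /smooth_exceeds_slope; elim: s => [|p s ih].
  rewrite (_ : (fun _ => _) = cst 1); last by apply/funext => t; rewrite big_nil.
  by rewrite !big_nil mulr0; exact: is_derive_cst.
rewrite (_ : (fun _ => _) = (fun t => smooth_pos m (u p.1 - p.2 + t * v p.1)) *
    (fun t => \prod_(q <- s) smooth_pos m (u q.1 + t * v q.1 - q.2))); last first.
  by apply/funext => t; rewrite big_cons addrAC.
apply: (is_derive_eq (is_deriveM (is_derive_smooth_pos m _ _) ih)).
rewrite !big_cons /GRing.scale/= !mul0r !addr0.
have -> : \prod_(q <- s) smooth_pos m (u q.1 + 0 * v q.1 - q.2) =
    \prod_(q <- s) smooth_pos m (u q.1 - q.2).
  by apply: eq_bigr => q _; rewrite mul0r addr0.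
by ring.
Qed.

Lemma smooth_exceeds_cvg s u :
  (fun i : nat => smooth_exceeds i.+1%:R s u) @ \oo -->
    ((all (fun p => (p.2 < u p.1)%R) s)%:R : R).
Proof.
rewrite /smooth_exceeds; elim: s => [|p s ih].
  by under eq_fun do rewrite big_nil; exact: cvg_cst.
under eq_fun do rewrite big_cons.
rewrite /= -mulnb natrM -subr_gt0; apply: cvgM ih; exact: smooth_pos_cvg.
Qed.

End smoothed_exceedances.

Lemma measurable_smooth_exceeds d (T : measurableType d) (R : realType) (X : eqType)
    (m : R) (s : seq (X * R)) (Y : X -> T -> R) :
  (forall x, measurable_fun setT (Y x)) ->
  measurable_fun setT (fun w => smooth_exceeds m s (Y ^~ w)).
Proof.
move=> mY; rewrite /smooth_exceeds; elim: s => [|p s ih].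
  by under eq_fun do rewrite big_nil; exact: measurable_cst.
under eq_fun do rewrite big_cons.
apply: measurable_funM => //.
apply: (measurableT_comp (measurable_smooth_pos m)).
exact: measurable_funB.
Qed.

(** * Smooth functionals of cell averages *)

Section cell_functionals.
Context (R : realType) (n : nat) (dO : measure_display)
  (Omega : measurableType dO) (P : probability Omega R).
Local Notation Rd := 'rV[R]_n.
Local Notation leb := (lebesgue_rV R n).
Local Open Scope ereal_scope.
Variables (A : Rd -> Omega -> R) (M : set (Rd -> R)).
Hypotheses (mA : jointly_measurable A) (sA : stationary P A).
Hypothesis A2 : 'E_P[(fun w => `|A 0%R w| ^+ 2)%R] < +oo.

(** A functional defined on classes of functions cannot read point values of [u]; means over small
    cells replace them. *)
Definition cell_mean (dl : R) (u : Rd -> R) (x : Rd) : R :=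
  ((2 * dl) ^- n * fine (\int[leb]_(y in cell dl x) (u y)%:E))%R.

Lemma measurable_cell_mean dl x : measurable_fun setT (fun w => cell_mean dl (A ^~ w) x).
Proof.
apply: measurable_funM => //.
exact: (measurable_pint leb (measurable_cell dl x) mA).
Qed.

Section fixed_cells.
Variables (dl m sg : R) (s : seq (Rd * R)).
Hypotheses (dl0 : (0 < dl)%R) (m0 : (0 <= m)%R).
Local Notation avg w := (cell_mean dl (A ^~ w)).
Local Notation v := ((2 * dl) ^+ n)%R.

Let v0 : (0 < v)%R. Proof. by rewrite exprn_gt0// mulr_gt0. Qed.

Let Coo x : leb (cell dl x) < +oo.
Proof. by rewrite lebesgue_cell ?ltry// ltW. Qed.

Let F w := (sg * smooth_exceeds m s (avg w))%R.

Let mF : measurable_fun setT F.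
Proof.
apply: measurable_funM => //.
by apply: (measurable_smooth_exceeds m s (Y := fun x w => avg w x)) => x; exact: measurable_cell_mean.
Qed.

(** Chain rule: [F] times the logarithmic derivative of its factor [p], times the density [v^-1] of
    the mean over the cell of [p]. *)
Let coef p w : R := (F w * smooth_exceeds_slope m (avg w) p * v^-1)%R.

Let mcoef p : measurable_fun setT (coef p).
Proof.
apply: measurable_funM => //; apply: measurable_funM => //.
apply: measurable_funM => //; apply: (measurableT_comp (@measurable_expR R)).
apply: measurableT_comp => //; apply: measurable_funM => //.
by apply: measurable_funB => //; exact: measurable_cell_mean.
Qed.

Let coef_le p w : p \in s -> (`|coef p w| <= `|sg| * m / v)%R.
Proof.
move=> ps; rewrite /coef /F normrM [`|v^-1|%R]ger0_norm ?invr_ge0 ?(ltW v0)//.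
rewrite ler_wpM2r ?invr_ge0 ?(ltW v0)// -mulrA normrM ler_wpM2l// ger0_norm.
  exact: smooth_exceeds_slope_le.
by rewrite mulr_ge0 ?smooth_exceeds_ge0// mulr_ge0 ?sqr_ge0 ?expR_ge0.
Qed.

Let g (x : Rd) (w : Omega) : R := (\sum_(p <- s) coef p w * \1_(cell dl p.1) x)%R.

Let mg : jointly_measurable g.
Proof.
rewrite /jointly_measurable /g; elim: s => [|p s' ih].
  by under eq_fun do rewrite big_nil; exact: measurable_cst.
under eq_fun do rewrite big_cons.
apply: measurable_funD => //; apply: measurable_funM.
  by apply: (measurableT_comp (mcoef p)).
by apply: (measurableT_comp (measurable_indic (measurable_cell dl p.1))).
Qed.

Let g_le x w : (`|g x w| <= (size s)%:R * (`|sg| * m / v))%R.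
Proof.
rewrite /g (le_trans (ler_norm_sum _ _ _))//.
rewrite (@le_trans _ _ (\sum_(p <- s) (`|sg| * m / v))%R)//; last first.
  by rewrite big_const_seq count_predT iter_addr_0 [leRHS]mulr_natl.
rewrite big_seq [leRHS]big_seq; apply: ler_sum => p ps.
rewrite normrM (le_trans _ (coef_le w ps))// ler_piMr//.
by rewrite indicE ger0_norm// lern1 leq_b1.
Qed.

Let integral_cells (B : Rd -> R) (c : Rd * R -> R) (t : seq (Rd * R)) :
  B \in Lfun leb +oo ->
  leb.-integrable setT (fun x => (\sum_(p <- t) c p * (B x * \1_(cell dl p.1) x))%:E) /\
  fine (\int[leb]_x (\sum_(p <- t) c p * (B x * \1_(cell dl p.1) x))%:E) =
  (\sum_(p <- t) c p * fine (\int[leb]_(x in cell dl p.1) (B x)%:E))%R.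
Proof.
move=> BLoo.
have one x : leb.-integrable setT (fun y => (B y * \1_(cell dl x) y)%:E) /\
    \int[leb]_y (B y * \1_(cell dl x) y)%:E = \int[leb]_(y in cell dl x) (B y)%:E.
  have E : (fun y => (B y * \1_(cell dl x) y)%:E) = (EFin \o B) \_ (cell dl x).
    apply/funext => y; rewrite patchE indicE.
    by case: ifP => _; rewrite ?mulr1 ?mulr0.
  split; last by rewrite [RHS]integral_mkcond E.
  rewrite E; apply/(integrable_mkcond _ (measurable_cell dl x)).
  exact: (Linfty_integrable BLoo (measurable_cell dl x) (Coo x)).
elim: t => [|p t [iht ihE]].
  under [X in leb.-integrable _ X]eq_fun do rewrite big_nil.
  under eq_integral do rewrite big_nil.
  by rewrite integral0 big_nil; split => //; exact: integrable0.
have [i1 E1] := one p.1.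
have i1c : leb.-integrable setT (fun x => (c p)%:E * (B x * \1_(cell dl p.1) x)%:E).
  exact: integrableZl.
have E : (fun x => (\sum_(p0 <- p :: t) c p0 * (B x * \1_(cell dl p0.1) x))%:E) =
    (fun x => (c p)%:E * (B x * \1_(cell dl p.1) x)%:E) \+
    (fun x => (\sum_(p <- t) c p * (B x * \1_(cell dl p.1) x))%:E).
  by apply/funext => x /=; rewrite big_cons EFinD EFinM.
rewrite E; split; first exact: integrableD.
rewrite big_cons -ihE integralD// fineD ?integrable_fin_num//; congr (_ + _)%R.
by rewrite integralZl// E1 fineM// -E1 integrable_fin_num.
Qed.

(** The derivative is a combination of indicators of the cells with uniformly bounded coefficients:
    it is square integrable, and it vanishes on a ball that misses the cells. *)
Lemma fct_smooth_admissible : open_Linfty M -> (forall w, M (A ^~ w)) -> exists X dX,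
  [/\ admissible P fct M A X dX,
      {ae P, forall w, X w = (sg * smooth_exceeds m s (avg w))%R} &
      forall z r, (forall p y, p \in s -> cell dl p.1 y -> ~ eball z r y) ->
        sq_mean P dX (eball z r) = 0].
Proof.
move=> [MLoo _] MA.
have /choice[Y hY] : forall x, exists y : Omega -> R,
    sub_measurable_fun (field_sigma A setT) y /\
    {ae P, forall w, y w = pint leb (cell dl x) A w}.
  move=> x.
  have [y yP] := avg_modification mA sA A2 (measurable_cell dl x) (Coo x) (@subsetT _ _).
  by exists y.
(* The modifications [Y x] replace the exact cell integrals, which need not be measurable for
   [sigma(A)]. *)
pose X w := (sg * smooth_exceeds m s (fun x => v^-1 * Y x w))%R.
have CT := field_generator_measurable mA (S := setT).
have GX : sub_measurable_fun (field_sigma A setT) X.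
  apply/sub_measurable_funP; apply: measurable_funM => //.
  apply: (@measurable_smooth_exceeds _ (g_sigma_algebraType
    (\bigcup_(x in setT) preimage_set_system setT (A x) measurable)) _ _ m s
    (fun x w => v^-1 * Y x w)%R) => x.
  apply: measurable_funM => //; apply/sub_measurable_funP; exact: (hY x).1.
have mX := sub_measurable_fun_measurable CT GX.
have XE : {ae P, forall w, X w = F w}.
  rewrite /X /F /smooth_exceeds; elim: (s) => [|p t ih].
    by apply: aeW => w; rewrite !big_nil.
  apply: filterS2 ih (hY p.1).2 => w ih Yp; rewrite !big_cons.
  by rewrite mulrCA ih [RHS]mulrCA Yp.
pose dX (S : set Rd) (w : Omega) : \bar R := \int[leb]_(x in S) `|g x w|%:E.
pose Xt (u : Rd -> R) : R := (sg * smooth_exceeds m s (cell_mean dl u))%R.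
exists X, dX; split => //.
- split => //.
    apply: (@bounded_Lfun2 _ _ _ _ _ `|sg|%R) => // w.
    rewrite /X normrM ler_piMr// ger0_norm ?smooth_exceeds_ge0//.
    exact: smooth_exceeds_le1.
  exists Xt, g; split; [| |by move=> S _ _ w].
  + split; last by apply: filterS XE => w ->.
    move=> u u' Mu Mu' uu'; rewrite /Xt; congr (_ * smooth_exceeds _ _ _)%R.
    apply/funext => x; rewrite /cell_mean; congr (_ * fine _)%R.
    have [mu _] := Linfty_bounded (MLoo _ Mu); have [mu' _] := Linfty_bounded (MLoo _ Mu').
    apply: ae_eq_integral => //.
    * exact: measurable_cell.
    * by apply: measurable_funTS; exact/measurable_EFinP.
    * by apply: measurable_funTS; exact/measurable_EFinP.
    * by apply: filterS uu' => y /= -> _.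
  + split => //.
    * move=> r; pose c := ((size s)%:R * (`|sg| * m / v))%R.
      have c0 : (0 <= c)%R by rewrite !mulr_ge0// invr_ge0 ltW.
      apply: (@le_lt_trans _ _ (\int[P]_w ((c%:E * leb (eball 0 r)) ^+ 2))).
        apply: ge0_le_integral_nonmeasurable => w _; first by rewrite sqre_ge0.
        have ge0 : 0 <= \int[leb]_(x in eball 0 r) `|g x w|%:E by exact: integral_ge0.
        rewrite !expe2; suff le1 : \int[leb]_(x in eball 0 r) `|g x w|%:E <= c%:E * leb (eball 0 r).
          exact: lee_pmul.
        rewrite -(integral_cst leb (measurable_eball 0 r)).
        by apply: ge0_le_integral_nonmeasurable => x _ //; rewrite lee_fin g_le.
      rewrite integral_probability_cst.
      have : leb (eball 0 r) \is a fin_num.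
        rewrite ge0_fin_numE//; apply: (@le_lt_trans _ _ (leb (eball 0 `|r|%R))).
          apply: le_measure; rewrite ?inE; [exact: measurable_eball..|].
          by move=> x /= h; apply: lt_le_trans h _; exact: ler_norm.
        by apply: le_lt_trans (lebesgue_eball _ _) _ => //; rewrite ltry.
      by case: (leb _) => // q _; rewrite -EFinM -EFin_expe ltry.
    * move=> B BLoo _; apply: aeW => w.
      (* Cell means are affine in [t], so the Gateaux quotient reduces to the derivative at 0 of a
         function of one real variable. *)
      have lin t x : cell_mean dl (fun y => A y w + t * B y)%R x =
          (avg w x + t * cell_mean dl B x)%R.
        have mCx := measurable_cell dl x.
        have intA := Linfty_integrable (MLoo _ (MA w)) mCx (Coo x).
        have intB := Linfty_integrable BLoo mCx (Coo x).
        rewrite /cell_mean; under eq_integral do rewrite EFinD EFinM.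
        rewrite integralD//; last exact: integrableZl.
        rewrite integralZl// fineD ?integrable_fin_num//; last first.
          by rewrite fin_numM// integrable_fin_num.
        by rewrite fineM ?integrable_fin_num//=; ring.
      have [Dex Dval] := is_derive_smooth_exceeds m s (avg w) (cell_mean dl B).
      have -> : (\int[leb]_x (B x * g x w))%R = (sg * (smooth_exceeds m s (avg w) *
          \sum_(p <- s) smooth_exceeds_slope m (avg w) p * cell_mean dl B p.1))%R.
        rewrite /Rintegral.
        rewrite (eq_integral (fun x =>
            (\sum_(p <- s) coef p w * (B x * \1_(cell dl p.1) x))%:E)); last first.
          move=> x _; congr EFin; rewrite /g mulr_sumr; apply: eq_bigr => p _.
          by rewrite mulrCA.
        rewrite (integral_cells (fun p => coef p w) s BLoo).2 !mulr_sumr.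
        apply: eq_bigr => p _; rewrite /coef /F /cell_mean.
        by ring.
      rewrite -Dval.
      (* This puts the quotient into the literal form unfolded from derivability at 0 in direction
         1. *)
      rewrite (_ : (fun t => _) = (fun t : R => sg * (t^-1 *:
          (((fun t => smooth_exceeds m s (fun x => avg w x + t * cell_mean dl B x)) \o shift 0) (t *: 1)
            - smooth_exceeds m s (fun x => avg w x + 0 * cell_mean dl B x))))%R); last first.
        apply/funext => t; rewrite /Xt /= addr0 [t *: 1%R]mulr1.
        rewrite (funext (lin t)) [t^-1 *: _]mulrC.
        under [X in (_ = _ * ((_ - smooth_exceeds _ _ X) * _))%R]eq_fun do rewrite mul0r addr0.
        by ring.
      by apply: cvgM; [exact: cvg_cst|exact: Dex].
- move=> z r zr; rewrite /sq_mean integral0_eq// => w _.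
  rewrite /dX integral0_eq ?expe2 ?mule0// => x zx.
  rewrite /g big_seq big1 ?normr0// => p ps.
  by rewrite indicE memNset ?mulr0// => px; exact: (zr p x ps px).
Qed.

End fixed_cells.
End cell_functionals.

(** * Covariance of variables with values in the unit interval *)

Section unit_interval_valued.
Context d (T : measurableType d) (R : realType) (P : probability T R).
Implicit Types F G : T -> R.

Definition unit_valued F := measurable_fun setT F /\ forall w, 0 <= F w <= 1.

Lemma unit_valued_norm F w : unit_valued F -> `|F w| <= 1.
Proof. by move=> [_ /(_ w)/andP[F0 F1]]; rewrite ger0_norm. Qed.

Lemma unit_valued_integrable F : unit_valued F -> P.-integrable setT (EFin \o F).
Proof.
by move=> uF; apply: (bounded_integrable P uF.1) => w; exact: unit_valued_norm.
Qed.

Lemma unit_valuedM F G : unit_valued F -> unit_valued G ->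
  unit_valued (fun w => F w * G w).
Proof.
move=> [mF F01] [mG G01]; split; first exact: measurable_funM.
move=> w; have /andP[? ?] := F01 w; have /andP[? ?] := G01 w.
by rewrite mulr_ge0//= mulr_ile1.
Qed.

Lemma Rintegral_unit_valued F : unit_valued F -> `|\int[P]_w F w| <= 1.
Proof.
move=> uF; have iF := unit_valued_integrable uF.
apply: (le_trans (le_normr_Rintegral measurableT iF)).
have P1 : fine (P setT) = 1 by rewrite probability_setT.
rewrite -[leRHS](_ : \int[P]_w 1 = 1); last by rewrite Rintegral_cst// mul1r.
apply: le_Rintegral => //.
- by have := integrable_abse iF.
- by apply: (unit_valued_integrable (F := fun=> 1)); split => // w; rewrite ler01 lexx.
- by move=> w _; exact: unit_valued_norm.
Qed.

Lemma covariance_unit_valued F G : unit_valued F -> unit_valued G ->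
  covariance P F G =
  (\int[P]_w (F w * G w) - (\int[P]_w F w) * (\int[P]_w G w))%:E.
Proof.
move=> uF uG; have L1 H : unit_valued H -> H \in Lfun P 1.
  by move=> /unit_valued_integrable /Lfun1_integrable.
have E H : unit_valued H -> ('E_P[H] = (\int[P]_w H w)%:E)%E.
  move=> uH; rewrite unlock /Rintegral fineK//.
  exact: (integrable_fin_num measurableT (unit_valued_integrable uH)).
have uFG := unit_valuedM uF uG.
by rewrite covarianceE ?L1// !E.
Qed.

(** Since all variables lie in [0, 1], replacing the pair costs [2 * e] in the mean of the product
    and [2 * e] in the product of the means. *)
Lemma product_rule_perturb F F' G G' (e : R) :
  unit_valued F -> unit_valued F' -> unit_valued G -> unit_valued G' ->
  \int[P]_w `|F w - G w| <= e -> \int[P]_w `|F' w - G' w| <= e ->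
  \int[P]_w (G w * G' w) = (\int[P]_w G w) * (\int[P]_w G' w) ->
  `|\int[P]_w (F w * F' w) - (\int[P]_w F w) * (\int[P]_w F' w)| <= 4 * e.
Proof.
move=> uF uF' uG uG' FG FG' GG.
have iB H H' : unit_valued H -> unit_valued H' ->
    P.-integrable setT (EFin \o (fun w => H w - H' w)).
  move=> /unit_valued_integrable iH /unit_valued_integrable iH'.
  by have := integrableB measurableT iH iH'.
have iA H H' : unit_valued H -> unit_valued H' ->
    P.-integrable setT (EFin \o (fun w => `|H w - H' w|)).
  by move=> uH uH'; have := integrable_abse (iB _ _ uH uH').
have dint H H' : unit_valued H -> unit_valued H' ->
    `|\int[P]_w H w - \int[P]_w H' w| <= \int[P]_w `|H w - H' w|.
  move=> uH uH'; rewrite -RintegralB//; try exact: unit_valued_integrable.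
  exact: (le_normr_Rintegral measurableT (iB _ _ uH uH')).
have uFF' := unit_valuedM uF uF'; have uGG' := unit_valuedM uG uG'.
have h1 : `|\int[P]_w (F w * F' w) - \int[P]_w (G w * G' w)| <= 2 * e.
  apply: (le_trans (dint _ _ uFF' uGG')).
  apply: (@le_trans _ _ (\int[P]_w (`|F w - G w| + `|F' w - G' w|))).
    apply: le_Rintegral => //.
    - exact: iA.
    - by have := integrableD measurableT (iA _ _ uF uG) (iA _ _ uF' uG').
    - move=> w _; rewrite (_ : _ - _ = (F w - G w) * F' w + G w * (F' w - G' w)); last by ring.
      rewrite (le_trans (ler_normD _ _))// !normrM lerD//.
        by rewrite ler_piMr// unit_valued_norm.
      by rewrite ler_piMl// unit_valued_norm.
  rewrite RintegralD//; [lra|exact: iA..].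
set a := \int[P]_w F w; set b := \int[P]_w F' w.
set a' := \int[P]_w G w in GG *; set b' := \int[P]_w G' w in GG *.
have ha : `|a - a'| <= e by apply: le_trans FG; exact: dint.
have hb : `|b - b'| <= e by apply: le_trans FG'; exact: dint.
have b1 : `|b| <= 1 by exact: Rintegral_unit_valued.
have a1 : `|a'| <= 1 by exact: Rintegral_unit_valued.
have h2 : `|a' * b' - a * b| <= 2 * e.
  rewrite (_ : _ - _ = a' * (b' - b) + (a' - a) * b); last by ring.
  rewrite (le_trans (ler_normD _ _))// !normrM (distrC b') (distrC a').
  have : `|a'| * `|b - b'| <= `|b - b'| by rewrite ler_piMl.
  have : `|a - a'| * `|b| <= `|a - a'| by rewrite ler_piMr.
  lra.
rewrite (_ : _ - _ = (\int[P]_w (F w * F' w) - a' * b') + (a' * b' - a * b)); last by ring.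
by rewrite -GG (le_trans (ler_normD _ _))//; rewrite GG in h1 *; lra.
Qed.

Lemma unit_valued_smooth_exceeds (X : eqType) (m : R) (s : seq (X * R)) (Y : X -> T -> R) :
  0 <= m -> (forall x, measurable_fun setT (Y x)) ->
  unit_valued (fun w => smooth_exceeds m s (Y ^~ w)).
Proof.
move=> m0 mY; split; first exact: measurable_smooth_exceeds.
by move=> w; rewrite smooth_exceeds_ge0 smooth_exceeds_le1.
Qed.

End unit_interval_valued.

(** * Approximation of point values by cell averages *)

Section smoothing_by_averages.
Context (R : realType) (n : nat) (dO : measure_display)
  (Omega : measurableType dO) (P : probability Omega R).
Local Notation Rd := 'rV[R]_n.
Local Notation leb := (lebesgue_rV R n).
Variables (A : Rd -> Omega -> R).
Hypotheses (mA : jointly_measurable A) (sA : stationary P A).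
Local Open Scope ereal_scope.
Hypothesis A2 : 'E_P[(fun w => `|A 0%R w| ^+ 2)%R] < +oo.

(** From mean-square continuity with tolerance [e^2], by [|t| <= e / 2 + t^2 / (2 e)]; stationarity
    extends it to every base point. *)
Lemma field_L1_uniformly_continuous (e : R) : (0 < e)%R -> exists2 r : R, (0 < r)%R &
  forall x y : Rd, cube r (y - x)%R -> \int[P]_w `|A y w - A x w|%:E <= e%:E.
Proof.
move=> e0; have e20 : (0 < e ^+ 2)%R by rewrite exprn_gt0.
have [r r0 hr] := field_L2_continuous mA sA A2 e20.
exists r => // x y xy.
have mB : measurable_fun setT (fun w => A y w - A x w)%R.
  by apply: measurable_funB; exact: measurable_field.
have c0 : (0 <= (2 * e)^-1)%R by rewrite invr_ge0 mulr_ge0// ltW.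
apply: (@le_trans _ _ (\int[P]_w ((e / 2)%:E + ((2 * e)^-1)%:E * ((A y w - A x w) ^+ 2)%:E))).
  apply: ge0_le_integral => //.
  - exact/measurable_EFinP/measurableT_comp.
  - apply: emeasurable_funD => //; apply: measurable_funeM.
    exact/measurable_EFinP/measurable_funX.
  - move=> w _; rewrite -EFinM -EFinD lee_fin.
    rewrite -[((A y w - A x w) ^+ 2)%R]real_normK ?num_real//.
    set t := `|_|%R; have := sqr_ge0 (t - e)%R; rewrite sqrrB => H.
    rewrite -(@ler_pM2r _ (2 * e)%R) ?mulr_gt0//.
    have -> : ((e / 2 + (2 * e)^-1 * t ^+ 2) * (2 * e) = e ^+ 2 + t ^+ 2)%R.
      by field; rewrite gt_eqF.
    by move: H; rewrite -mulr_natr; lra.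
have m2 : measurable_fun setT (fun w => ((A y w - A x w) ^+ 2)%:E).
  exact/measurable_EFinP/measurable_funX.
rewrite ge0_integralD//; last 3 first.
- by move=> w _; rewrite lee_fin divr_ge0// ltW.
- by move=> w _; rewrite -EFinM lee_fin mulr_ge0// sqr_ge0.
- exact: measurable_funeM.
rewrite integral_probability_cst ge0_integralZl//; last first.
  by move=> w _; rewrite lee_fin sqr_ge0.
have -> : (e%:E = (e / 2)%:E + ((2 * e)^-1 * e ^+ 2)%:E).
  by rewrite -EFinD; congr EFin; field; rewrite gt_eqF.
rewrite leeD2l// [leRHS]EFinM lee_wpmul2l ?lee_fin//; apply: le_trans (hr _ xy).
rewrite -(stationary_integral2 mA sA (y - x)%R 0%R x (psi := fun p => (p.1 - p.2) ^+ 2)%R).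
  by rewrite subrK add0r.
by apply: measurable_funX; exact: measurable_funB.
Qed.

(** The error is the mean over the cell of [A y - A x], so Fubini reduces it to continuity in L^1,
    uniformly in [x]. The identity holds only for those [w], almost all, at which [A] is integrable
    on the cell. *)
Lemma cell_mean_L1 (e : R) : (0 < e)%R -> exists2 r : R, (0 < r)%R &
  forall dl x, (0 < dl)%R -> (dl <= r)%R ->
    \int[P]_w `|cell_mean dl (A ^~ w) x - A x w|%:E <= e%:E.
Proof.
move=> e0; have [r r0 hr] := field_L1_uniformly_continuous e0.
exists r => // dl x dl0 dlr.
have mC := measurable_cell dl x.
have Cv : leb (cell dl x) = ((2 * dl) ^+ n)%:E by rewrite lebesgue_cell// ltW.
set v := ((2 * dl) ^+ n)%R in Cv.
have v0 : (0 < v)%R by rewrite exprn_gt0// mulr_gt0.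
have Coo : leb (cell dl x) < +oo by rewrite Cv ltry.
pose X y w : R := `|A y w - A x w|%R.
have mAx : measurable_fun setT (fun p : Rd * Omega => A x p.2).
  by apply: (@measurableT_comp _ _ _ _ _ _ (A x)) => //; exact: measurable_field.
have mX : measurable_fun [set: Rd * Omega] (fun p => X p.1 p.2).
  by apply: measurableT_comp => //; apply: measurable_funB.
have Xe y : cell dl x y -> \int[P]_w `|X y w|%:E <= e%:E.
  move=> xy; under eq_integral do rewrite /X normr_id.
  by apply: hr; exact: (subset_cube dlr).
have [c1 h1] := field_L1_bound mA sA A2.
have [intp pE] := integral_pint mC Coo mX Xe.
have pint0 w : (0 <= pint leb (cell dl x) X w)%R.
  by apply: fine_ge0; apply: integral_ge0 => y _; rewrite lee_fin normr_ge0.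
apply: (@le_trans _ _ (\int[P]_w ((v^-1)%:E * (pint leb (cell dl x) X w)%:E))).
  apply: ae_ge0_le_integral => //.
  - apply/measurable_EFinP/measurableT_comp => //; apply: measurable_funB.
      exact: measurable_cell_mean.
    exact: measurable_field.
  - by move=> w _; rewrite -EFinM lee_fin mulr_ge0// invr_ge0 ltW.
  - by apply: measurable_funeM; exact: (measurable_int _ intp).
  apply: filterS2 (ae_integrable_param mC Coo mX Xe)
    (ae_integrable_param mC Coo mA (fun y _ => h1 y)) => w iX iA _.
  have intc : leb.-integrable (cell dl x) (fun=> (A x w)%:E).
    apply/integrableP; split; first exact: measurable_cst.
    by rewrite (integral_cst leb mC `|A x w|%:E) lte_mul_pinfty.
  have iD : leb.-integrable (cell dl x) (fun y => (A y w - A x w)%:E).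
    by have := integrableB mC iA intc.
  have -> : (cell_mean dl (A ^~ w) x - A x w =
      v^-1 * fine (\int[leb]_(y in cell dl x) (A y w - A x w)%:E))%R.
    under eq_integral do rewrite EFinB.
    rewrite (integralB mC iA intc) fineB ?integrable_fin_num//.
    have -> : \int[leb]_(_ in cell dl x) (A x w)%:E = (A x w * v)%:E.
      by rewrite EFinM -Cv; exact: (integral_cst leb mC (A x w)%:E).
    rewrite /cell_mean -/v mulrBr; congr (_ - _)%R.
    by rewrite /= mulrCA mulVf ?mulr1// gt_eqF.
  rewrite -EFinM lee_fin normrM ger0_norm ?invr_ge0 ?(ltW v0)//.
  rewrite ler_wpM2l ?invr_ge0 ?(ltW v0)//.
  exact: (le_normr_Rintegral mC iD).
rewrite ge0_integralZl//; last 3 first.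
- exact: (measurable_int _ intp).
- by move=> w _; rewrite lee_fin.
- by rewrite lee_fin invr_ge0 ltW.
rewrite pE (@le_trans _ _ ((v^-1)%:E * (e%:E * v%:E)))//; last first.
  by rewrite -!EFinM lee_fin le_eqVlt; apply/orP; left; apply/eqP; field; rewrite gt_eqF.
rewrite lee_wpmul2l ?lee_fin ?invr_ge0 ?(ltW v0)// -Cv -(integral_cst leb mC).
apply: ge0_le_integral_nonmeasurable => y xy.
  by apply: integral_ge0 => w _; rewrite lee_fin normr_ge0.
by apply: le_trans (Xe y xy); under [leRHS]eq_integral do rewrite normr_id.
Qed.

Lemma smooth_exceeds_L1 (m e : R) (s : seq (Rd * R)) : (0 <= m)%R -> (0 < e)%R ->
  exists2 r : R, (0 < r)%R & forall dl, (0 < dl)%R -> (dl <= r)%R ->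
    (\int[P]_w `|smooth_exceeds m s (A ^~ w) - smooth_exceeds m s (cell_mean dl (A ^~ w))| <= e)%R.
Proof.
(* Each point of [s] contributes with Lipschitz constant [m]; the added 1 keeps the denominator
   positive for an empty list or [m = 0]. *)
move=> m0 e0; pose e' := (e / (m * (size s)%:R + 1))%R.
have den0 : (0 < m * (size s)%:R + 1)%R by rewrite ltr_wpDl// mulr_ge0.
have e'0 : (0 < e')%R by rewrite divr_gt0.
have [r r0 hr] := cell_mean_L1 e'0; exists r => // dl dl0 dlr.
have mD p : measurable_fun setT (fun w => `|A p w - cell_mean dl (A ^~ w) p|%R).
  apply: measurableT_comp => //; apply: measurable_funB; first exact: measurable_field.
  exact: measurable_cell_mean.
rewrite -lee_fin /Rintegral fineK; last first.
  have uA : unit_valued (fun w => smooth_exceeds m s (A ^~ w)).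
    by apply: unit_valued_smooth_exceeds => // x; exact: measurable_field.
  have uC : unit_valued (fun w => smooth_exceeds m s (cell_mean dl (A ^~ w))).
    apply: (@unit_valued_smooth_exceeds _ Omega _ _ m s (fun x w => cell_mean dl (A ^~ w) x)) => // x.
    exact: measurable_cell_mean.
  have := integrableB measurableT (unit_valued_integrable P uA) (unit_valued_integrable P uC).
  by move=> /integrable_abse /(integrable_fin_num measurableT).
apply: (@le_trans _ _ (\int[P]_w (m%:E * \sum_(p <- s) `|A p.1 w - cell_mean dl (A ^~ w) p.1|%:E))).
  apply: ge0_le_integral_nonmeasurable => w _ //.
  rewrite sumEFin -EFinM lee_fin; exact: smooth_exceeds_lipschitz.
rewrite ge0_integralZl//; last 2 first.
- by apply: emeasurable_sum => p; exact/measurable_EFinP.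
- by move=> w _; apply: sume_ge0.
rewrite ge0_integral_sum//; last first.
  by move=> p; exact/measurable_EFinP.
apply: (@le_trans _ _ (m%:E * \sum_(p <- s) e'%:E)).
  rewrite lee_wpmul2l ?lee_fin//; apply: lee_sum => p _.
  by under eq_integral do rewrite distrC; exact: hr.
rewrite sumEFin -EFinM lee_fin big_const_seq count_predT iter_addr_0 -[(e' *+ _)%R]mulr_natl.
rewrite mulrA /e' mulrCA ler_piMr ?(ltW e0)// ler_pdivrMr// mul1r lerDl//.
Qed.

Variable M : set (Rd -> R).
Hypothesis MA : open_Linfty M /\ forall w, M (A ^~ w).

Section separated_sets.
Variables (S T : set Rd) (r r' : R).
Hypotheses (rr' : (2 * r < r')%R)
  (gap : forall x y, S x -> T y -> (r' <= enorm (x - y)%R)%R).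
Hypothesis ci : forall e : R, (0 < e)%R -> exists2 c : R, (0 < c)%R & CI P fct M A (r + e) c.

(** With [m] fixed, the functionals of small cells are uncorrelated by the inequality; shrinking the
    cells passes this on to the field values themselves. *)
Lemma fct_CI_smooth_uncorrelated (m : R) (s t : seq (Rd * R)) : (0 <= m)%R ->
  (forall p, p \in s -> S p.1) -> (forall p, p \in t -> T p.1) ->
  (\int[P]_w (smooth_exceeds m s (A ^~ w) * smooth_exceeds m t (A ^~ w)) =
   (\int[P]_w smooth_exceeds m s (A ^~ w)) * (\int[P]_w smooth_exceeds m t (A ^~ w)))%R.
Proof.
(* A quarter of the gap: [2 (r + e) = r' - 2 e], and the cells enlarge the reach by [2 n dl <= e]
   only. *)
move=> m0 sS tT; pose e := ((r' - 2 * r) / 4)%R.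
have e0 : (0 < e)%R by rewrite divr_gt0// subr_gt0.
have [c c0 cie] := ci e0; pose rho := (r + e)%R.
have uA q : unit_valued (fun w => smooth_exceeds m q (A ^~ w)).
  by apply: unit_valued_smooth_exceeds => // x; exact: measurable_field.
have uC dl q : unit_valued (fun w => smooth_exceeds m q (cell_mean dl (A ^~ w))).
  apply: (@unit_valued_smooth_exceeds _ Omega _ _ m q (fun x w => cell_mean dl (A ^~ w) x)) => // x.
  exact: measurable_cell_mean.
apply/eqP; rewrite -subr_eq0 -normr_le0; apply/ler_addgt0Pl => eta eta0; rewrite addr0.
have eta40 : (0 < eta / 4)%R by rewrite divr_gt0.
have [r1 r10 h1] := smooth_exceeds_L1 s m0 eta40.
have [r2 r20 h2] := smooth_exceeds_L1 t m0 eta40.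
pose dl := Num.min (Num.min r1 r2) (e / 2 / n.+1%:R)%R.
have dl0 : (0 < dl)%R by rewrite !lt_min r10 r20/= divr_gt0// divr_gt0.
have dl1 : (dl <= r1)%R by rewrite !ge_min lexx.
have dl2 : (dl <= r2)%R by rewrite !ge_min lexx orbT.
have ndl : (n%:R * dl <= e / 2)%R.
  apply: (@le_trans _ _ (n.+1%:R * dl)%R); first by rewrite ler_wpM2r ?(ltW dl0)// ler_nat.
  by rewrite mulrC -ler_pdivlMr// ge_min lexx orbT.
have -> : (eta = 4 * (eta / 4))%R by field.
apply: (product_rule_perturb (uA s) (uA t) (uC dl s) (uC dl t) (h1 dl dl0 dl1) (h2 dl dl0 dl2)).
have [X [dX [aX XE dX0]]] := fct_smooth_admissible mA sA A2 1%R s dl0 m0 MA.1 MA.2.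
(* The inequality bounds the covariance from above; taking [sg] equal to 1 and to -1 forces it to
   vanish. *)
have le0 sg : (sg * (\int[P]_w (smooth_exceeds m s (cell_mean dl (A ^~ w)) *
      smooth_exceeds m t (cell_mean dl (A ^~ w))) -
    (\int[P]_w smooth_exceeds m s (cell_mean dl (A ^~ w))) *
    (\int[P]_w smooth_exceeds m t (cell_mean dl (A ^~ w)))) <= 0)%R.
  have [Y [dY [aY YE dY0]]] := fct_smooth_admissible mA sA A2 sg t dl0 m0 MA.1 MA.2.
  have L2 q : (fun w => smooth_exceeds m q (cell_mean dl (A ^~ w))) \in Lfun P 2%:E.
    by apply: (bounded_Lfun2 P (uC dl q).1 (M := 1%R)) => w; exact: (unit_valued_norm w (uC dl q)).
  rewrite -lee_fin EFinM -covariance_unit_valued// -(covarianceZr2 sg (L2 s) (L2 t)).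
  have mX : measurable_fun setT X by case: aX => _ /Lfun2_measurable.
  have mY : measurable_fun setT Y by case: aY => _ /Lfun2_measurable.
  rewrite -(covariance_ae_eq mX (uC dl s).1 mY (measurable_funM (measurable_cst sg) (uC dl t).1) _ YE).
    apply: (CI_covariance_le0 cie aX aY) => z.
    have [hS|nS] := pselect (forall p y, p \in s -> cell dl p.1 y -> ~ eball z rho y).
      by left; exact: dX0.
    right; apply: dY0 => q y' qt ty' zy'; apply: nS => p y ps sy zy.
    have := gap (sS p ps) (tT q qt); apply/negP; rewrite -ltNge.
    have np := enorm_cell sy; have nq := enorm_cell ty'.
    have : (enorm (p.1 - q.1) <= enorm (p.1 - y) + enorm (y - z) + (enorm (z - y') + enorm (y' - q.1)))%R.
      apply: (le_trans _ (lerD (enormD _ _) (enormD _ _))).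
      by apply: (le_trans _ (enormD _ _)); rewrite !subrKA.
    move: zy zy'; rewrite /eball/= (enormB p.1 y) (enormB z y') /rho /e in e0 ndl *; lra.
  by apply: filterS XE => w ->; rewrite mul1r.
have := le0 1%R; have := le0 (-1)%R; rewrite mul1r mulN1r.
lra.
Qed.

(** As [m] tends to infinity, dominated convergence turns the smooth product rule into that of
    exceedance events. Concatenating lists multiplies the smooth products and intersects the
    events. *)
Lemma fct_CI_independent : independent_sigma P (field_sigma A S) (field_sigma A T).
Proof.
have mex Q : exceedances A Q `<=` measurable.
  by move=> _ [s _ <-]; exact: measurable_exceeds.
have H : independent_sigma P <<s exceedances A S >> <<s exceedances A T >>.
  apply: independent_sigma_generated => //; try exact: setI_closed_exceedances;
    try exact: exceedancesT.
  move=> _ _ [s sS <-] [t tT <-].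
  have ind q w : (all (fun p => (p.2 < A p.1 w)%R) q)%:R = \1_(exceeds A q) w :> R.
    rewrite indicE; congr (_ _)%:R; apply/allP/idP => [h|]; first exact/mem_set.
    by rewrite inE.
  have mA1 x : measurable_fun setT (A x) by exact: measurable_field.
  have uA i q : unit_valued (fun w => smooth_exceeds i.+1%:R q (A ^~ w)).
    exact: unit_valued_smooth_exceeds.
  have cv q : \int[P]_w (smooth_exceeds i.+1%:R q (A ^~ w))%:E @[i --> \oo] --> P (exceeds A q).
    rewrite -[X in P X]setIT -integral_indic//; last exact: measurable_exceeds.
    apply: (@dominated_cvg _ _ _ P setT _ (fun i w => (smooth_exceeds i.+1%:R q (A ^~ w))%:E)
      _ (fun=> 1)) => //.
    - by move=> i; apply/measurable_EFinP; exact: (uA i q).1.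
    - by move=> w _; rewrite -ind; apply: cvg_EFin; [exact: nearW|exact: smooth_exceeds_cvg].
    - exact: finite_measure_integrable_cst.
    - by move=> i w _; rewrite lee_fin; exact: (unit_valued_norm w (uA i q)).
  have cv2 : \int[P]_w (smooth_exceeds i.+1%:R (s ++ t) (A ^~ w))%:E @[i --> \oo] -->
      P (exceeds A s) * P (exceeds A t).
    rewrite [X in X @ _ --> _](_ : _ = fun i : nat =>
      \int[P]_w (smooth_exceeds i.+1%:R s (A ^~ w))%:E *
      \int[P]_w (smooth_exceeds i.+1%:R t (A ^~ w))%:E).
      apply: cvgeM => //; apply: mule_def_fin; apply: fin_num_measure; exact: measurable_exceeds.
    apply/funext => i.
    have fin q := integrable_fin_num measurableT (unit_valued_integrable P (uA i q)).
    rewrite -(fineK (fin (s ++ t))) -(fineK (fin s)) -(fineK (fin t)) -EFinM.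
    congr EFin; rewrite -[RHS]fct_CI_smooth_uncorrelated//.
    by congr fine; apply: eq_integral => w _; rewrite /= /smooth_exceeds big_cat.
  have -> : exceeds A s `&` exceeds A t = exceeds A (s ++ t).
    apply/seteqP; split => w.
      by move=> [h1 h2] p; rewrite mem_cat => /orP[/h1|/h2].
    by move=> h; split => p ps; apply: h; rewrite mem_cat ps// orbT.
  by rewrite -(cvg_lim _ (cv (s ++ t)))//; exact: cvg_lim.
by move=> E F SE TF; apply: H; exact: field_sigma_exceedances.
Qed.

End separated_sets.

End smoothing_by_averages.

(** The constants must be fixed before the probability space and the field. The one from
    [truncated_sum_weight] depends on [a] and [d] only and is selected by choice; [a = 0] has its
    own bound. *)
Lemma choose_weight_constants (R : realType) (d : nat) (K : R) : (0 < d)%N ->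
  exists Ca : R -> R, forall (a : R) (dO : measure_display)
    (Omega : measurableType dO) (P : probability Omega R)
    (A : 'rV[R]_d -> Omega -> R) (k : derivative_kind) (M : set ('rV[R]_d -> R)),
  0 <= a -> jointly_measurable A -> stationary P A ->
  ('E_P[(fun w => `|A 0 w| ^+ 2)%R] < +oo)%E ->
  (k = osc -> bounded_field P A K) ->
  (k = fct -> open_Linfty M /\ forall w, M (A ^~ w)) ->
  (forall x, 0 <= cov P A x) ->
  forall w : R -> R, is_weight w -> MSG P k M A w ->
  (\int[lebesgue_rV R d]_x ((1 + enorm x) `^ (- a) * cov P A x)%:E
   <= (Ca a)%:E * weight_bound d a w)%E.
Proof.
move=> d0; pose K2 := osc_const K ^+ 2.
have ex (a : R) : exists c : R, 0 < a -> 0 < c /\ forall N l, 0 <= l ->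
    truncated_sum (2 `^ (- a)) d N (l + 1) <= c * weight_kernel d a l.
  have [a0|_] := ltP 0 a; last by exists 0.
  by have [c c0 hc] := truncated_sum_weight d0 a0; exists c.
have [c hc] := choice ex.
exists (fun a => if a == 0 then K2 * 8 ^+ d else K2 * 32 ^+ d * c a).
move=> a dO Omega P A k M a0 mA sA A2 bA MA C0 w hw msg.
case: eqVneq => [->|an0]; first exact: (MSG_cov_weighted0 mA sA A2 bA MA C0 hw msg d0).
have a1 : 0 < a by rewrite lt_neqAle eq_sym an0.
by have [c0 h] := hc a a1; exact: (MSG_cov_weighted mA sA A2 bA MA C0 hw msg a0 c0 h).
Qed.

Theorem proposition1p3 (R : realType) (d : nat) (hd : (0 < d)%N)
    (k : derivative_kind) (K : R) :
  exists (C : R) (Ca : R -> R),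
  forall (dO : measure_display) (Omega : measurableType dO)
    (P : probability Omega R) (A : 'rV[R]_d -> Omega -> R)
    (M : set ('rV[R]_d -> R)),
  jointly_measurable A ->
  stationary P A ->
  ('E_P[(fun w => `|A 0 w| ^+ 2)%R] < +oo)%E ->
  (k = osc -> bounded_field P A K) ->
  (k = fct -> open_Linfty M /\ forall w, M (A ^~ w)) ->
  [/\
    (* (i) *)
    forall r c : R, 0 < r -> 0 < c -> SG P k M A r c ->
      (forall x, (0 <= autocovariance P A x)%E) ->
      (lebesgue_rV R d).-integrable setT (autocovariance P A),
    (* (ii) *)
    forall w : R -> R, is_weight w -> MSG P k M A w ->
      (forall x, (0 <= autocovariance P A x)%E) ->
      ((\int[lebesgue_measure]_(l in `[0%R, +oo[) (l ^+ d * w l)%:E < +oo)%E ->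
       (lebesgue_rV R d).-integrable setT (autocovariance P A)) /\
      (forall a : R, 0 <= a ->
        (\int[lebesgue_rV R d]_x
            (((1 + enorm x) `^ (- a))%:E * autocovariance P A x)
         <= (Ca a)%:E * weight_bound d a w)%E),
    (* (iii) *)
    forall r : R, 0 <= r ->
      (forall e : R, 0 < e -> exists2 c : R, 0 < c & CI P k M A (r + e) c) ->
      forall S T : set 'rV[R]_d, measurable S -> measurable T ->
        ((2 * r)%:E < edist_set S T)%E ->
        independent_sigma P (field_sigma A S) (field_sigma A T) &
    (* (iv) *)
    forall w : R -> R, is_weight w -> MCI P k M A w ->
      forall x : 'rV[R]_d,
        (`|autocovariance P A x| <=
         C%:E * \int[lebesgue_measure]_(l in
                  `[Num.max (2^-1 * (enorm x - 2))%R 0%R, +oo[) (w l)%:E)%E].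
Proof.
have [Ca hCa] := choose_weight_constants K hd.
exists (osc_const K ^+ 2 * 2 ^+ d), Ca.
move=> dO Omega P A M mA sA A2 bA MA.
have C0 : (forall x, 0 <= autocovariance P A x)%E -> forall x, 0 <= cov P A x.
  by move=> h x; rewrite -lee_fin -(covE mA sA A2).
split.
- move=> r c r0 c0 sg /C0 h; exact: (SG_cov_integrable mA sA A2 bA MA h r0 c0 sg).
- move=> w hw msg /C0 h; split.
    exact: (MSG_cov_integrable mA sA A2 bA MA h hw msg).
  move=> a a0; apply: le_trans (hCa a _ _ P A k M a0 mA sA A2 bA MA h w hw msg).
  rewrite le_eqVlt; apply/orP; left; apply/eqP; apply: eq_integral => x _.
  by rewrite (covE mA sA A2) EFinM.
- move=> r r0 ci S T mS mT rST; case: k bA MA ci => [_ _|_ MA] ci.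
    exact: (osc_CI_independent mA erefl ci rST).
  have [r' rr' gap] := edist_set_gap rST.
  exact: (fct_CI_independent mA sA A2 (MA erefl) rr' gap ci).
- by move=> w hw mci x; exact: (MCI_cov mA sA A2 bA MA hw mci x).
Qed.
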